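(* Let $k,d\ge 1$ be fixed integers and let $P$ be a probability distribution on $\mathbb{R}^d$ such that: (1) (Peak power constraint) $P(\mathcal{B}(0,1))=1$; (2) (Pollard's regularity condition) $P$ has a continuous density $f$ with respect to Lebesgue measure on $\mathbb{R}^d$, and the Hessian matrix of the map $\mathbf{c}\mapsto P\gamma(\mathbf{c},\cdot)$ is positive definite at every optimal vector of clusters $\mathbf{c}^*\in\mathcal{M}$. Then there is a positive constant $C_0$, depending only on $P$, $k$ and $d$, such that for every $n\ge 1$, if $X_1,\dots,X_n$ are i.i.d. with distribution $P$ and $\hat{\mathbf{c}}_n$ is an empirical risk minimizer, i.e. $\hat{\mathbf{c}}_n\in\arg\min_{\mathbf{c}\in(\mathbb{R}^d)^k}P_n\gamma(\mathbf{c},\cdot)$, then for $\mathbf{c}^*\in\mathcal{M}$ $$\mathbb{E}\,\ell(\hat{\mathbf{c}}_n,\mathbf{c}^* )\le\frac{C_0}{n}.$$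
   Context: $\|\cdot\|$ is the Euclidean norm, and $\mathcal{B}(0,1)$ is the closed unit ball of $\mathbb{R}^d$. For $\mathbf{c}=(c_1,\dots,c_k)\in(\mathbb{R}^d)^k$ and $x\in\mathbb{R}^d$, $\gamma(\mathbf{c},x)=\min_{j=1,\dots,k}\|x-c_j\|^2$. For a function $g$, $Pg$ denotes the integral of $g$ with respect to $P$, and $P_ng=\frac1n\sum_{i=1}^n g(X_i)$, where $P_n$ is the empirical distribution of the sample $X_1,\dots,X_n$. The risk is $R(\mathbf{c})=P\gamma(\mathbf{c},\cdot)$, $\mathcal{M}$ is the (nonempty) set of minimizers of $R$ over $(\mathbb{R}^d)^k$, whose elements are called optimal vectors of clusters, and $\ell(\mathbf{c},\mathbf{c}^* )=R(\mathbf{c})-R(\mathbf{c}^* )$ for $\mathbf{c}^*\in\mathcal{M}$ (the value does not depend on which $\mathbf{c}^*\in\mathcal{M}$ is chosen). Under (1) and the continuity of the density, the map $\mathbf{c}\mapsto P\gamma(\mathbf{c},\cdot)$ is twice differentiable at the optimal vectors, so that the Hessian in (2) makes sense. *)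

(* Defs.v *)
From HB Require Import structures.
From mathcomp Require Import all_boot all_order all_algebra.
From mathcomp Require Import all_classical all_reals all_analysis.
From mathcomp Require Import measurable_realfun lra.

Set Implicit Arguments.
Unset Strict Implicit.
Unset Printing Implicit Defensive.

Import Order.TTheory GRing.Theory Num.Theory.
Import numFieldTopology.Exports numFieldNormedType.Exports.

Local Open Scope classical_set_scope.
Local Open Scope ring_scope.

(* 'M[R]_(m, n) carries the sigma-algebra generated by its entries, which is
   the Borel one ([open_measurable_mx]). A point of R^d is a row vector 'rV_d,
   and a codebook c = (c_1, ..., c_k) is the matrix 'M_(k, d) whose j-th row
   is c_j. *)
Section measurable_matrix.
Context {R : realType} {m n : nat}.

Definition mx_measurable : set (set 'M[R]_(m, n)) :=
  <<s [set A | exists i j (B : set R),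
         measurable B /\ A = (fun M : 'M[R]_(m, n) => M i j) @^-1` B] >>.

Let mx_measurable0 : mx_measurable set0.
Proof. exact: sigma_algebra0. Qed.

Let mx_measurableC A : mx_measurable A -> mx_measurable (~` A).
Proof. exact: sigma_algebraC. Qed.

Let mx_measurable_bigcup (F : (set 'M[R]_(m, n))^nat) :
  (forall i, mx_measurable (F i)) -> mx_measurable (\bigcup_i F i).
Proof. exact: sigma_algebra_bigcup. Qed.

HB.instance Definition _ := @isMeasurable.Build default_measure_display
  'M[R]_(m, n) mx_measurable mx_measurable0 mx_measurableC mx_measurable_bigcup.

Lemma measurable_mx_entry i j :
  measurable_fun setT (fun M : 'M[R]_(m, n) => M i j).
Proof.
by move=> _ B mB; rewrite setTI; apply: sub_sigma_algebra; exists i, j, B.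
Qed.

Lemma measurable_fun_mxP d (T : measurableType d) (f : T -> 'M[R]_(m, n)) :
  (forall i j, measurable_fun setT (fun t => f t i j)) ->
  measurable_fun setT f.
Proof.
move=> mf _ A; rewrite setTI; move: A; apply: smallest_sub.
  split => [|A mA|F mF] /=.
  - by rewrite preimage_set0.
  - by rewrite setTD preimage_setC; exact: measurableC.
  - by rewrite preimage_bigcup; exact: bigcupT_measurable.
move=> _ [i [j [B [mB ->]]]] /=.
by have := mf i j measurableT B mB; rewrite setTI.
Qed.

Lemma open_measurable_mx (U : set 'M[R]_(m, n)) : open U -> measurable U.
Proof.
move=> oU.
pose box (c : 'M[rat]_(m, n)) (e : rat) : set 'M[R]_(m, n) :=
  [set M | forall i j, `|(ratr (c i j) : R) - M i j| < ratr e].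
have mbox c e : measurable (box c e).
  have -> : box c e = \bigcap_(i in setT) \bigcap_(j in setT)
      (fun M : 'M[R]_(m, n) => M i j) @^-1` ball (ratr (c i j) : R) (ratr e).
    apply/seteqP; split => [M h i _ j _|M h i j]; first exact: h.
    exact: (h i Logic.I j Logic.I).
  apply: fin_bigcap_measurable => // i _.
  apply: fin_bigcap_measurable => // j _.
  rewrite -[X in measurable X]setTI; apply: measurable_mx_entry => //.
  exact: measurable_ball.
pose G (p : 'M[rat]_(m, n) * rat) :=
  if `[< box p.1 p.2 `<=` U >] then box p.1 p.2 else set0.
rewrite (_ : U = \bigcup_(p in setT) G p); last first.
  apply/seteqP; split => [M UM|M [p _]]; last first.
    by rewrite /G; case: asboolP => [sub|_] //; exact: sub.
  have /nbhs_ballP[e /= e0 beU] : nbhs M U by exact: open_nbhs_nbhs.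
  have [q] := @rat_in_itvoo R 0 (e / 2) (divr_gt0 e0 (ltr0Sn R 1)).
  rewrite in_itv /= => /andP[q0 qe].
  have cM i j : exists c : rat, `|(ratr c : R) - M i j| < ratr q.
    have [c] := @rat_in_itvoo R (M i j - ratr q) (M i j + ratr q) ltac:(lra).
    rewrite in_itv /= => /andP[c1 c2]; exists c.
    by rewrite ltr_norml; apply/andP; split; lra.
  have [c hc] : exists c : 'M[rat]_(m, n), box c q M.
    exists (\matrix_(i, j) sval (cid (cM i j))) => i j; rewrite mxE.
    by case: cid.
  exists (c, q) => //; rewrite /G; case: asboolP => //= -[] N hN.
  apply: beU; split=> // i j; rewrite /ball /=.
  rewrite -(subrKA (ratr (c i j))) (splitr e).
  apply: le_lt_trans (ler_normD _ _) _.
  by rewrite ltrD// ?(lt_trans _ qe)// distrC.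
apply: countable_bigcupT_measurable => // -[c e].
by rewrite /G; case: asboolP.
Qed.

End measurable_matrix.

(* d-dimensional Lebesgue measure, as an iterated product measure. *)
Fixpoint lebesgue_rV (R : realType) (d : nat) : set 'rV[R]_d -> \bar R :=
  match d with
  | 0 => dirac (0 : 'rV[R]_0)
  | d'.+1 => pushforward (@lebesgue_measure R \x @lebesgue_rV R d')%E
      (fun p : measurableTypeR R * 'rV[R]_d' => row_mx (const_mx p.1 : 'rV[R]_1) p.2)
  end.

Section lebesgue_rV_measure.
Context {R : realType}.

Let cons_rV d (p : measurableTypeR R * 'rV[R]_d) : 'rV[R]_d.+1 :=
  row_mx (const_mx p.1 : 'rV[R]_1) p.2.

Let uncons_rV d (x : 'rV[R]_d.+1) : measurableTypeR R * 'rV[R]_d :=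
  (x 0 0, rsubmx (x : 'rV[R]_(1 + d))).

Let cons_rVK d : cancel (@cons_rV d) (@uncons_rV d).
Proof.
move=> [a x]; rewrite /uncons_rV /cons_rV row_mxKr; congr (_, _).
rewrite (_ : (0 : 'I_d.+1) = @lshift 1 d 0); last exact/val_inj.
by apply: (etrans (row_mxEl _ _ _ _)); rewrite mxE.
Qed.

Let measurable_cons_rV d : measurable_fun setT (@cons_rV d).
Proof.
apply: measurable_fun_mxP => i j; rewrite /cons_rV.
case: (@split_ordP 1 d j) => j' ->.
  rewrite (_ : (fun _ => _) = fst); first exact: measurable_fst.
  by apply/funext => p; apply: (etrans (row_mxEl _ _ _ _)); rewrite mxE.
rewrite (_ : (fun _ => _) = (fun x : 'rV_d => x i j') \o snd).
  by apply: measurableT_comp; [exact: measurable_mx_entry|exact: measurable_snd].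
by apply/funext => p; exact: row_mxEr.
Qed.

Let measurable_uncons_rV d : measurable_fun setT (@uncons_rV d).
Proof.
apply/measurable_fun_pair => //=; first exact: measurable_mx_entry.
apply: measurable_fun_mxP => i j.
under eq_fun do rewrite mxE; exact: measurable_mx_entry.
Qed.

Let pushforward_sigma_finite d1 d2 (T1 : measurableType d1)
    (T2 : measurableType d2) (mu : {measure set T1 -> \bar R})
    (f : T1 -> T2) (g : T2 -> T1) :
  sigma_finite setT mu -> measurable_fun setT f -> measurable_fun setT g -> cancel f g ->
  exists nu : {sigma_finite_measure set T2 -> \bar R}, pushforward mu f = nu.
Proof.
move=> [F FT F_oo] mf mg fK.
pose m : {measure set T2 -> \bar R} :=
  measure_function_pushforward__canonical__measure_function_Measure mu mf.
have sf : sigma_finite setT m.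
  exists (fun i => g @^-1` F i).
    by rewrite -preimage_bigcup -FT preimage_setT.
  move=> i; have [mFi Fi_oo] := F_oo i; split.
    by rewrite -[X in measurable X]setTI; exact: mg.
  rewrite (_ : m _ = mu (F i))//; congr (mu _).
  by apply/seteqP; split => x /=; rewrite fK.
pose sfm := Measure_isSigmaFinite.Build _ _ _ m sf.
pose nu : {sigma_finite_measure set T2 -> \bar R} :=
  HB.pack (m : set T2 -> \bar R) (Measure.class m) sfm.
by exists nu.
Qed.

Let product_sigma_finite d1 d2 (T1 : measurableType d1)
    (T2 : measurableType d2) (m1 : {sigma_finite_measure set T1 -> \bar R})
    (m2 : {sigma_finite_measure set T2 -> \bar R}) :
  sigma_finite setT (m1 \x m2)%E.
Proof.
have /sigma_finiteP[F [TF ndF Foo]] := sigma_finiteT m1.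
have /sigma_finiteP[G [TG ndG Goo]] := sigma_finiteT m2.
exists (fun n => F n `*` G n).
  rewrite -setXTT TF TG predeqE => -[x y]; split.
    move=> [/= [n _ Fnx] [k _ Gky]]; exists (maxn n k) => //; split.
    - by move: x Fnx; exact/subsetPset/ndF/leq_maxl.
    - by move: y Gky; exact/subsetPset/ndG/leq_maxr.
  by move=> [n _ []/= ? ?]; split; exists n.
move=> k; have [? ?] := Foo k; have [? ?] := Goo k.
split; first exact: measurableX.
by rewrite product_measure1E// lte_mul_pinfty// ge0_fin_numE.
Qed.

Let lebesgue_rV_measureP d :
  exists mu : {sigma_finite_measure set 'rV[R]_d -> \bar R},
    @lebesgue_rV R d = mu.
Proof.
elim: d => [|d [mu muE]].
  pose m : {measure set 'rV[R]_0 -> \bar R} := dirac (0 : 'rV[R]_0).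
  have sf : sigma_finite setT m.
    by apply: fin_num_fun_sigma_finite => [|A _]; rewrite /m /= ?measure0.
  pose sfm := Measure_isSigmaFinite.Build _ _ _ m sf.
  pose nu : {sigma_finite_measure set 'rV[R]_0 -> \bar R} :=
    HB.pack (m : set 'rV[R]_0 -> \bar R) (Measure.class m) sfm.
  by exists nu.
have -> : @lebesgue_rV R d.+1 =
    pushforward (@lebesgue_measure R \x mu)%E (@cons_rV d) by rewrite -muE.
exact: (pushforward_sigma_finite (product_sigma_finite lebesgue_measure mu)
  (@measurable_cons_rV d) (@measurable_uncons_rV d) (@cons_rVK d)).
Qed.

Let lebesgue_rV_semi_sigma_additive d : semi_sigma_additive (@lebesgue_rV R d).
Proof.
have [mu ->] := lebesgue_rV_measureP d; exact: measure_semi_sigma_additive.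
Qed.

Let lebesgue_rV0 d : @lebesgue_rV R d set0 = 0%E.
Proof. by have [mu ->] := lebesgue_rV_measureP d; rewrite measure0. Qed.

Let lebesgue_rV_ge0 d A : (0 <= @lebesgue_rV R d A)%E.
Proof. by have [mu ->] := lebesgue_rV_measureP d; exact: measure_ge0. Qed.

HB.instance Definition _ d := isMeasure.Build _ _ _ (@lebesgue_rV R d)
  (lebesgue_rV0 d) (@lebesgue_rV_ge0 d) (@lebesgue_rV_semi_sigma_additive d).

Let lebesgue_rV_sigma_finite d : sigma_finite setT (@lebesgue_rV R d).
Proof. by have [mu ->] := lebesgue_rV_measureP d; exact: sigma_finiteT. Qed.

HB.instance Definition _ d := Measure_isSigmaFinite.Build _ _ _
  (@lebesgue_rV R d) (lebesgue_rV_sigma_finite d).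

End lebesgue_rV_measure.

Section quantization.
Context {R : realType} {d : nat}.

(* The norm `|x| of 'rV[R]_d in the library is the max norm. *)
Definition enorm (x : 'rV[R]_d) : R := Num.sqrt (\sum_(i < d) x 0 i ^+ 2).

Definition closed_unit_ball : set 'rV[R]_d := [set x | enorm x <= 1].

(* The infimum is over a finite set, nonempty when 0 < k: it is the minimum. *)
Definition gamma (k : nat) (c : 'M[R]_(k, d)) (x : 'rV[R]_d) : R :=
  inf (range (fun j : 'I_k => enorm (x - row j c) ^+ 2)).

Definition risk (P : probability 'rV[R]_d R) (k : nat) (c : 'M[R]_(k, d)) : R :=
  \int[P]_x gamma c x.

Definition optimal (P : probability 'rV[R]_d R) (k : nat) (c : 'M[R]_(k, d)) :=
  forall c' : 'M[R]_(k, d), risk P c <= risk P c'.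

Definition excess_risk (P : probability 'rV[R]_d R) (k : nat)
    (c cstar : 'M[R]_(k, d)) : R :=
  risk P c - risk P cstar.

Definition empirical_risk (n : nat) (x : 'I_n -> 'rV[R]_d) (k : nat)
    (c : 'M[R]_(k, d)) : R :=
  n%:R^-1 * \sum_(i < n) gamma c (x i).

Definition empirical_risk_minimizer (n : nat) (x : 'I_n -> 'rV[R]_d) (k : nat)
    (c : 'M[R]_(k, d)) :=
  forall c' : 'M[R]_(k, d), empirical_risk x c <= empirical_risk x c'.

Definition is_density (P : probability 'rV[R]_d R) (f : 'rV[R]_d -> R) :=
  (forall x, 0 <= f x) /\
  forall A : set 'rV[R]_d, measurable A ->
    P A = (\int[@lebesgue_rV R d]_(x in A) (f x)%:E)%E.

End quantization.

Definition hessian (R : realType) (N : nat) (F : 'rV[R]_N -> R) (a : 'rV[R]_N) :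
    'M[R]_N :=
  \matrix_(i, j) 'D_(delta_mx 0 i) (fun y => 'D_(delta_mx 0 j) F y) a.

Definition posdefmx (R : realType) (N : nat) (A : 'M[R]_N) :=
  forall v : 'rV[R]_N, v != 0 -> 0 < (v *m A *m v^T) 0 0.

(* Codebooks are flattened by mxvec, so that the Hessian of the risk is a
   square matrix of size k * d. No differentiability is assumed: when P is
   carried by the unit ball and has a continuous density, the risk is twice
   differentiable at the optimal codebooks. *)
Definition pollard_regular (R : realType) (d : nat)
    (P : probability 'rV[R]_d R) (k : nat) :=
  (exists2 f : 'rV[R]_d -> R, continuous f & is_density P f) /\
  forall c : 'M[R]_(k, d), optimal P c ->
    posdefmx (hessian (fun v : 'rV[R]_(k * d) => risk P (vec_mx v)) (mxvec c)).

Section sampling.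
Context {R : realType} {dO dT : measure_display} {Omega : measurableType dO}
  {T : measurableType dT} (Pr : probability Omega R) (n : nat).

Definition mutually_independent (X : 'I_n -> {RV Pr >-> T}) :=
  forall (J : {set 'I_n}) (A : 'I_n -> set T),
    (forall i, measurable (A i)) ->
    Pr (\bigcap_(i in [set` J]) X i @^-1` A i) =
    (\prod_(i in J) Pr (X i @^-1` A i))%E.

Definition iid (P : probability T R) (X : 'I_n -> {RV Pr >-> T}) :=
  mutually_independent X /\
  forall (i : 'I_n) (A : set T), measurable A -> distribution Pr (X i) A = P A.

End sampling.

(* Main.v *)
Require Import Defs.
From HB Require Import structures.
From mathcomp Require Import all_boot all_order all_algebra.
From mathcomp Require Import all_classical all_reals all_analysis.
From mathcomp Require Import measurable_realfun ring lra.

Import Order.TTheory GRing.Theory Num.Theory.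
Import numFieldTopology.Exports numFieldNormedType.Exports.

Set Implicit Arguments.
Unset Strict Implicit.
Unset Printing Implicit Defensive.

Local Open Scope classical_set_scope.
Local Open Scope ring_scope.


(** Let [h c] be the loss of the codebook [c], and let [G c] be the centered empirical mean
    of [h c]. A minimizer [chat] of the empirical risk satisfies, for every
    optimal [m], the inequality [excess chat <= G m - G chat]. The rate [1 / n],
    instead of [1 / sqrt n], comes from the quadratic margin
    [a * |chat - m|^2 <= excess chat]: at distance [2^s / sqrt n] from [m] the
    excess is at least of order [4^s / n], whereas the increments of [G] there
    are only of order [2^s / n]. So large values of [s] are very unlikely.

    The probabilistic half is [erm_fast_rate]. The loss is Lipschitz in the
    codebook, so every increment [G u - G v] has its [p]-th moment bounded by
    a multiple of [(|u - v| / sqrt n)^p] ([centered_mean_moment]). In the space of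
    codebooks, of finite dimension [N], chaining over dyadic grids turns this into a
    bound on the supremum over a cube, as soon as [p] is large compared with
    [N] ([chaining], [expectation_chaining_bound]). Peeling the space into the shells
    of radii [2^s / sqrt n] and summing over [s] gives [C0 / n].

    The analytic half is the margin, [global_quadratic_growth], which has to be
    derived from the positivity of the Hessian at the optimal codebooks alone.
    At a codebook with distinct centers the risk has a gradient, given by integrals over the
    Voronoi cells, and keeping every point in its old cell when the
    centers move shows [risk (c + h) <= risk c + gradient c h + |h|^2]
    ([risk_upper]). The gradient is itself differentiable: the integral of a
    continuous function over a cell has a derivative in the centers, with one
    contribution per face of the cell ([cvg_cell_derivative]). No surface
    measure appears, because averaging along the normal of a face turns the surface
    integral into a volume integral ([cvg_halfspace_derivative]). Hence the
    Hessian of the risk is the derivative of the gradient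
    ([hessian_quadratic]). Together with [risk_upper], its positivity
    implies quadratic growth near an optimal codebook
    ([quadratic_growth]); the centers of such a codebook are
    distinct because two equal centers would waste one of them
    ([optimal_distinct]).

    The local bounds become a uniform one by compactness
    ([compact_quadratic_growth]), with finitely many reference points. Compactness
    is available because far away centers serve no point of the unit ball and
    can be moved without changing the loss there ([gamma_truncation]). *)

(** * Moments of sums of independent variables *)
Section transfer.
Local Open Scope ereal_scope.
Context d1 d2 (T1 : measurableType d1) (T2 : measurableType d2) (R : realType).
Variables (mu : {measure set T1 -> \bar R}) (nu : {measure set T2 -> \bar R}).
Import HBNNSimple.


(** An identity between integrals of indicators extends to nonnegative functions by monotone
    approximation. The weight [W] stands for a density, or for the factors
    that are independent of [X]. *)
Lemma ge0_integral_transfer (X : T1 -> T2) (W : T1 -> R) (w : R) :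
  measurable_fun setT X -> measurable_fun setT W ->
  (forall t, 0 <= W t)%R -> (0 <= w)%R ->
  (forall A, measurable A -> \int[mu]_t (\1_A (X t) * W t)%:E = w%:E * nu A) ->
  forall phi : T2 -> R, measurable_fun setT phi -> (forall y, 0 <= phi y)%R ->
  \int[mu]_t (phi (X t) * W t)%:E = w%:E * \int[nu]_y (phi y)%:E.
Proof.
move=> mX mW W0 w0 trA phi mphi phi0.
have mphiE : measurable_fun setT (EFin \o phi) by exact/measurable_EFinP.
have phiE0 y : setT y -> 0 <= (EFin \o phi) y by rewrite lee_fin.
pose f_ := nnsfun_approx measurableT mphiE.
have cvf y : (f_ n y)%:E @[n --> \oo] --> (phi y)%:E.
  by apply: (cvg_nnsfun_approx measurableT mphiE phiE0).
have ndf y m n : (m <= n)%N -> (f_ m y <= f_ n y)%R.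
  by move=> mn; exact/lefP/nd_nnsfun_approx.
have lhs : \int[mu]_t (f_ n (X t) * W t)%:E @[n --> \oo] -->
    \int[mu]_t (phi (X t) * W t)%:E.
  rewrite (_ : \int[mu]_t (phi (X t) * W t)%:E =
     \int[mu]_t limn (fun n => (f_ n (X t) * W t)%:E)).
    apply: cvg_monotone_convergence => //.
    - move=> n; apply/measurable_EFinP; apply: measurable_funM => //.
      exact: measurableT_comp.
    - by move=> n t _; rewrite lee_fin mulr_ge0.
    - by move=> t _ m n mn; rewrite lee_fin ler_wpM2r// ndf.
  apply: eq_integral => t _; apply/esym/cvg_lim => //.
  under eq_fun do rewrite EFinM.
  by rewrite EFinM; apply: cvgeZr => //; exact: cvf.
have rhs : w%:E * \int[nu]_y (f_ n y)%:E @[n --> \oo] -->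
    w%:E * \int[nu]_y (phi y)%:E.
  apply: cvgeZl => //.
  rewrite (_ : \int[nu]_y (phi y)%:E = \int[nu]_y limn (fun n => (f_ n y)%:E)).
    apply: cvg_monotone_convergence => //.
    - by move=> n; exact/measurable_EFinP.
    - by move=> n y _; rewrite lee_fin.
    - by move=> y _ m n mn; rewrite lee_fin; exact: ndf.
  by apply: eq_integral => y _; apply/esym/cvg_lim.
apply: (cvg_unique _ lhs) => //=.
rewrite [X in X @ _ --> _](_ : _ = fun n => w%:E * \int[nu]_y (f_ n y)%:E) //.
apply/funext => n.
have ki k y : (0 <= k * \1_(f_ n @^-1` [set k]) y)%R.
  by have := nnfun_muleindic_ge0 (f_ n) k y; rewrite -EFinM lee_fin.
have mfX : measurable_fun setT (f_ n \o X) by exact: measurableT_comp.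
transitivity (\sum_(k \in range (f_ n))
    \int[mu]_t (k%:E * (\1_(f_ n @^-1` [set k]) (X t) * W t)%:E)).
  rewrite -ge0_integral_fsum//; last 2 first.
  - move=> k; apply/measurable_EFinP; apply: measurable_funM => //.
    apply: measurable_funM => //.
    by apply: (measurableT_comp (measurable_indic _)).
  - move=> k t _; rewrite -EFinM mulrA EFinM mule_ge0 ?lee_fin//.
  apply: eq_integral => t _; rewrite fimfunE EFinM -fsumEFin// ge0_mule_fsuml//.
    by apply: eq_fsbigr => k _; rewrite -!EFinM mulrA.
  by move=> k; rewrite lee_fin.
under [X in _ * X]eq_integral do rewrite fimfunE -fsumEFin//.
rewrite [X in _ * X]ge0_integral_fsum//; last 2 first.
- by move=> r; exact/measurable_EFinP/measurableT_comp.
- by move=> r x _; rewrite lee_fin.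
rewrite ge0_mule_fsumr; last by move=> r; rewrite integral_ge0// => x _; rewrite lee_fin.
apply: eq_fsbigr => k /[!inE] -[y _ <-].
have mk : measurable_fun setT
    (fun t => (\1_(f_ n @^-1` [set f_ n y]) (X t) * W t)%:E).
  apply/measurable_EFinP; apply: measurable_funM => //.
  by apply: (measurableT_comp (measurable_indic _)).
rewrite ge0_integralZl ?lee_fin//; last by move=> t _; rewrite lee_fin mulr_ge0.
rewrite trA // integralZl_indic_nnsfun// integral_indic//= setIT.
by rewrite muleCA.
Qed.
End transfer.

Section independence.
Context (R : realType) (dO dT : measure_display) (Omega : measurableType dO)
  (T : measurableType dT) (Pr : probability Omega R) (P : probability T R).

Lemma bounded_integrable d (U : measurableType d) (mu : {finite_measure set U -> \bar R})
    (f : U -> R) (M : R) :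
  measurable_fun setT f -> (forall x, `|f x| <= M) ->
  mu.-integrable setT (EFin \o f).
Proof.
move=> mf fM; apply: measurable_bounded_integrable => //.
  by rewrite ltey_eq fin_num_measure.
exists M; split; first exact: num_real.
by move=> y My x _ /=; apply: (le_trans (fM x)); rewrite ltW.
Qed.

Lemma EFin_Rintegral d (U : measurableType d) (mu : {measure set U -> \bar R})
    (f : U -> R) : mu.-integrable setT (EFin \o f) ->
  (\int[mu]_x (f x)%:E = (\int[mu]_x f x)%:E)%E.
Proof. by move=> fi; rewrite fineK//; exact: integrable_fin_num. Qed.


(** Independence is the case in which all the factors are indicators; the transfer lemma
    replaces them by [phi] one coordinate at a time. *)
Lemma iid_expectation_prod n (X : 'I_n -> {RV Pr >-> T}) (phi : T -> R) (M : R) :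
  iid P X -> measurable_fun setT phi -> (forall x, 0 <= phi x <= M) ->
  (\int[Pr]_w (\prod_(i < n) phi (X i w))%:E = ((\int[P]_x phi x) ^+ n)%:E)%E.
Proof.
move=> [indep law] mphi phiM.
have phi0 x : 0 <= phi x by case/andP: (phiM x).
have phiI : P.-integrable setT (EFin \o phi).
  by apply: (@bounded_integrable _ _ _ _ M) => // x; rewrite ger0_norm//; case/andP: (phiM x).
set e := \int[P]_x phi x.
have e0 : 0 <= e by exact: Rintegral_ge0.
have lawE i A : measurable A -> Pr (X i @^-1` A) = P A by exact: law.
suff H m (A : 'I_n -> set T) : (forall i, measurable (A i)) -> (m <= n)%N ->
    (\int[Pr]_w (\prod_(i < n) if (i < m)%N then phi (X i w) else \1_(A i) (X i w))%:E
     = (\prod_(i < n) if (i < m)%N then e else fine (P (A i)))%:E)%E.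
  have := H n (fun=> setT) (fun=> measurableT) (leqnn n).
  under eq_integral do under eq_bigr do rewrite ltn_ord.
  move=> ->; congr (_%:E).
  by under eq_bigr do rewrite ltn_ord; rewrite prodr_const card_ord.
(* [m] counts the coordinates that already carry [phi] instead of an indicator. *)
elim: m A => [|m IH] A mA mn.
  have -> : (\int[Pr]_w (\prod_(i < n) \1_(A i) (X i w))%:E =
      \int[Pr]_w (\1_(\bigcap_(i in [set` [set: 'I_n]%SET]) X i @^-1` A i) w)%:E)%E.
    apply: eq_integral => w _; congr (_%:E); rewrite [RHS]indicE.
    case: (boolP (w \in _)) => [|] /=.
      rewrite inE => h; apply: big1 => i _; rewrite indicE mem_set//.
      by apply: h; rewrite /= inE.
    move=> /negP h; apply/eqP; rewrite prodf_seq_eq0; apply/hasP.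
    have [i /= hi] : exists i, ~ A i (X i w).
      by apply/existsNP => hA; apply: h; rewrite inE => i _; exact: hA.
    by exists i; rewrite ?mem_index_enum//= indicE memNset.
  rewrite integral_indic// ?setIT; last first.
    apply: fin_bigcap_measurable => // i _.
    by rewrite -[X in measurable X]setTI; apply: (measurable_funP (X i)).
  apply: (etrans (indep [set: 'I_n]%SET A mA)).
  rewrite -prodEFin; apply: eq_big => i; rewrite ?inE// => _.
  by rewrite lawE// fineK// fin_num_measure.
pose i0 := Ordinal mn.
have mX i : measurable_fun setT (X i) by exact: measurable_funP.
pose g (B : 'I_n -> set T) (i : 'I_n) w := if (i < m)%N then phi (X i w) else \1_(B i) (X i w).
have mg i B : measurable (B i) -> measurable_fun setT (g B i).
  move=> mB; rewrite /g; case: (ltnP i m) => _; first exact: (measurableT_comp mphi (mX i)).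
  exact: (measurableT_comp (measurable_indic mB) (mX i)).
have g0 i B w : 0 <= g B i w by rewrite /g; case: ifP.
pose W w := \prod_(i < n | i != i0) g A i w.
pose v B (i : 'I_n) := if (i < m)%N then e else fine (P (B i)).
have := @ge0_integral_transfer _ _ _ _ R Pr P (X i0) W (\prod_(i < n | i != i0) v A i).
move=> /(_ (mX i0)).
have mW : measurable_fun setT W.
  rewrite /W; under eq_fun do rewrite big_mkcond/=.
  by apply: measurable_prod => i _; case: (i != i0); [exact: mg|exact: measurable_cst].
have W0 w : 0 <= W w by apply: prodr_ge0.
have v0 : 0 <= \prod_(i < n | i != i0) v A i.
  by apply: prodr_ge0 => i _; rewrite /v; case: ifP => // _; rewrite fine_ge0.
move=> /(_ mW W0 v0) tr.
have eqW w : (\prod_(i < n) (if (i < m.+1)%N then phi (X i w) else \1_(A i) (X i w)))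
    = phi (X i0 w) * W w.
  rewrite (bigD1 i0)//= ltnSn; congr (_ * _); apply: eq_bigr => i ii0.
  by rewrite /g ltnS leq_eqVlt (_ : (i == m :> nat) = false)//; apply/negbTE.
under eq_integral do rewrite eqW.
rewrite tr //; last first.
  move=> B mB.
  pose A' (i : 'I_n) := if i == i0 then B else A i.
  have mA' i : measurable (A' i) by rewrite /A'; case: ifP.
  have := IH A' mA' (ltnW mn).
  have -> : (\int[Pr]_w (\prod_(i < n) (if (i < m)%N then phi (X i w) else \1_(A' i) (X i w)))%:E =
    \int[Pr]_w (\1_B (X i0 w) * W w)%:E)%E.
    apply: eq_integral => w _; congr (_%:E).
    rewrite (bigD1 i0)//= ltnn /A' eqxx; congr (_ * _).
    by apply: eq_bigr => i ii0; rewrite (negbTE ii0).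
  move=> ->; rewrite (bigD1 i0)//= ltnn /A' eqxx EFinM muleC fineK ?fin_num_measure//.
  congr (_%:E * _)%E; apply: eq_bigr => i ii0; by rewrite (negbTE ii0).
rewrite EFin_Rintegral// -EFinM; congr (_%:E).
rewrite [RHS](bigD1 i0)//= ltnSn mulrC; congr (_ * _); apply: eq_bigr => i ii0.
by rewrite /v ltnS [(i <= m)%N]leq_eqVlt (_ : (i == m :> nat) = false)//; apply/negbTE.
Qed.

End independence.

Section exponential_moments.
Context {R : realType}.

Lemma expR_le_quadratic (y : R) : y <= 2^-1 -> expR y <= 1 + y + 2 * y ^+ 2.
Proof.
move=> y2; have y1 : 0 < 1 - y by lra.
have h : expR y <= (1 - y)^-1.
  rewrite -[X in X <= _]invrK -expRN lef_pV2 ?posrE ?expR_gt0//.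
  by have := expR_ge1Dx (- y).
apply: (le_trans h); rewrite -[leLHS]mul1r ler_pdivrMr//.
have -> : (1 + y + 2 * y ^+ 2) * (1 - y) = 1 + y ^+ 2 * (1 - 2 * y) by ring.
by rewrite lerDl mulr_ge0 ?sqr_ge0//; lra.
Qed.

Lemma exprn_le_expR (p : nat) (x : R) : 0 <= x -> x ^+ p <= p%:R ^+ p * expR x.
Proof.
move=> x0; case: p => [|p].
  by rewrite !expr0 mul1r; apply: le_trans (expR_ge1Dx x); rewrite lerDl.
have p0 : (0 : R) < p.+1%:R by [].
have -> : expR x = expR (x / p.+1%:R) ^+ p.+1.
  by rewrite -expRM_natl mulrC divfK ?gt_eqF.
rewrite -exprMn; apply: lerXn2r; rewrite ?nnegrE ?mulr_ge0 ?expR_ge0//.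
rewrite mulrC -ler_pdivrMr//; apply: le_trans (expR_ge1Dx _); by rewrite lerDr.
Qed.

Lemma even_exprn_le_expR (p : nat) (x : R) : ~~ odd p ->
  x ^+ p <= p%:R ^+ p * (expR x + expR (- x)).
Proof.
move=> ep; have [x0|x0] := leP 0 x.
  apply: (le_trans (exprn_le_expR p x0)).
  by rewrite ler_wpM2l ?exprn_ge0// lerDl expR_ge0.
have -> : x ^+ p = (- x) ^+ p by rewrite exprNn -signr_odd (negbTE ep) mul1r.
apply: (le_trans (exprn_le_expR p _)); first by rewrite oppr_ge0 ltW.
by rewrite ler_wpM2l ?exprn_ge0// lerDr expR_ge0.
Qed.

Context (dO dT : measure_display) (Omega : measurableType dO)
  (T : measurableType dT) (Pr : probability Omega R) (P : probability T R).


(** At the scale [1 / (b sqrt n)] each factor of the product has mean at most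
    [1 + 1 / (2 n)], since the linear term of the exponential is centered. *)
Lemma iid_sum_exp_moment n (X : 'I_n -> {RV Pr >-> T}) (phi : T -> R) (b l : R) :
  (0 < n)%N -> iid P X -> measurable_fun setT phi ->
  (forall x, `|phi x| <= b) -> \int[P]_x phi x = 0 -> 0 < b ->
  `|l| = (2 * b * Num.sqrt n%:R)^-1 ->
  (\int[Pr]_w (expR (l * \sum_(i < n) phi (X i w)))%:E <= (expR 1)%:E)%E.
Proof.
move=> n0 hX mphi phib phi0 b0 hl.
have n0' : (0 : R) < n%:R by rewrite ltr0n.
have s0 : 0 < Num.sqrt n%:R :> R by rewrite sqrtr_gt0.
have s1 : 1 <= Num.sqrt n%:R :> R by rewrite -[X in X <= _]sqrtr1 ler_wsqrtr// ler1n.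
have lphi x : `|l * phi x| <= (2 * Num.sqrt n%:R)^-1.
  rewrite normrM hl (_ : (2 * Num.sqrt n%:R)^-1 = (2 * b * Num.sqrt n%:R)^-1 * b).
    by rewrite ler_wpM2l// invr_ge0 !mulr_ge0 ?ltW.
  by field; rewrite !gt_eqF.
have lphi2 x : l * phi x <= 2^-1.
  apply: (le_trans (ler_norm _)); apply: (le_trans (lphi x)).
  by rewrite lef_pV2 ?posrE ?mulr_gt0// ler_peMr.
have mexp : measurable_fun setT (fun x => expR (l * phi x)).
  by apply: measurableT_comp => //; apply: measurable_funM.
have expb x : 0 <= expR (l * phi x) <= expR (2^-1).
  by rewrite expR_ge0 ler_expR lphi2.
under eq_integral do rewrite mulr_sumr expR_sum.
rewrite (iid_expectation_prod hX mexp expb) lee_fin.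
have phiI : P.-integrable setT (EFin \o phi) by exact: (@bounded_integrable _ _ _ _ _ b).
have expI : P.-integrable setT (EFin \o (fun x => expR (l * phi x))).
  apply: (@bounded_integrable _ _ _ _ _ (expR 2^-1)) => // x.
  by rewrite ger0_norm ?expR_ge0//; case/andP: (expb x).
have step : \int[P]_x expR (l * phi x) <= 1 + (2 * n%:R)^-1.
  have -> : 1 + (2 * n%:R)^-1 = \int[P]_x ((1 + (2 * n%:R)^-1) + l * phi x) :> R.
    rewrite RintegralD//.
    - rewrite Rintegral_cst//. rewrite [fine _](_ : _ = 1); last exact: (congr1 fine (probability_setT P)).
      rewrite mulr1 RintegralZl// phi0 mulr0 addr0//.
    - apply: (@bounded_integrable _ _ _ _ _ `|1 + (2 * n%:R)^-1|) => //.
    - apply: (@bounded_integrable _ _ _ _ _ (2 * Num.sqrt n%:R)^-1) => //.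
      exact: measurable_funM.
  apply: le_Rintegral => //.
    apply: (@bounded_integrable _ _ _ _ _ (`|1 + (2 * n%:R)^-1| + (2 * Num.sqrt n%:R)^-1)).
      by apply: measurable_funD => //; exact: measurable_funM.
    by move=> x; apply: (le_trans (ler_normD _ _)); rewrite lerD2l.
  move=> x _; apply: (le_trans (expR_le_quadratic (lphi2 x))).
  rewrite -addrA [leRHS]addrAC -addrA lerD2l lerD2l.
  rewrite -[(l * phi x) ^+ 2](real_normK (num_real _)).
  apply: (@le_trans _ _ (2 * ((2 * Num.sqrt n%:R)^-1) ^+ 2)).
    by rewrite ler_pM2l// lerXn2r ?nnegrE// invr_ge0 mulr_ge0 ?ltW.
  rewrite exprVn exprMn sqr_sqrtr; last exact: ltW.
  rewrite le_eqVlt; apply/orP; left; apply/eqP.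
  by field; rewrite gt_eqF.
have exp0 : 0 <= \int[P]_x expR (l * phi x) by apply: Rintegral_ge0 => x _; exact: expR_ge0.
apply: (@le_trans _ _ (expR ((2 * n%:R)^-1) ^+ n)).
  apply: lerXn2r; rewrite ?nnegrE ?expR_ge0//.
  by apply: (le_trans step); exact: expR_ge1Dx.
rewrite -expRM_natl ler_expR invfM mulrCA divff ?gt_eqF//; lra.
Qed.

(** After division by [2 b sqrt n] the sum has bounded exponential moments of both signs, and
    these dominate every even power. *)
Lemma iid_sum_moment n (X : 'I_n -> {RV Pr >-> T}) (phi : T -> R) (b : R) (p : nat) :
  (0 < n)%N -> iid P X -> measurable_fun setT phi ->
  (forall x, `|phi x| <= b) -> \int[P]_x phi x = 0 -> 0 <= b -> ~~ odd p -> (0 < p)%N ->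
  (\int[Pr]_w ((\sum_(i < n) phi (X i w)) ^+ p)%:E <=
   (2 * expR 1 * (2 * p%:R) ^+ p * (b * Num.sqrt n%:R) ^+ p)%:E)%E.
Proof.
move=> n0 hX mphi phib phi0 b0 ep p0.
have mX i : measurable_fun setT (X i) by exact: measurable_funP.
have [b00|bn0] := eqVneq b 0.
  rewrite b00 mul0r expr0n (gtn_eqF p0) mulr0.
  rewrite (_ : (fun w => _) = cst 0%E) ?integral0//.
  apply/funext => w; rewrite big1 ?expr0n ?(gtn_eqF p0)// => i _.
  by apply/eqP; rewrite -normr_le0 -b00.
have {b0}bn0 : 0 < b by rewrite lt_neqAle eq_sym bn0.
have s0 : 0 < Num.sqrt n%:R :> R by rewrite sqrtr_gt0 ltr0n.
pose l : R := (2 * b * Num.sqrt n%:R)^-1.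
have l0 : 0 < l by rewrite invr_gt0 !mulr_gt0.
pose S w := \sum_(i < n) phi (X i w).
have mS : measurable_fun setT S.
  by apply: measurable_sum => i; exact: measurableT_comp.
pose c : R := (p%:R / l) ^+ p.
have c0 : 0 <= c by rewrite exprn_ge0// divr_ge0// ltW.
have mEr r : measurable_fun setT (fun w => expR (r * S w)).
  by apply: measurableT_comp => //; exact: measurable_funM.
have mE r : measurable_fun setT (fun w => (expR (r * S w))%:E).
  exact/measurable_EFinP.
have bd w : (S w) ^+ p <= c * expR (l * S w) + c * expR (- l * S w).
  rewrite -mulrDr.
  have -> : (S w) ^+ p = (l * S w) ^+ p / l ^+ p.
    by rewrite exprMn mulrC mulrA mulVf ?mul1r// expf_neq0// gt_eqF.
  rewrite /c [(p%:R / l) ^+ p]expr_div_n ler_pdivrMr ?exprn_gt0// mulrAC divfK; last first.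
    by rewrite expf_neq0// gt_eqF.
  by rewrite mulNr; exact: even_exprn_le_expR.
apply: (@le_trans _ _ (\int[Pr]_w (c * expR (l * S w) + c * expR (- l * S w))%:E)%E).
  apply: ge0_le_integral => //.
  - by move=> w _; rewrite lee_fin exprn_even_ge0.
  - by apply/measurable_EFinP; exact: measurable_funX.
  - by apply/measurable_EFinP; apply: measurable_funD;
      apply: measurable_funM (mEr _); exact: measurable_cst.
  - by move=> w _; rewrite lee_fin; exact: bd.
under eq_integral do rewrite EFinD !EFinM.
rewrite ge0_integralD//; last 4 first.
- by move=> w _; rewrite -EFinM lee_fin mulr_ge0// expR_ge0.
- exact: measurable_funeM.
- by move=> w _; rewrite -EFinM lee_fin mulr_ge0// expR_ge0.
- exact: measurable_funeM.
rewrite !ge0_integralZl ?lee_fin//.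
apply: (@le_trans _ _ (c%:E * (expR 1)%:E + c%:E * (expR 1)%:E)%E).
  apply: leeD; (apply: lee_wpmul2l; first by rewrite lee_fin);
    apply: (iid_sum_exp_moment n0 hX mphi phib phi0 bn0).
    by rewrite ger0_norm// ltW.
  by rewrite normrN ger0_norm// ltW.
rewrite -!EFinM -EFinD lee_fin le_eqVlt; apply/orP; left; apply/eqP.
rewrite /c /l invrK !exprMn; ring.
Qed.

End exponential_moments.

(** * Chaining over dyadic grids *)
Section matrix_norm.
Context {R : realType} {m n : nat}.
Implicit Types A : 'M[R]_(m, n).

Lemma mx_norm_entry A i j : `|A i j| <= `|A|.
Proof.
rewrite [leRHS]/Num.norm /= mx_normrE.
exact: (@le_bigmax_cond _ _ _ (0 : R) (i, j) predT (fun ij : 'I_m * 'I_n => `|A ij.1 ij.2|)).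
Qed.

Lemma mx_norm_le A (r : R) : 0 <= r -> (forall i j, `|A i j| <= r) -> `|A| <= r.
Proof.
move=> r0 Ar; rewrite [leLHS]/Num.norm /= mx_normrE.
by apply/bigmax_leP; split => // -[i j] _.
Qed.

End matrix_norm.

Section dyadic_chaining.
Context {R : realType} {N : nat}.
Variables (m : 'rV[R]_N) (delta : R).
Hypothesis delta0 : 0 < delta.


(** For [z i < 2^j] these are the lower corners of the [2^(j N)] dyadic cells of level [j]
    of the cube of radius [delta] centered at [m]. *)
Definition dyadic_point (j : nat) (z : 'I_N -> nat) : 'rV[R]_N :=
  \row_i (m 0 i - delta + 2 * delta * ((z i)%:R / 2 ^+ j)).

Definition dyadic_parent (j : nat) (z : 'I_N -> nat) : 'rV[R]_N :=
  if j is j'.+1 then dyadic_point j' (fun i => (z i)./2) else m.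

Definition dyadic_index (j : nat) (c : 'rV[R]_N) (i : 'I_N) : nat :=
  Num.truncn (2 ^+ j * ((c 0 i - m 0 i + delta) / (2 * delta))).

Let relpos (c : 'rV[R]_N) i := (c 0 i - m 0 i + delta) / (2 * delta).

Let relpos_itv c i : `|c - m| < delta -> 0 < relpos c i < 1.
Proof.
move=> cm; have := le_lt_trans (mx_norm_entry (c - m) 0 i) cm.
rewrite !mxE ltr_norml => /andP[h1 h2].
rewrite /relpos divr_gt0 ?mulr_gt0//=; last by lra.
by rewrite ltr_pdivrMr ?mulr_gt0// mul1r; lra.
Qed.

Let truncn_half (x : R) : 0 <= x -> (Num.truncn (2 * x))./2 = Num.truncn x.
Proof.
move=> x0; apply/esym/truncn_def.
have x20 : 0 <= 2 * x by rewrite mulr_ge0.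
have /andP[h1 h2] := truncn_itv x20.
set t := Num.truncn (2 * x) in h1 h2 *.
have tE := odd_double_half t.
have tR : t%:R = (odd t)%:R + 2 * (t./2)%:R :> R.
  by rewrite -[in LHS]tE natrD -muln2 natrM mulrC.
have o1 : (0 : R) <= (odd t)%:R by rewrite ler0n.
have o2 : (odd t)%:R <= (1 : R) by rewrite lern1 leq_b1.
rewrite -[t.+1%:R]natr1 tR in h2; rewrite tR in h1.
by rewrite -[(t./2).+1%:R]natr1; apply/andP; split; lra.
Qed.

Lemma dyadic_index_half j c i : `|c - m| < delta ->
  (dyadic_index j.+1 c i)./2 = dyadic_index j c i.
Proof.
move=> /(relpos_itv i) /andP[h _].
by rewrite /dyadic_index exprS -mulrA truncn_half// mulr_ge0// ltW.
Qed.

Lemma dyadic_index_lt j c i : `|c - m| < delta -> (dyadic_index j c i < 2 ^ j)%N.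
Proof.
move=> /(relpos_itv i) /andP[h0 h1].
have p0 : (0 : R) < 2 ^+ j by rewrite exprn_gt0.
rewrite truncn_lt_nat; last by rewrite mulr_ge0// ltW.
by rewrite natrX gtr_pMr.
Qed.

Lemma dyadic_point_dist j c : `|c - m| < delta ->
  `|c - dyadic_point j (dyadic_index j c)| <= 2 * delta / 2 ^+ j.
Proof.
move=> cm; apply: mx_norm_le => [|i k]; first by rewrite divr_ge0// mulr_ge0// ltW.
rewrite ord1 !mxE; have /andP[h0 h1] := relpos_itv k cm.
have p0 : (0 : R) < 2 ^+ j by rewrite exprn_gt0.
have ce : c 0 k = m 0 k - delta + 2 * delta * relpos c k.
  by rewrite /relpos; field; rewrite gt_eqF.
rewrite [X in `|X - _|]ce opprD addrACA subrr add0r -mulrBr normrM gtr0_norm ?mulr_gt0//.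
rewrite ler_pM2l ?mulr_gt0//.
have x0 : 0 <= 2 ^+ j * relpos c k by rewrite mulr_ge0// ltW.
have /andP[t1 t2] := truncn_itv x0.
rewrite -(ler_pM2l p0) -[X in X * `|_|](gtr0_norm p0) -normrM divff ?gt_eqF//.
rewrite mulrBr [2 ^+ j * (_ / 2 ^+ j)]mulrCA divff ?gt_eqF// mulr1 /dyadic_index -/(relpos c k).
by rewrite ger0_norm ?subr_ge0// lerBlDl natr1 ltW.
Qed.

Lemma dyadic_parent_dist j (z : 'I_N -> nat) : (forall i, z i < 2 ^ j)%N ->
  `|dyadic_point j z - dyadic_parent j z| <= 2 * delta / 2 ^+ j.
Proof.
have d0 := ltW delta0.
move=> zj; apply: mx_norm_le => [|i k]; first by rewrite divr_ge0// mulr_ge0.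
rewrite ord1; case: j zj => [|j] zj.
  have := zj k; rewrite expn0 ltnS leqn0 => /eqP zk.
  rewrite !mxE zk mul0r mulr0 addr0 addrAC subrr sub0r normrN ger0_norm// expr0 divr1.
  by rewrite mulr_natl mulr2n lerDl.
rewrite !mxE opprD addrACA subrr add0r -mulrBr normrM [`|2 * delta|]gtr0_norm ?mulr_gt0//.
rewrite ler_pM2l ?mulr_gt0//.
have p0 : (0 : R) < 2 ^+ j by rewrite exprn_gt0.
rewrite exprS.
have -> : (z k)%:R / (2 * 2 ^+ j) - (z k)./2%:R / 2 ^+ j =
    (odd (z k))%:R / (2 * 2 ^+ j) :> R.
  rewrite -[X in X%:R / _]odd_double_half natrD -muln2 natrM; field.
  by rewrite gt_eqF.
rewrite ger0_norm; last by rewrite divr_ge0// mulr_ge0// ltW.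
rewrite -[leRHS]mul1r ler_pM2r ?invr_gt0 ?mulr_gt0//.
by case: (odd _); rewrite ?ler01.
Qed.


(** The weights sum to at most [1]. Their ratio [3/4] exceeds [1/2]: dividing an increment of
    level [j], of size [2^-j], by its weight still leaves the geometric decay
    [(2/3)^j]. *)
Definition chaining_weight (j : nat) : R := 4^-1 * (3 / 4) ^+ j.

Definition chaining_bound (p J : nat) (G : 'rV[R]_N -> R) : R :=
  \sum_(j < J.+1) \sum_(z : {ffun 'I_N -> 'I_(2 ^ j)})
    ((G (dyadic_point j (fun i => z i)) - G (dyadic_parent j (fun i => z i)))
      / chaining_weight j) ^+ p.

Lemma chaining_weight_gt0 j : 0 < chaining_weight j.
Proof. by rewrite mulr_gt0// exprn_gt0. Qed.

Lemma sum_chaining_weight J : \sum_(j < J) chaining_weight j <= 1.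
Proof.
suff -> : \sum_(j < J) chaining_weight j = 1 - (3 / 4) ^+ J.
  by rewrite gerBl exprn_ge0.
elim: J => [|J IH]; first by rewrite big_ord0 expr0 subrr.
by rewrite big_ord_recr/= IH /chaining_weight exprS; field.
Qed.


(** If the sum is [s], some term is at least its share [s * w i]. *)
Lemma exprn_sum_le_sum_weight (I : finType) (a w : I -> R) (p : nat) : (0 < p)%N ->
  (forall i, 0 <= a i) -> (forall i, 0 < w i) -> \sum_i w i <= 1 ->
  (\sum_i a i) ^+ p <= \sum_i (a i / w i) ^+ p.
Proof.
move=> p0 a0 w0 w1; set s := \sum_i a i.
have s0 : 0 <= s by exact: sumr_ge0.
have t0 i : 0 <= (a i / w i) ^+ p by rewrite exprn_ge0// divr_ge0// ltW.
have [s00|sn0] := eqVneq s 0; first by rewrite s00 expr0n gtn_eqF// sumr_ge0.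
have spos : 0 < s by rewrite lt_neqAle eq_sym sn0.
have [i hi] : exists i, s * w i <= a i.
  apply: contrapT => /forallNP h.
  have h' i : a i < s * w i by rewrite ltNge; apply/negP/h.
  have [i0 _|noI] := pickP I; last by move: sn0; rewrite /s big_pred0 ?eqxx.
  have : 0 < \sum_i (s * w i - a i).
    rewrite (bigD1 i0)//=; apply: ltr_pwDl; first by rewrite subr_gt0.
    by apply: sumr_ge0 => i _; rewrite subr_ge0 ltW.
  by rewrite sumrB -mulr_sumr -/s subr_gt0 ltNge ler_piMr.
rewrite (bigD1 i)//=; apply: (@le_trans _ _ ((a i / w i) ^+ p)).
  apply: lerXn2r; rewrite ?nnegrE//; first by rewrite divr_ge0// ltW.
  by rewrite ler_pdivlMr.
by rewrite lerDl sumr_ge0.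
Qed.

Lemma chaining_bound_ge0 p J G : ~~ odd p -> 0 <= chaining_bound p J G.
Proof.
by move=> ep; apply: sumr_ge0 => j _; apply: sumr_ge0 => z _; exact: exprn_even_ge0.
Qed.

(** Telescoping along the dyadic approximations of [c] down to the level [J]. Each step of the
    path is one of the finitely many increments in [chaining_bound], which
    does not depend on [c]; the Lipschitz bound takes care of the
    distance from [c] to its last approximation. *)
Lemma chaining p J (G : 'rV[R]_N -> R) (K : R) (c : 'rV[R]_N) :
  ~~ odd p -> (0 < p)%N ->
  (forall u v, `|G u - G v| <= K * `|u - v|) -> 0 <= K -> `|c - m| < delta ->
  exists U : R, [/\ 0 <= U, `|G c - G m| <= U + K * (2 * delta / 2 ^+ J)
     & U ^+ p <= chaining_bound p J G].
Proof.
move=> ep p0 GK K0 cm.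
pose D j := G (dyadic_point j (dyadic_index j c)) - G (dyadic_parent j (dyadic_index j c)).
exists (\sum_(j < J.+1) `|D j|); split; first exact: sumr_ge0.
  have tel : G (dyadic_point J (dyadic_index J c)) - G m = \sum_(j < J.+1) D j.
    elim: J => [|J IH]; first by rewrite big_ord1.
    rewrite big_ord_recr/= -IH /D /=.
    rewrite (_ : (fun i => _./2) = dyadic_index J c); first by ring.
    by apply/funext => i; rewrite dyadic_index_half.
  have -> : G c - G m = (G (dyadic_point J (dyadic_index J c)) - G m) +
     (G c - G (dyadic_point J (dyadic_index J c))) by ring.
  apply: (le_trans (ler_normD _ _)); rewrite tel lerD ?ler_norm_sum//.
  apply: (le_trans (GK _ _)); rewrite ler_wpM2l//; exact: dyadic_point_dist.
apply: (le_trans (exprn_sum_le_sum_weight (w := fun j : 'I_J.+1 => chaining_weight j)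
   p0 _ _ _)) => //.
- by move=> j; exact: chaining_weight_gt0.
- exact: sum_chaining_weight.
apply: ler_sum => j _.
pose z0 : {ffun 'I_N -> 'I_(2 ^ j)} := [ffun i => Ordinal (dyadic_index_lt j i cm)].
have z0E : (fun i => z0 i : nat) = dyadic_index j c by apply/funext => i; rewrite ffunE.
rewrite (bigD1 z0)//= z0E -/(D j) -[leLHS]addr0; apply: lerD.
  rewrite !expr_div_n -normrX ger0_norm//; exact: exprn_even_ge0.
by apply: sumr_ge0 => z _; exact: exprn_even_ge0.
Qed.

End dyadic_chaining.

Section expected_chaining.
Context {R : realType} {N : nat} (dO : measure_display) (Omega : measurableType dO)
  (Pr : probability Omega R).

Lemma ge0_integral_sumr (I : Type) (s : seq I) (f : I -> Omega -> R) :
  (forall i, measurable_fun setT (f i)) -> (forall i w, 0 <= f i w) ->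
  (\int[Pr]_w (\sum_(i <- s) f i w)%:E = \sum_(i <- s) \int[Pr]_w (f i w)%:E)%E.
Proof.
move=> mf f0; under eq_integral do rewrite -sumEFin.
rewrite ge0_integral_sum// => [i|i w _]; first exact/measurable_EFinP.
by rewrite lee_fin.
Qed.


(** The level [j] has [2^(j N)] increments, each of [p]-th moment proportional to
    [(2/3)^(j p)] after the division by the weights; the hypothesis on [p]
    makes the sum over the levels geometric of ratio at most [1/2]. *)
Lemma expectation_chaining_bound (m : 'rV[R]_N) (delta A : R) (p J : nat)
    (G : Omega -> 'rV[R]_N -> R) :
  0 < delta -> 0 <= A -> ~~ odd p ->
  (forall u, measurable_fun setT (fun w => G w u)) ->
  (forall u v, (\int[Pr]_w ((G w u - G w v) ^+ p)%:E <= (A * `|u - v| ^+ p)%:E)%E) ->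
  2 ^+ N * (2 / 3) ^+ p <= 2^-1 :> R ->
  (\int[Pr]_w (chaining_bound m delta p J (G w))%:E <= (2 * A * (8 * delta) ^+ p)%:E)%E.
Proof.
move=> d0 A0 ep mG GA q2; set q : R := 2 ^+ N * (2 / 3) ^+ p in q2.
have q0 : 0 <= q by rewrite mulr_ge0 ?exprn_ge0.
have mD u v (a : R) : measurable_fun setT (fun w => ((G w u - G w v) / a) ^+ p).
  by apply: measurable_funX; apply: measurable_funM => //; exact: measurable_funB.
have D0 u v (a : R) w : 0 <= ((G w u - G w v) / a) ^+ p by exact: exprn_even_ge0.
rewrite /chaining_bound ge0_integral_sumr; last 2 first.
- by move=> j; apply: measurable_sum => z; exact: mD.
- by move=> j w; apply: sumr_ge0.
apply: (@le_trans _ _ (\sum_(j < J.+1) (A * (8 * delta) ^+ p * q ^+ j)%:E)%E).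
  apply: lee_sum => j _; rewrite ge0_integral_sumr//.
  have w0 := @chaining_weight_gt0 R j.
  have wp0 : 0 < chaining_weight j ^+ p :> R by rewrite exprn_gt0.
  apply: (@le_trans _ _ (\sum_(z : {ffun 'I_N -> 'I_(2 ^ j)})
      ((chaining_weight j ^+ p)^-1 * (A * (2 * delta / 2 ^+ j) ^+ p))%:E)%E).
    apply: lee_sum => z _.
    set u := dyadic_point _ _ _ _; set v := dyadic_parent _ _ _ _.
    under eq_integral do rewrite expr_div_n mulrC EFinM.
    rewrite ge0_integralZl ?lee_fin//; last 3 first.
    - apply/measurable_EFinP; apply: measurable_funX; exact: measurable_funB.
    - by move=> w _; rewrite lee_fin exprn_even_ge0.
    - by rewrite invr_ge0 ltW.
    rewrite EFinM; apply: lee_wpmul2l; first by rewrite lee_fin invr_ge0 ltW.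
    apply: (le_trans (GA u v)); rewrite lee_fin ler_wpM2l// lerXn2r ?nnegrE//.
      by rewrite divr_ge0// mulr_ge0// ltW.
    by apply: dyadic_parent_dist => // i; exact: ltn_ord.
  rewrite sumEFin lee_fin sumr_const card_ffun !card_ord.
  rewrite le_eqVlt; apply/orP; left; apply/eqP.
  have base : 2 * delta / 2 ^+ j / chaining_weight j = 8 * delta * (2 / 3) ^+ j.
    have -> : (2 / 3) ^+ j = (2 ^+ j * (3 / 4) ^+ j)^-1 :> R.
      by rewrite -exprMn -exprVn; congr (_ ^+ _); field.
    rewrite /chaining_weight; field.
    by rewrite !expf_neq0//; apply/andP; split; apply: lt0r_neq0; lra.
  rewrite -[LHS]mulr_natl natrX natrX mulrCA mulrA [_^-1 * (2 ^+ j) ^+ N]mulrC.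
  rewrite (_ : (2 ^+ j) ^+ N * _ * _ = A * (2 ^+ j) ^+ N *
     ((2 * delta / 2 ^+ j) / chaining_weight j) ^+ p); last first.
    by rewrite [in RHS]expr_div_n; ring.
  rewrite base /q !exprMn -!exprM [(N * j)%N]mulnC [(p * j)%N]mulnC.
  by ring.
rewrite sumEFin lee_fin -mulr_sumr.
have -> : 2 * A * (8 * delta) ^+ p = A * (8 * delta) ^+ p * 2 by ring.
rewrite ler_wpM2l//; first by rewrite mulr_ge0// exprn_ge0// mulr_ge0// ltW.
suff : \sum_(j < J.+1) q ^+ j <= 2 * (1 - 2^-1 ^+ J.+1).
  by move=> /le_trans; apply; rewrite ler_piMr// gerBl exprn_ge0.
elim: (J.+1) => [|k IH]; first by rewrite big_ord0 expr0 subrr mulr0.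
rewrite big_ord_recr/=; apply: (le_trans (lerD IH (lerXn2r k _ _ q2))); rewrite ?nnegrE//.
by rewrite exprS le_eqVlt; apply/orP; left; apply/eqP; field.
Qed.

End expected_chaining.

(** * Fast rates under a quadratic margin *)
Section fast_rate.
Context {R : realType} {N : nat} (dT : measure_display) (T : measurableType dT)
  (P : probability T R).

Definition centered_mean (h : 'rV[R]_N -> T -> R) n (x : 'I_n -> T) (c : 'rV[R]_N) : R :=
  n%:R^-1 * \sum_(i < n) (h c (x i) - \int[P]_y h c y).

Variables (h : 'rV[R]_N -> T -> R) (L B : R).
Hypothesis mh : forall c, measurable_fun setT (h c).
Hypothesis hL : forall c c' x, `|h c x - h c' x| <= L * `|c - c'|.
Hypothesis hB : forall c x, `|h c x| <= B.
Hypothesis L0 : 0 <= L.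

Let hI c : P.-integrable setT (EFin \o h c).
Proof. exact: (@bounded_integrable _ _ _ _ _ B). Qed.

Let intL u v : `|\int[P]_y h u y - \int[P]_y h v y| <= L * `|u - v|.
Proof.
rewrite -RintegralB//; apply: (le_trans (le_normr_Rintegral _ _)) => //.
  by apply: (@bounded_integrable _ _ _ _ _ (L * `|u - v|)) => //; exact: measurable_funB.
have -> : L * `|u - v| = \int[P]_y (L * `|u - v|).
  rewrite Rintegral_cst//.
  by rewrite [fine _](_ : _ = 1) ?mulr1//; exact: (congr1 fine (probability_setT P)).
apply: le_Rintegral => //.
  apply: (@bounded_integrable _ _ _ _ _ (L * `|u - v|)) => //.
    by apply: measurableT_comp => //; exact: measurable_funB.
  by move=> x; rewrite normr_id.
by apply: (@bounded_integrable _ _ _ _ _ (`|L * `|u - v| |)).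
Qed.

Lemma centered_mean_lipschitz n (x : 'I_n -> T) u v :
  `|centered_mean h x u - centered_mean h x v| <= 2 * L * `|u - v|.
Proof.
rewrite /centered_mean -mulrBr -sumrB normrM.
case: n x => [|n] x.
  by rewrite big_ord0 normr0 mulr0 !mulr_ge0.
rewrite ger0_norm ?invr_ge0// mulrC ler_pdivrMr//.
apply: (le_trans (ler_norm_sum _ _ _)).
rewrite mulr_natr -[in leRHS](card_ord n.+1) -sumr_const; apply: ler_sum => i _.
set a := \int[P]_y h u y; set b := \int[P]_y h v y.
have -> : h u (x i) - a - (h v (x i) - b) = (h u (x i) - h v (x i)) - (a - b) by ring.
apply: (le_trans (ler_normB _ _)); rewrite -mulrA mulr_natl mulr2n.
by apply: lerD; [exact: hL|exact: intL].
Qed.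

Lemma centered_mean_moment p : ~~ odd p -> (0 < p)%N ->
  exists2 A : R, 0 <= A & forall n, (0 < n)%N ->
  forall (dO : measure_display) (Omega : measurableType dO)
    (Pr : probability Omega R) (X : 'I_n -> {RV Pr >-> T}), iid P X ->
  forall u v, (\int[Pr]_w ((centered_mean h (fun i => X i w) u -
       centered_mean h (fun i => X i w) v) ^+ p)%:E <=
    (A / Num.sqrt n%:R ^+ p * `|u - v| ^+ p)%:E)%E.
Proof.
move=> ep p0; exists (2 * expR 1 * (2 * p%:R) ^+ p * (2 * L) ^+ p).
  by rewrite !mulr_ge0 ?exprn_ge0 ?expR_ge0 ?mulr_ge0.
move=> n n0 dO Omega Pr X hX u v.
pose phi x := h u x - h v x - (\int[P]_y h u y - \int[P]_y h v y).
have mphi : measurable_fun setT phi.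
  by apply: measurable_funB => //; exact: measurable_funB.
have phib x : `|phi x| <= 2 * L * `|u - v|.
  apply: (le_trans (ler_normB _ _)); rewrite -mulrA mulr_natl mulr2n.
  by apply: lerD.
have dI : P.-integrable setT (EFin \o (fun x => h u x - h v x)).
  by apply: (@bounded_integrable _ _ _ _ _ (L * `|u - v|)) => //; exact: measurable_funB.
have phi0 : \int[P]_x phi x = 0.
  rewrite RintegralB//; last first.
    by apply: (@bounded_integrable _ _ _ _ _ `|\int[P]_y h u y - \int[P]_y h v y|).
  rewrite Rintegral_cst// [fine _](_ : _ = 1); last exact: (congr1 fine (probability_setT P)).
  by rewrite mulr1 RintegralB// subrr.
have b0 : 0 <= 2 * L * `|u - v| by rewrite !mulr_ge0.
have := iid_sum_moment n0 hX mphi phib phi0 b0 ep p0.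
have r0 : 0 < Num.sqrt n%:R :> R by rewrite sqrtr_gt0 ltr0n.
have n0' : (0 : R) < n%:R by rewrite ltr0n.
have np0 : 0 <= (n%:R ^+ p)^-1 :> R by rewrite invr_ge0 exprn_ge0.
move=> /(lee_wpmul2l (x := ((n%:R ^+ p)^-1)%:E)) => /(_ ltac:(by rewrite lee_fin)).
rewrite -ge0_integralZl//; last 2 first.
- apply/measurable_EFinP; apply: measurable_funX; apply: measurable_sum => i.
  by apply: measurableT_comp => //; exact: measurable_funP.
- by move=> w _; rewrite lee_fin exprn_even_ge0.
move=> le1; apply: (le_trans _ (le_trans le1 _)).
  rewrite le_eqVlt; apply/orP; left; apply/eqP; apply: eq_integral => w _.
  rewrite -EFinM; congr (_%:E).
  rewrite /centered_mean -mulrBr -sumrB exprMn exprVn; congr (_ * _ ^+ _).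
  by apply: eq_bigr => i _; rewrite /phi; ring.
rewrite -EFinM lee_fin le_eqVlt; apply/orP; left; apply/eqP.
have {1}-> : n%:R = Num.sqrt n%:R * Num.sqrt n%:R :> R by rewrite -expr2 sqr_sqrtr// ltW.
rewrite !exprMn; field.
by rewrite !expf_neq0// gt_eqF.
Qed.

End fast_rate.

Lemma exists_pow2_gt (R : realType) (x : R) : exists S : nat, x < 2 ^+ S.
Proof.
exists (Num.truncn x).+1; apply: (lt_trans (truncnS_gt x)).
rewrite -natrX ltr_nat; exact: ltn_expl.
Qed.

Section peeling.
Context {R : realType} {N : nat}.


(** Either [e] is already of order [1 / r^2], or [c] lies in a shell [s], of outer
    radius [2^s / r], on which the margin bounds [e] below by [y = kap * 4^s / r^2]. In the
    latter case [e <= e^p / y^(p-1)], and [e^p] is controlled by the chaining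
    bound of the shell. *)
Lemma peeling_bound (p : nat) (a K D r e : R) (m c : 'rV[R]_N) (S J : nat)
    (G : 'rV[R]_N -> R) :
  ~~ odd p -> (0 < p)%N -> 0 < a -> 0 < r -> 0 <= K ->
  (forall u v, `|G u - G v| <= K * `|u - v|) ->
  `|c - m| <= D -> D < 2 ^+ S / r -> K * (2 * (2 ^+ S / r) / 2 ^+ J) <= (r ^+ 2)^-1 ->
  a * `|c - m| ^+ 2 <= e -> e <= G m - G c ->
  e <= 2 * (r ^+ 2)^-1 \/
  exists2 s : nat, (s <= S)%N &
    e <= 2 ^+ p * (r ^+ 2 / (Num.min (a / 4) 2 * 4 ^+ s)) ^+ p.-1 *
         chaining_bound m (2 ^+ s / r) p J G.
Proof.
move=> ep p0 a0 r0 K0 GK cD DS KJ ae eG.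
have [e2|e2] := leP e (2 * (r ^+ 2)^-1); [by left|right].
have rr0 : 0 < r ^+ 2 by rewrite exprn_gt0.
have ri0 : 0 < (r ^+ 2)^-1 by rewrite invr_gt0.
have e0 : 0 < e by apply: le_lt_trans e2; rewrite mulr_ge0// ltW.
have ex : exists s, `|c - m| < 2 ^+ s / r by exists S; exact: le_lt_trans DS.
have [s cs smin] := ex_minnP ex.
have sS : (s <= S)%N by apply: smin; exact: le_lt_trans DS.
exists s => //.
have ds0 : 0 < 2 ^+ s / r by rewrite divr_gt0// exprn_gt0.
have [U [U0 GU UZ]] := chaining (m := m) ds0 J ep p0 GK K0 cs.
have rem : K * (2 * (2 ^+ s / r) / 2 ^+ J) <= (r ^+ 2)^-1.
  apply: le_trans KJ; rewrite ler_wpM2l// ler_pM2r ?invr_gt0 ?exprn_gt0//.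
  by rewrite ler_pM2l// ler_pM2r ?invr_gt0// ler_eXn2l// ltr1n.
have eU : e <= 2 * U.
  have : e <= U + (r ^+ 2)^-1.
    apply: (le_trans eG); apply: (le_trans (ler_norm _)).
    by rewrite distrC; apply: (le_trans GU); rewrite lerD2l.
  by lra.
(* The inner radius of the shell [s + 1] is [2^s / r], whence [a / 4]; in the
   innermost shell the margin says nothing, and [2 / r^2 < e] is used. *)
set kap := Num.min (a / 4) 2.
have kap0 : 0 < kap by rewrite /kap lt_min divr_gt0//=.
have y0 : 0 < kap * 4 ^+ s / r ^+ 2 by rewrite divr_gt0// mulr_gt0// exprn_gt0.
have ey : kap * 4 ^+ s / r ^+ 2 <= e.
  case: s {sS ds0 GU UZ rem} cs smin y0 => [|s] cs smin y0.
    rewrite expr0 mulr1; apply: le_trans (ltW e2).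
    apply: ler_wpM2r; first exact: ltW.
    by rewrite /kap ge_min lexx orbT.
  have h : 2 ^+ s / r <= `|c - m|.
    by rewrite leNgt; apply/negP => /smin; rewrite ltnn.
  apply: le_trans ae.
  apply: (@le_trans _ _ (a * (2 ^+ s / r) ^+ 2)); last first.
    by rewrite ler_pM2l// lerXn2r ?nnegrE// divr_ge0 ?exprn_ge0 ?(ltW r0).
  rewrite expr_div_n mulrA; apply: ler_wpM2r; first exact: ltW.
  rewrite exprS mulrA.
  rewrite -exprM mulnC exprM (_ : 2 ^+ 2 = 4 :> R); last by ring.
  rewrite ler_wpM2r ?exprn_ge0// -ler_pdivlMr//.
  by rewrite /kap ge_min lexx.
rewrite -[r ^+ 2 / _]invrK invf_div exprVn -mulrA [X in _ <= _ * X]mulrC mulrA.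
rewrite ler_pdivlMr ?exprn_gt0//.
apply: (@le_trans _ _ (e ^+ p)).
  rewrite -[in leRHS](prednK p0) [in leRHS]exprS; apply: ler_wpM2l; first exact: ltW.
  by rewrite lerXn2r ?nnegrE// ltW.
apply: (@le_trans _ _ ((2 * U) ^+ p)).
  by rewrite lerXn2r ?nnegrE ?mulr_ge0 ?(ltW e0).
by rewrite exprMn ler_wpM2l// exprn_ge0.
Qed.

End peeling.

Section fast_rate_theorem.
Context {R : realType} {N : nat} (dT : measure_display) (T : measurableType dT)
  (P : probability T R).


(** Here [e] is the excess risk of the minimizer [c], and [m] is a reference point that may
    depend on the sample but stays in a finite list, so that the bounds of
    all the references can be added. *)
Theorem erm_fast_rate (h : 'rV[R]_N -> T -> R) (L B a D : R) (ms : seq 'rV[R]_N) :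
  (forall c, measurable_fun setT (h c)) ->
  (forall c c' x, `|h c x - h c' x| <= L * `|c - c'|) ->
  (forall c x, `|h c x| <= B) -> 0 <= L -> 0 < a ->
  exists2 C0 : R, 0 < C0 & forall n, (0 < n)%N ->
  forall (dO : measure_display) (Omega : measurableType dO)
    (Pr : probability Omega R) (X : 'I_n -> {RV Pr >-> T}), iid P X ->
  forall e : Omega -> R, measurable_fun setT e -> (forall w, 0 <= e w) ->
  {ae Pr, forall w, exists2 m, m \in ms & exists c,
     [/\ `|c - m| <= D, a * `|c - m| ^+ 2 <= e w &
      e w <= centered_mean P h (fun i => X i w) m - centered_mean P h (fun i => X i w) c]} ->
  (\int[Pr]_w (e w)%:E <= (C0 / n%:R)%:E)%E.
Proof.
move=> mh hL hB L0 a0.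
(* The factor [2^N] by which a grid is refined must be absorbed by [(2/3)^p], and the
   shells must be summable: [(2^s)^p / (4^s)^(p-1) = (2^s)^(2-p)]. *)
pose p := (N + 2).*2.
have ep : ~~ odd p by rewrite odd_double.
have p0 : (0 < p)%N by rewrite /p addn2.
have p3 : (3 < p)%N by rewrite /p addn2.
have q2 : 2 ^+ N * (2 / 3) ^+ p <= 2^-1 :> R.
  rewrite /p -muln2 mulnC exprM exprD mulrA -exprMn.
  rewrite (_ : 2 * (2 / 3) ^+ 2 = 8 / 9 :> R); last by field.
  apply: (@le_trans _ _ (1 * ((2 / 3) ^+ 2) ^+ 2)); last by lra.
  rewrite ler_wpM2r ?exprn_ge0//.
  by apply: exprn_ile1; lra.
have [A A0 HA] := centered_mean_moment P mh hL hB L0 ep p0.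
pose kap := Num.min (a / 4) 2.
have kap0 : 0 < kap by rewrite /kap lt_min divr_gt0//=.
pose C2 : R := 2 ^+ p * (kap ^+ p.-1)^-1 * (2 * A * 8 ^+ p).
have C20 : 0 <= C2 by rewrite !mulr_ge0 ?exprn_ge0 ?invr_ge0 ?exprn_ge0// ltW.
exists (2 + 2 * C2 * (size ms)%:R).
  apply: ltr_pwDl => //; apply: mulr_ge0 => //; exact: mulr_ge0.
move=> n n0 dO Omega Pr X hX e me e0 he.
set r : R := Num.sqrt n%:R.
have n0' : (0 : R) < n%:R by rewrite ltr0n.
have r0 : 0 < r by rewrite sqrtr_gt0.
have r2 : r ^+ 2 = n%:R by rewrite sqr_sqrtr// ltW.
pose K := 2 * L.
have K0 : 0 <= K by rewrite mulr_ge0.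
pose G w := centered_mean P h (fun i => X i w).
have GK w u v : `|G w u - G w v| <= K * `|u - v|.
  apply: (@centered_mean_lipschitz _ _ _ _ _ h L B) => //.
have mG u : measurable_fun setT (fun w => G w u).
  apply: measurable_funM => //; apply: measurable_sum => i; apply: measurable_funB => //.
  by apply: measurableT_comp => //; exact: measurable_funP.
have [S hS] := exists_pow2_gt (D * r).
have DS : D < 2 ^+ S / r by rewrite ltr_pdivlMr.
(* Beyond the level [J] the Lipschitz bound gives an error of at most [1 / n]. *)
have [J hJ] := exists_pow2_gt (K * (2 * (2 ^+ S / r)) * r ^+ 2).
have KJ : K * (2 * (2 ^+ S / r) / 2 ^+ J) <= (r ^+ 2)^-1.
  rewrite -[leRHS]mul1r ler_pdivlMr ?exprn_gt0//.
  rewrite (_ : K * (2 * (2 ^+ S / r) / 2 ^+ J) * r ^+ 2 =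
    K * (2 * (2 ^+ S / r)) * r ^+ 2 / 2 ^+ J); last by ring.
  by rewrite ler_pdivrMr ?exprn_gt0// mul1r ltW.
pose wt s : R := 2 ^+ p * (r ^+ 2 / (kap * 4 ^+ s)) ^+ p.-1.
have wt0 s : 0 <= wt s.
  by rewrite mulr_ge0 ?exprn_ge0// divr_ge0 ?exprn_ge0 ?mulr_ge0 ?exprn_ge0// ltW.
pose Z m s w := chaining_bound m (2 ^+ s / r) p J (G w).
have Z0 m s w : 0 <= Z m s w by exact: chaining_bound_ge0.
have mZ m s : measurable_fun setT (Z m s).
  apply: measurable_sum => j; apply: measurable_sum => z; apply: measurable_funX.
  by apply: measurable_funM => //; exact: measurable_funB.
pose Y w := 2 * (r ^+ 2)^-1 + \sum_(m <- ms) \sum_(s < S.+1) wt s * Z m s w.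
have mY' m : measurable_fun setT (fun w => \sum_(s < S.+1) wt s * Z m s w).
  by apply: measurable_sum => s; exact: measurable_funM.
have Y'0 m w : 0 <= \sum_(s < S.+1) wt s * Z m s w.
  by apply: sumr_ge0 => s _; exact: mulr_ge0.
have mY : measurable_fun setT Y.
  by apply: measurable_funD => //; exact: measurable_sum.
have c0 : 0 <= 2 * (r ^+ 2)^-1 by rewrite mulr_ge0// invr_ge0 exprn_ge0// ltW.
have Y0 w : 0 <= Y w by rewrite addr_ge0// sumr_ge0.
apply: (@le_trans _ _ (\int[Pr]_w (Y w)%:E)%E).
  apply: ae_ge0_le_integral => //.
  - by move=> w _; rewrite lee_fin.
  - exact/measurable_EFinP.
  - by move=> w _; rewrite lee_fin Y0.
  - exact/measurable_EFinP.
  - apply: filterS he => w [m mms [c [cD ae eG]]] _; rewrite lee_fin.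
    have [eb|[s sS es]] := peeling_bound ep p0 a0 r0 K0 (GK w) cD DS KJ ae eG.
      by apply: (le_trans eb); rewrite lerDl sumr_ge0.
    apply: (le_trans es); rewrite -/kap -/(wt s) -/(Z m s w).
    apply: (@le_trans _ _ (\sum_(s < S.+1) wt s * Z m s w)).
      have sS' : (s < S.+1)%N by [].
      rewrite (bigD1 (Ordinal sS'))//= lerDl sumr_ge0// => i _; exact: mulr_ge0.
    rewrite /Y (big_rem m)//= addrCA lerDl addr_ge0// sumr_ge0//.
have EZ m s : (\int[Pr]_w (wt s * Z m s w)%:E <= (C2 / n%:R * 2^-1 ^+ s)%:E)%E.
  under eq_integral do rewrite EFinM.
  rewrite ge0_integralZl ?lee_fin//; last 2 first.
  - exact/measurable_EFinP.
  - by move=> w _; rewrite lee_fin.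
  have ds0 : 0 < 2 ^+ s / r by rewrite divr_gt0// exprn_gt0.
  have Ar0 : 0 <= A / r ^+ p by rewrite divr_ge0// exprn_ge0// ltW.
  have := expectation_chaining_bound m J ds0 Ar0 ep mG (HA n n0 _ _ _ _ hX) q2.
  move=> /(lee_wpmul2l (x := (wt s)%:E)) => /(_ ltac:(by rewrite lee_fin)) /le_trans; apply.
  rewrite -EFinM lee_fin /wt /C2 -r2.
  have [t pt] : exists t, p = t.+3 by exists (N.*2).+1; rewrite /p addn2 !doubleS.
  rewrite pt /= (_ : 4 ^+ s = 2 ^+ s * 2 ^+ s :> R); last first.
    by rewrite -exprMn; congr (_ ^+ _); ring.
  rewrite exprVn; set u : R := 2 ^+ s.
  have u0 : 0 < u by rewrite exprn_gt0.
  have u1 : 1 <= u by rewrite exprn_ege1// ler1n.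
  have ut0 : 0 < u ^+ t by rewrite exprn_gt0.
  have rt0 : 0 < r ^+ t by rewrite exprn_gt0.
  have kt0 : 0 < kap ^+ t by rewrite exprn_gt0.
  rewrite [leLHS](_ : _ = 2 ^+ t.+3 / kap ^+ t.+2 * (2 * A * 8 ^+ t.+3) / r ^+ 2 / u
      * (u ^+ t)^-1); last first.
    rewrite !(expr_div_n, exprMn, exprS, expr0, mulr1); field.
    by rewrite !gt_eqF.
  rewrite ler_piMr ?invf_le1 ?exprn_ege1 ?ler1n//.
  have [k0 r0' u0'] := And3 (ltW kap0) (ltW r0) (ltW u0).
  apply: divr_ge0 => //; apply: divr_ge0; last exact: exprn_ge0.
  apply: mulr_ge0; first by apply: divr_ge0; exact: exprn_ge0.
  by apply: mulr_ge0; [exact: mulr_ge0|exact: exprn_ge0].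
rewrite /Y; under eq_integral do rewrite EFinD.
rewrite ge0_integralD//; last 2 first.
- by move=> w _; rewrite lee_fin sumr_ge0.
- by apply/measurable_EFinP; exact: measurable_sum.
rewrite integral_cst//= [Pr _](_ : _ = 1%E) ?mule1; last exact: probability_setT.
rewrite ge0_integral_sumr//.
apply: (@le_trans _ _ ((2 * (r ^+ 2)^-1)%:E + \sum_(m <- ms) (2 * C2 / n%:R)%:E)%E).
  apply: leeD => //; apply: lee_sum => m _.
  rewrite ge0_integral_sumr; last 2 first.
  - by move=> s; exact: measurable_funM.
  - by move=> s w; exact: mulr_ge0.
  apply: (@le_trans _ _ (\sum_(s < S.+1) (C2 / n%:R * 2^-1 ^+ s)%:E)%E).
    by apply: lee_sum => s _.
  rewrite sumEFin lee_fin -mulr_sumr.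
  have -> : 2 * C2 / n%:R = C2 / n%:R * 2 by ring.
  apply: ler_wpM2l; first by rewrite divr_ge0.
  suff -> : \sum_(s < S.+1) 2^-1 ^+ s = 2 * (1 - 2^-1 ^+ S.+1) :> R.
    by rewrite ler_piMr// gerBl exprn_ge0.
  elim: (S.+1) => [|k IH]; first by rewrite big_ord0 expr0 subrr mulr0.
  by rewrite big_ord_recr/= IH exprS; field.
rewrite sumEFin -EFinD lee_fin big_const_seq count_predT iter_addr_0 r2.
rewrite le_eqVlt; apply/orP; left; apply/eqP.
rewrite -[(2 * C2 / n%:R) *+ _]mulr_natr; ring.
Qed.

End fast_rate_theorem.

(** * Lebesgue measure on row vectors: translations and boxes *)
Lemma continuous_measurable_mx (R : realType) m n (f : 'M[R]_(m, n) -> R) :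
  continuous f -> measurable_fun setT f.
Proof.
move=> cf; apply: (measurability _ (RGenOpens.measurableE R)).
move=> /= _ [_ [a [b ->]] <-]; rewrite setTI; apply: open_measurable_mx.
by apply: open_comp => // x _; exact: cf.
Qed.

Section lebesgue_translation.
Context {R : realType}.
Local Notation mu := (@lebesgue_measure R).

Lemma ge0_integral_lebesgue_shift (a : R) (H : R -> \bar R) :
  measurable_fun setT H -> (forall x, 0 <= H x)%E ->
  (\int[mu]_x H (x + a)%R = \int[mu]_x H x)%E.
Proof.
move=> mH H0.
pose sh : measurableTypeR R -> measurableTypeR R := fun x => x + a.
have msh : measurable_fun setT sh.
  by apply: measurable_funD => //; exact: measurable_cst.
have shE A : measurable A -> pushforward mu sh A = mu A.
  move=> mA; apply/esym/(@lebesgue_measure_unique R) => //= _ [[x y]] _ <-.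
  rewrite /pushforward.
  have -> : sh @^-1` `]x, y]%classic = `]x - a, y - a]%classic.
    by apply/seteqP; split => z /=; rewrite !in_itv/= /sh ltrBlDr lerBrDr.
  rewrite !lebesgue_measure_itv /= !lte_fin ltrD2r.
  by case: ifP => // _; rewrite -!EFinB opprB addrA subrK.
transitivity (\int[pushforward mu sh]_x H x)%E.
  rewrite (ge0_integral_pushforward msh)//.
by apply: eq_measure_integral => A mA _; exact: shE.
Qed.

Definition cons_rV d (t : R) (y : 'rV[R]_d) : 'rV[R]_d.+1 := row_mx (const_mx t : 'rV_1) y.

Lemma cons_rV_head d t (y : 'rV[R]_d) (i : 'I_1) : cons_rV t y 0 (@lshift 1 d i) = t.
Proof. by apply: (etrans (row_mxEl _ _ _ _)); rewrite mxE. Qed.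

Lemma cons_rV_tail d t (y : 'rV[R]_d) (i : 'I_d) : cons_rV t y 0 (@rshift 1 d i) = y 0 i.
Proof. exact: row_mxEr. Qed.

Lemma measurable_cons_rV d :
  measurable_fun setT (fun p : measurableTypeR R * 'rV[R]_d => cons_rV p.1 p.2).
Proof.
apply: measurable_fun_mxP => i j; rewrite ord1.
case: (@split_ordP 1 d j) => j' ->.
  under eq_fun do rewrite cons_rV_head; exact: measurable_fst.
under eq_fun do rewrite cons_rV_tail.
by apply: (measurableT_comp (measurable_mx_entry 0 j')); exact: measurable_snd.
Qed.

Section cons_integral.
Variables (d : nat) (G : 'rV[R]_d.+1 -> \bar R).
Hypotheses (mG : measurable_fun setT G) (G0 : forall x, (0 <= G x)%E).

Let mGcons : measurable_fun setT
  (fun p : measurableTypeR R * 'rV[R]_d => G (cons_rV p.1 p.2)).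
Proof. exact: (measurableT_comp mG (@measurable_cons_rV d)). Qed.

Lemma measurable_cons_rV_section t : measurable_fun setT (fun y => G (cons_rV t y)).
Proof. exact: (measurableT_comp mGcons (measurable_pair1 _)). Qed.

Lemma measurable_cons_rV_integral :
  measurable_fun setT (fun t : R => \int[@lebesgue_rV R d]_y G (cons_rV t y))%E.
Proof.
exact: (@measurable_fun_fubini_tonelli_F _ _ _ _ R (@lebesgue_rV R d)
    (fun p : measurableTypeR R * 'rV[R]_d => G (cons_rV p.1 p.2))).
Qed.

(** Tonelli, for the first coordinate and the others. *)
Lemma lebesgue_rVS_integral :
  (\int[@lebesgue_rV R d.+1]_x G x =
   \int[mu]_t \int[@lebesgue_rV R d]_y G (cons_rV t y))%E.
Proof.
transitivity (\int[(mu \x @lebesgue_rV R d)%E]_p G (cons_rV p.1 p.2))%E.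
  by rewrite -(ge0_integral_pushforward (@measurable_cons_rV d)
    (mu \x @lebesgue_rV R d)%E measurableT mG).
by rewrite (@fubini_tonelli1 _ _ _ _ R mu (@lebesgue_rV R d)
  (fun p => G (cons_rV p.1 p.2))).
Qed.

End cons_integral.

Lemma measurable_shift_rV d (a : 'rV[R]_d) : measurable_fun setT (fun x : 'rV[R]_d => x + a).
Proof.
apply: measurable_fun_mxP => i j; under eq_fun do rewrite mxE.
by apply: measurable_funD => //; exact: measurable_mx_entry.
Qed.

Lemma ge0_integral_lebesgue_rV_shift d (a : 'rV[R]_d) (G : 'rV[R]_d -> \bar R) :
  measurable_fun setT G -> (forall x, 0 <= G x)%E ->
  (\int[@lebesgue_rV R d]_x G (x + a)%R = \int[@lebesgue_rV R d]_x G x)%E.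
Proof.
elim: d a G => [|d IH] a G mG G0.
  by apply: eq_integral => x _; congr G; apply/rowP => -[].
have consD t y : cons_rV t y + a = cons_rV (t + a 0 0) (y + rsubmx (a : 'rV_(1 + d))).
  apply/rowP => j; rewrite mxE.
  case: (@split_ordP 1 d j) => j' ->; rewrite ?cons_rV_head ?cons_rV_tail ?mxE//.
  by congr (_ + a 0 _); apply/val_inj; rewrite /= ord1.
rewrite !lebesgue_rVS_integral//; last exact: (measurableT_comp mG (measurable_shift_rV a)).
have mH := measurable_cons_rV_integral mG G0.
rewrite -[RHS](ge0_integral_lebesgue_shift (a 0 0) mH); last first.
  by move=> t; exact: integral_ge0.
apply: eq_integral => t _.
rewrite -[RHS](IH (rsubmx (a : 'rV_(1 + d))))//.
  by apply: eq_integral => y _; rewrite consD.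
exact: measurable_cons_rV_section.
Qed.

Lemma measurable_mx_box m n (r : R) : measurable [set x : 'M[R]_(m, n) | `|x| <= r].
Proof.
rewrite (_ : [set _ | _] = (fun x => `|x|) @^-1` `]-oo, r]%classic); last first.
  by apply/seteqP; split => x /=; rewrite in_itv.
rewrite -[X in measurable X]setTI.
apply: (@continuous_measurable_mx R m n (fun x => `|x|)) => //.
exact: norm_continuous.
Qed.

Lemma measurable_rV_ball d (x : 'rV[R]_d) (e : R) : measurable [set y | `|y - x| <= e].
Proof.
rewrite (_ : [set _ | _] = (fun y => y - x) @^-1` [set y | `|y| <= e])//.
rewrite -[X in measurable X]setTI.
by apply: (measurable_shift_rV (- x)) => //; exact: measurable_mx_box.
Qed.

Lemma lebesgue_rV_ball d (x : 'rV[R]_d) (e : R) :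
  @lebesgue_rV R d [set y | `|y - x| <= e] = @lebesgue_rV R d [set y | `|y| <= e].
Proof.
have lE (A : set 'rV[R]_d) : measurable A ->
    (@lebesgue_rV R d A = \int[@lebesgue_rV R d]_y (\1_A y)%:E)%E.
  by move=> mA; rewrite integral_indic// setIT.
have mball := measurable_rV_ball x e; have mbox := @measurable_mx_box 1 d e.
rewrite (lE _ mball) (lE _ mbox) -[RHS](ge0_integral_lebesgue_rV_shift (- x))//.
by apply/measurable_EFinP; exact: measurable_indic.
Qed.
Lemma lebesgue_rV_boxS d (r : R) : 0 <= r ->
  (@lebesgue_rV R d.+1 [set x : 'rV[R]_d.+1 | (`|x| <= r)%R] =
   (r + r)%:E * @lebesgue_rV R d [set x : 'rV[R]_d | (`|x| <= r)%R])%E.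
Proof.
move=> r0.
set B := [set x : 'rV[R]_d.+1 | _]; set B' := [set x : 'rV[R]_d | _].
have mB : measurable B by exact: measurable_mx_box.
have mB' : measurable B' by exact: measurable_mx_box.
have -> : (@lebesgue_rV R d.+1 B = \int[@lebesgue_rV R d.+1]_x (\1_B x)%:E)%E.
  by rewrite integral_indic// setIT.
have m1 : measurable_fun setT (fun x : 'rV[R]_d.+1 => (\1_B x : R)%:E).
  by apply/measurable_EFinP; exact: measurable_indic.
have m10 (x : 'rV[R]_d.+1) : (0 <= (\1_B x : R)%:E)%E by rewrite lee_fin.
rewrite lebesgue_rVS_integral//.
transitivity (\int[mu]_t ((\1_(`[(- r)%R, r]%classic) t)%:E * @lebesgue_rV R d B'))%E.
  apply: eq_integral => t _.
  rewrite (_ : @lebesgue_rV R d B' = \int[@lebesgue_rV R d]_y (\1_B' y)%:E)%E; last first.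
    by rewrite integral_indic// setIT.
  have m1' : measurable_fun setT (fun x : 'rV[R]_d => (\1_B' x : R)%:E).
    by apply/measurable_EFinP; exact: measurable_indic.
  rewrite -ge0_integralZl ?lee_fin//.
  apply: eq_integral => y _; rewrite -EFinM !indicE -natrM mulnb; congr (_%:R%:E).
  congr nat_of_bool; apply/idP/andP; rewrite !inE /B /B' /= in_itv/= -ler_norml.
    move=> h; split; apply: (le_trans _ h).
      by rewrite -[X in `|X|](cons_rV_head t y 0); exact: mx_norm_entry.
    apply: mx_norm_le => // i j; rewrite ord1.
    by rewrite -(cons_rV_tail t y j); exact: mx_norm_entry.
  move=> [tr yr]; apply: mx_norm_le => // i j; rewrite ord1.
  case: (@split_ordP 1 d j) => j' ->; rewrite ?cons_rV_head ?cons_rV_tail//.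
  by apply: le_trans yr; exact: mx_norm_entry.
rewrite ge0_integralZr//; last by apply/measurable_EFinP; exact: measurable_indic.
congr (_ * _)%E.
rewrite integral_indic//= setIT.
rewrite [lebesgue_measure _](lebesgue_measure_itv `[(- r)%R, r])/= lte_fin -EFinB opprK.
case: ltP => // rr; have -> : r = 0 by lra.
by rewrite addr0.
Qed.

Lemma lebesgue_rV_box_lty d (r : R) :
  (@lebesgue_rV R d [set x : 'rV[R]_d | (`|x| <= r)%R] < +oo)%E.
Proof.
have [r0|r0] := leP 0 r; last first.
  rewrite (_ : [set _ | _] = set0) ?measure0 ?ltry//.
  by apply/seteqP; split => // x /= /(le_trans (normr_ge0 x)); rewrite leNgt r0.
elim: d => [|d IH]; first by rewrite /lebesgue_rV /= diracE; exact: ltry.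
by rewrite lebesgue_rV_boxS//; apply: lte_mul_pinfty => //; rewrite lee_fin addr_ge0.
Qed.

Lemma lebesgue_rV_box_gt0 d (r : R) : 0 < r ->
  (0 < @lebesgue_rV R d [set x : 'rV[R]_d | (`|x| <= r)%R])%E.
Proof.
move=> r0; elim: d => [|d IH].
  rewrite /lebesgue_rV /= diracE mem_set ?lte_fin//=.
  by apply: mx_norm_le; [exact: ltW|move=> i []].
by rewrite lebesgue_rV_boxS ?ltW// mule_gt0// lte_fin addr_gt0.
Qed.

End lebesgue_translation.

(** * Averaging along a direction *)
Section averaging.
Context {R : realType} {d : nat}.
Local Notation mu := (@lebesgue_measure R).
Local Notation lam := (@lebesgue_rV R d).
Local Notation I01 := (\1_(`[0%R, 1%R]%classic) : R -> R).

Lemma measurable_line (w : 'rV[R]_d) :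
  measurable_fun setT (fun p : 'rV[R]_d * measurableTypeR R => p.1 + (p.2 : R) *: w).
Proof.
apply: measurable_fun_mxP => i j; rewrite ord1.
under eq_fun do rewrite !mxE.
apply: measurable_funD.
  by apply: (measurableT_comp (measurable_mx_entry 0 j)); exact: measurable_fst.
by apply: measurable_funM => //; exact: measurable_snd.
Qed.

Lemma measurable_I01 : measurable_fun setT I01.
Proof. exact: measurable_indic. Qed.

Lemma integral_I01 : (\int[mu]_u (I01 u)%:E = 1)%E.
Proof.
rewrite integral_indic//= setIT.
by rewrite [lebesgue_measure _](lebesgue_measure_itv `[0%R, 1%R])/= lte01 oppr0 adde0.
Qed.

Lemma measurable_average (w : 'rV[R]_d) (G : 'rV[R]_d -> \bar R) :
  measurable_fun setT G ->
  measurable_fun setT (fun p : 'rV[R]_d * measurableTypeR R =>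
    (I01 p.2)%:E * G (p.1 + (p.2 : R) *: w)%R)%E.
Proof.
move=> mG; apply: emeasurable_funM.
  apply/measurable_EFinP; apply: (measurableT_comp measurable_I01); exact: measurable_snd.
exact: (measurableT_comp mG (measurable_line w)).
Qed.


(** By translation invariance the integral does not change when [G x] is replaced by its
    average over the segment from [x] to [x + w]. Quantities that are singular across a
    hypersurface transverse to [w] become regular after averaging. *)
Lemma ge0_integral_average (w : 'rV[R]_d) (G : 'rV[R]_d -> \bar R) :
  measurable_fun setT G -> (forall x, 0 <= G x)%E ->
  (\int[lam]_x G x = \int[lam]_x \int[mu]_u ((I01 u)%:E * G (x + u *: w)%R))%E.
Proof.
move=> mG G0.
rewrite (fubini_tonelli (m1 := lam) (m2 := mu)
  (fun p : 'rV[R]_d * measurableTypeR R => (I01 p.2)%:E * G (p.1 + (p.2 : R) *: w)%R)%E); last 2 first.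
- exact: measurable_average.
- by move=> x; rewrite mule_ge0// lee_fin.
transitivity (\int[mu]_u ((I01 u)%:E * \int[lam]_x G x))%E.
  rewrite ge0_integralZr//; last 2 first.
  - by apply/measurable_EFinP; exact: measurable_I01.
  - exact: integral_ge0.
  by rewrite integral_I01 mul1e.
apply: eq_integral => u _ /=.
rewrite ge0_integralZl ?lee_fin//; last first.
  exact: (measurableT_comp mG (measurable_shift_rV _)).
by rewrite ge0_integral_lebesgue_rV_shift.
Qed.


(** A line in the direction [w] meets the zeros of [B] in one point, so the average of
    their indicator vanishes. *)
Lemma null_zeros_of_affine (B : 'rV[R]_d -> R) (w : 'rV[R]_d) (kap : R) :
  measurable_fun setT B -> kap != 0 -> (forall x u, B (x + u *: w) = B x + u * kap) ->
  lam (B @^-1` [set 0]) = 0%E.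
Proof.
move=> mB k0 Bw; set S := B @^-1` [set 0].
have mS : measurable S by rewrite -[S]setTI; exact: mB.
have -> : (lam S = \int[lam]_x (\1_S x)%:E)%E by rewrite integral_indic// setIT.
have m1 : measurable_fun setT (fun x => (\1_S x : R)%:E).
  by apply/measurable_EFinP; exact: measurable_indic.
rewrite (ge0_integral_average w m1); last by move=> x; rewrite lee_fin.
apply: integral0_eq => x _.
rewrite (_ : (fun u : R => _) = fun u => (I01 u * \1_S (x + u *: w))%:E) //.
apply/eqP; rewrite eq_le integral_ge0 ?andbT; last by move=> u _; rewrite lee_fin mulr_ge0.
apply: (@le_trans _ _ (\int[mu]_u (\1_[set (- B x / kap)] u)%:E)%E); last first.
  rewrite integral_indic//= setIT.
  by rewrite [lebesgue_measure _](lebesgue_measure_set1 (- B x / kap)).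
apply: ge0_le_integral => //.
- exact: (measurableT_comp (measurable_average w m1) (measurable_pair1 x)).
- by apply/measurable_EFinP; exact: measurable_indic.
move=> u _; rewrite lee_fin !indicE.
have [|] := boolP (x + u *: w \in S); last by rewrite mulr0.
rewrite inE /S /= Bw => h; rewrite mulr1.
have -> : u \in [set - B x / kap].
  rewrite inE /=; apply: (mulIf k0); rewrite divfK//.
  by apply/eqP; rewrite -addr_eq0 addrC; apply/eqP.
by rewrite lern1 leq_b1.
Qed.

Lemma boxed_integrable (F : 'rV[R]_d -> R) (M r : R) :
  measurable_fun setT F -> (forall x, `|F x| <= M) -> (forall x, r < `|x| -> F x = 0) ->
  lam.-integrable setT (EFin \o F).
Proof.
move=> mF FM F0.
have mbox := @measurable_mx_box R 1 d r.
apply: (@le_integrable _ _ _ _ _ _ _ (fun x => M%:E * (\1_[set x : 'rV[R]_d | `|x| <= r] x)%:E)%E) => //.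
- exact/measurable_EFinP.
- move=> x _; rewrite -EFinM !abse_EFin lee_fin indicE.
  have [xr|xr] := leP `|x| r.
    by rewrite mem_set//= mulr1; apply: (le_trans (FM x)); exact: ler_norm.
  by rewrite F0// normr0.
apply: integrableZl => //; apply/integrableP; split.
  by apply/measurable_EFinP; exact: measurable_indic.
under eq_integral do rewrite gee0_abs ?lee_fin//.
rewrite integral_indic// setIT; exact: lebesgue_rV_box_lty.
Qed.

Lemma integral_lebesgue_rV_shift (F : 'rV[R]_d -> R) (a : 'rV[R]_d) :
  measurable_fun setT F ->
  (\int[lam]_x (F (x + a)%R)%:E = \int[lam]_x (F x)%:E)%E.
Proof.
move=> mF; have mFE : measurable_fun setT (EFin \o F) by exact/measurable_EFinP.
rewrite integralE [RHS]integralE; congr (_ - _)%E.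
  rewrite -(ge0_integral_lebesgue_rV_shift a (measurable_funepos mFE)) //.
  by apply: eq_integral => x _; rewrite !funeposE.
rewrite -(ge0_integral_lebesgue_rV_shift a (measurable_funeneg mFE)) //.
by apply: eq_integral => x _; rewrite !funenegE.
Qed.

Section average_boxed.
Variables (F : 'rV[R]_d -> R) (M r : R) (w : 'rV[R]_d).
Hypotheses (mF : measurable_fun setT F) (FM : forall x, `|F x| <= M)
  (F0 : forall x, r < `|x| -> F x = 0).

Lemma segment_integrable x : mu.-integrable setT (EFin \o (fun u => I01 u * F (x + u *: w))).
Proof.
have gI : mu.-integrable setT (fun u => M%:E * (I01 u)%:E)%E.
  apply: integrableZl => //; apply/integrableP; split.
    by apply/measurable_EFinP; exact: measurable_I01.
  under eq_integral do rewrite gee0_abs ?lee_fin//.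
  by rewrite integral_I01 ltry.
apply: (le_integrable measurableT _ _ gI).
  apply: (measurableT_comp (measurable_average w (G := EFin \o F) _) (measurable_pair1 x)).
  exact/measurable_EFinP.
move=> u _; rewrite /= lee_fin normrM ger0_norm// mulrC normrM [X in _ <= _ * X]ger0_norm//.
by rewrite ler_wpM2r//; apply: (le_trans (FM _)); exact: ler_norm.
Qed.

Let f (p : 'rV[R]_d * measurableTypeR R) : \bar R :=
  (I01 p.2 * F (p.1 + (p.2 : R) *: w))%:E.

Let mf : measurable_fun setT f.
Proof.
by apply: (measurable_average w (G := EFin \o F)); exact/measurable_EFinP.
Qed.

Let fI : (lam \x mu)%E.-integrable setT f.
Proof.
apply/(integrable21ltyP lam mu mf).
have aI : lam.-integrable setT (EFin \o (fun x => `|F x|)).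
  apply: (boxed_integrable (M := M) (r := r)).
  - exact: measurableT_comp.
  - by move=> x; rewrite normr_id.
  - by move=> x /F0 ->; rewrite normr0.
rewrite [X in (X < _)%E](_ : _ =
    \int[mu]_u ((I01 u)%:E * \int[lam]_x `|F x|%:E))%E; last first.
  apply: eq_integral => u _ /=.
  rewrite -(@integral_lebesgue_rV_shift (fun x => `|F x|) (u *: w)); last exact: measurableT_comp.
  rewrite -ge0_integralZl ?lee_fin//; last first.
    apply/measurable_EFinP; apply: measurableT_comp => //.
    exact: (measurableT_comp mF (measurable_shift_rV _)).
  by apply: eq_integral => x _; rewrite -EFinM normrM ger0_norm.
have E0 : (0 <= \int[lam]_x `|F x|%:E)%E by apply: integral_ge0 => x _; rewrite lee_fin.
rewrite ge0_integralZr//; last by apply/measurable_EFinP; exact: measurable_I01.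
rewrite integral_I01 mul1e; move/integrableP: aI => [_].
by under eq_integral do rewrite /= normr_id.
Qed.

Lemma Rintegral_average :
  \int[lam]_x F x = \int[lam]_x (\int[mu]_u (I01 u * F (x + u *: w))).
Proof.
congr fine.
transitivity (\int[lam]_x \int[mu]_u f (x, u))%E; last first.
  apply: eq_integral => x _; exact/EFin_Rintegral/segment_integrable.
rewrite (Fubini fI).
transitivity (\int[mu]_u ((I01 u)%:E * \int[lam]_x (F x)%:E))%E; last first.
  apply: eq_integral => u _.
  rewrite -(integral_lebesgue_rV_shift (u *: w))//.
  rewrite -integralZl//.
  apply: (boxed_integrable (M := M) (r := r + `|u *: w|)).
  - exact: (measurableT_comp mF (measurable_shift_rV _)).
  - by move=> x.
  - move=> x xr; apply: F0; have := ler_normB (x + u *: w) (u *: w).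
    by rewrite addrK; lra.
have FI := boxed_integrable mF FM F0.
rewrite (EFin_Rintegral FI).
rewrite integralZr//.
  by rewrite integral_I01 mul1e.
apply/integrableP; split.
  by apply/measurable_EFinP; exact: measurable_I01.
under eq_integral do rewrite gee0_abs ?lee_fin//.
by rewrite integral_I01 ltry.
Qed.

Lemma measurable_Rintegral_average :
  measurable_fun setT (fun x : 'rV[R]_d => \int[mu]_u (I01 u * F (x + u *: w))).
Proof.
apply/measurable_EFinP; rewrite (_ : _ \o _ = fubini_F mu f).
  exact: measurable_fubini_F fI.
by apply/funext => x; rewrite /fubini_F /= -EFin_Rintegral//; exact: segment_integrable.
Qed.

End average_boxed.
End averaging.

(** * Differentiating integrals over moving half-spaces *)
Lemma Rintegral_dominated_convergence d (T : measurableType d) (R : realType)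
    (nu : {measure set T -> \bar R}) (K_ : nat -> T -> R) (K g : T -> R) :
  (forall n, measurable_fun setT (K_ n)) -> measurable_fun setT K ->
  {ae nu, forall x, K_ n x @[n --> \oo] --> K x} ->
  nu.-integrable setT (EFin \o g) -> (forall n x, `|K_ n x| <= g x) ->
  nu.-integrable setT (EFin \o K) /\
  \int[nu]_x K_ n x @[n --> \oo] --> \int[nu]_x K x.
Proof.
move=> mK_ mK KK gI Kg.
have KI n : nu.-integrable setT (EFin \o K_ n).
  apply: (le_integrable measurableT _ _ gI); first exact/measurable_EFinP.
  by move=> x _; rewrite /= lee_fin; apply: (le_trans (Kg n x)); exact: ler_norm.
have := @dominated_convergence _ T R nu setT measurableT (fun n => EFin \o K_ n)
  (EFin \o K) (EFin \o g).
case.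
- by move=> n; exact/measurable_EFinP.
- exact/measurable_EFinP.
- by apply: filterS KK => x Kx _; apply: cvg_EFin; [exact: nearW|].
- exact: gI.
- by apply: aeW => x n _; rewrite /= lee_fin.
move=> KI' _ cv; split => //.
apply: (@fine_cvg _ _ _ _ (fun n => (\int[nu]_x (K_ n x)%:E)%E)).
by rewrite -(EFin_Rintegral KI').
Qed.

Section slab.
Context {R : realType}.
Local Notation mu := (@lebesgue_measure R).
Local Notation I01 := (\1_(`[0%R, 1%R]%classic) : R -> R).

Definition below (s u : R) : R := (u <= s)%R%:R.

Lemma measurable_below s : measurable_fun setT (below s).
Proof.
rewrite (_ : below s = \1_(`]-oo, s]%classic)); first exact: measurable_indic.
by apply/funext => u; rewrite indicE /below mem_setE in_itv.
Qed.

(** The integrand vanishes unless [u] lies between the two levels. *)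
Lemma slab_bound (s s' M : R) (phi : R -> R) : measurable_fun setT phi -> 0 <= M ->
  (forall u, `|u - s| <= `|s' - s| -> `|phi u| <= M) ->
  mu.-integrable setT (EFin \o (fun u => I01 u * ((below s' u - below s u) * phi u))) /\
  `|\int[mu]_u (I01 u * ((below s' u - below s u) * phi u))| <= M * `|s' - s|.
Proof.
move=> mphi M0 phiM.
set J := (`[Num.min s s', Num.max s s']%classic : set R).
have mJ : measurable J by exact: measurable_itv.
set g : R -> R := fun u => M * \1_J u.
have ss : Num.min s s' <= Num.max s s' by rewrite ge_min !le_max lexx.
have muJ : mu J = `|s' - s|%:E.
  rewrite [LHS](lebesgue_measure_itv `[Num.min s s', Num.max s s'])/= lte_fin.
  have [ss'|ss'] := ltP s s'.
    by rewrite ss' -EFinB gtr0_norm// subr_gt0.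
  rewrite lt_neqAle ss' andbT; have [->|ne] := eqVneq s' s; first by rewrite subrr normr0.
  by rewrite -EFinB ler0_norm ?opprB// subr_le0.
have gI : mu.-integrable setT (EFin \o g).
  rewrite (_ : _ \o _ = fun u => M%:E * (\1_J u)%:E)%E//.
  apply: integrableZl => //; apply/integrableP; split.
    by apply/measurable_EFinP; exact: measurable_indic.
  under eq_integral do rewrite gee0_abs ?lee_fin//.
  by rewrite integral_indic//= setIT [lebesgue_measure _]muJ ltry.
set f : R -> R := fun u => _.
have fg u : `|f u| <= g u.
  rewrite /f /g normrM -[leRHS]mul1r; apply: ler_pM => //.
    by rewrite ger0_norm// indicE; case: (_ \in _).
  have bJ : Num.min s s' <= u -> u <= Num.max s s' -> \1_J u = 1 :> R.
    by move=> h1 h2; rewrite indicE mem_set// /J/= in_itv/= h1.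
  rewrite normrM /below.
  have [us'|us'] := leP u s'; have [us|us] := leP u s.
  - by rewrite subrr normr0 mul0r mulr_ge0.
  - rewrite bJ ?ge_min ?le_max ?us' ?(ltW us) ?orbT// mulr1 subr0 normr1 mul1r.
    by apply: phiM; rewrite !ger0_norm; lra.
  - rewrite bJ ?ge_min ?le_max ?us ?(ltW us') ?orbT// mulr1 sub0r normrN normr1 mul1r.
    by apply: phiM; rewrite !ler0_norm; lra.
  - by rewrite subrr normr0 mul0r mulr_ge0.
have mf : measurable_fun setT f.
  apply: measurable_funM; first exact: measurable_indic.
  by apply: measurable_funM => //; apply: measurable_funB; exact: measurable_below.
have fI : mu.-integrable setT (EFin \o f).
  apply: (le_integrable measurableT _ _ gI); first exact/measurable_EFinP.
  by move=> u _; rewrite /= lee_fin; apply: (le_trans (fg u)); exact: ler_norm.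
split => //.
apply: (le_trans (le_normr_Rintegral measurableT fI)).
have -> : M * `|s' - s| = \int[mu]_u g u.
  rewrite /g RintegralZl//.
    by rewrite /Rintegral integral_indic//= setIT [lebesgue_measure _]muJ.
  apply/integrableP; split.
    by apply/measurable_EFinP; exact: measurable_indic.
  under eq_integral do rewrite gee0_abs ?lee_fin//.
  by rewrite integral_indic//= setIT [lebesgue_measure _]muJ ltry.
apply: le_Rintegral => //.
apply: (le_integrable measurableT _ _ gI).
  by apply/measurable_EFinP; exact: measurableT_comp.
by move=> u _; rewrite /= lee_fin normr_id; apply: (le_trans (fg u)); exact: ler_norm.
Qed.

Lemma slab_width (s s' : R) : 0 < s < 1 -> 0 < s' < 1 ->
  \int[mu]_u (I01 u * (below s' u - below s u)) = s' - s.
Proof.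
have H x : 0 < x < 1 -> mu.-integrable setT (EFin \o (fun u => I01 u * below x u)) /\
    \int[mu]_u (I01 u * below x u) = x.
  move=> /andP[x0 x1].
  have E u : I01 u * below x u = \1_(`[0, x]%classic) u.
    rewrite !indicE !mem_setE !in_itv/= /below.
    have [ux|ux] := leP u x; last by rewrite mulr0 andbF.
    by rewrite (le_trans ux (ltW x1)) mulr1 !andbT.
  have muE : mu `[0, x]%classic = x%:E.
    by rewrite [LHS](lebesgue_measure_itv `[0, x])/= lte_fin x0 -EFinB subr0.
  rewrite (_ : (fun u => _) = \1_(`[0, x]%classic)); last by apply/funext.
  split.
    apply/integrableP; split.
      by apply/measurable_EFinP; exact: measurable_indic.
    under eq_integral do rewrite /= ger0_norm//.
    by rewrite integral_indic//= setIT [lebesgue_measure _]muE ltry.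
  by rewrite /Rintegral integral_indic//= setIT [lebesgue_measure _]muE.
move=> /H[I1 E1] /H[I2 E2].
by under eq_Rintegral do rewrite mulrBr; rewrite RintegralB// E1 E2.
Qed.

(** If the level [s] lies outside the unit interval, so do the nearby levels and the integral
    vanishes; inside, the slab between the two levels has a width equivalent to [t * sg],
    and [phi_] is nearly constant on it. *)
Lemma slab_cvg (s_ t_ : nat -> R) (s sg l M : R) (phi_ : nat -> R -> R) :
  (forall n, t_ n != 0) -> s_ n @[n --> \oo] --> s ->
  (t_ n)^-1 * (s_ n - s) @[n --> \oo] --> sg ->
  (forall n, measurable_fun setT (phi_ n)) -> (forall n u, `|phi_ n u| <= M) ->
  s != 0 -> s != 1 ->
  (0 < s < 1 -> phi_ p.1 p.2 @[p --> filter_prod \oo (nbhs s)] --> l) ->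
  (t_ n)^-1 * (\int[mu]_u (I01 u * ((below (s_ n) u - below s u) * phi_ n u)))
     @[n --> \oo] --> (if 0 < s < 1 then sg * l else 0).
Proof.
move=> t0 ss sgE mphi phiM sn0 sn1 phil.
case: ifPn => s01; last first.
  apply: cvg_near_cst.
  have [sneg|spos] := ltP s 0.
    have : \forall n \near \oo, s_ n < 0 by apply: (cvgr_lt _ ss).
    apply: filterS => n sn.
    rewrite (_ : Rintegral _ _ _ = 0) ?mulr0//.
    rewrite (@eq_Rintegral _ _ _ _ _ (cst 0)) ?Rintegral_cst ?mul0r// => u _.
    rewrite indicE mem_setE in_itv/= /below.
    have [u0|u0] := leP 0 u; last by rewrite mul0r.
    by rewrite !leNgt (lt_le_trans sn u0) (lt_le_trans sneg u0) subrr mul0r mulr0.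
  have s1 : 1 < s.
    have s0 : 0 < s by rewrite lt_neqAle eq_sym sn0.
    by move: s01; rewrite s0 /= -leNgt le_eqVlt eq_sym (negbTE sn1).
  have : \forall n \near \oo, 1 < s_ n by apply: (cvgr_gt _ ss).
  apply: filterS => n sn.
  rewrite (_ : Rintegral _ _ _ = 0) ?mulr0//.
  rewrite (@eq_Rintegral _ _ _ _ _ (cst 0)) ?Rintegral_cst ?mul0r// => u _.
  rewrite indicE mem_setE in_itv/= /below.
  have [u0|u0] := leP u 1; last by rewrite andbF mul0r.
  by rewrite (le_trans u0 (ltW sn)) (le_trans u0 (ltW s1)) subrr mul0r mulr0.
have {}phil := phil s01.
have [s0 s1] := andP s01.
set v : nat -> R := fun n => _; pose y n := (t_ n)^-1 * (s_ n - s) * l.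
suff h : v n - y n @[n --> \oo] --> 0.
  rewrite (_ : v = fun n => (v n - y n) + y n); last by apply/funext => n; rewrite subrK.
  by rewrite -[sg * l]add0r; apply: cvgD => //; exact: cvgMr_tmp.
rewrite /v /y {v y}.
have M0 : 0 <= M by apply: le_trans (phiM 0%N 0).
apply/cvgr0Pnorm_le => e e0.
pose e' := e / (`|sg| + 1).
have sg1 : 0 < `|sg| + 1 by rewrite ltr_wpDl.
have e'0 : 0 < e' by rewrite divr_gt0.
have [[A B] /= [[N _ NA] /nbhs_ballP[del /= del0 delB]] AB] :
  filter_prod \oo (nbhs s) (fun p => `|l - phi_ p.1 p.2| <= e').
  by move/cvgrPdist_le : phil; apply.
near=> n.
have Nn : (N <= n)%N by near: n; exists N.
have sn0' : 0 < s_ n by near: n; apply: (cvgr_gt _ ss).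
have sn1' : s_ n < 1 by near: n; apply: (cvgr_lt _ ss).
have sd : `|s - s_ n| < del by near: n; move/cvgrPdist_lt : ss; apply.
have sgb : `|(t_ n)^-1 * (s_ n - s)| <= `|sg| + 1.
  have : `|sg - (t_ n)^-1 * (s_ n - s)| <= 1.
    by near: n; move/cvgrPdist_le : sgE; apply.
  move=> h; rewrite -lerBlDl; apply: le_trans h.
  by rewrite distrC; exact: lerB_dist.
have ml : measurable_fun setT (fun _ : R => l) by exact: measurable_cst.
have [I1 _] := @slab_bound s (s_ n) _ _ (mphi n) M0 (fun u _ => phiM n u).
have [I2 _] := @slab_bound s (s_ n) _ _ ml (normr_ge0 l) (fun u _ => lexx _).
have mphil : measurable_fun setT (fun u => phi_ n u - l) by exact: measurable_funB.
have phil' u : `|u - s| <= `|s_ n - s| -> `|phi_ n u - l| <= e'.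
  move=> us; rewrite distrC; apply: (AB (n, u)); split => /=; first exact: NA.
  by apply: delB; rewrite /ball/= distrC; apply: (le_lt_trans us); rewrite distrC.
have [_ h] := slab_bound mphil (ltW e'0) phil'.
have E : \int[mu]_u (I01 u * ((below (s_ n) u - below s u) * phi_ n u)) - (s_ n - s) * l =
   \int[mu]_u (I01 u * ((below (s_ n) u - below s u) * (phi_ n u - l))).
  rewrite -(slab_width s01 (s' := s_ n)) ?sn0'//.
  rewrite -RintegralZr//; last first.
    have m1 : measurable_fun setT (fun _ : R => 1 : R) by exact: measurable_cst.
    have [I3 _] := @slab_bound s (s_ n) _ _ m1 (normr_ge0 1) (fun u _ => lexx _).
    by move: I3; under [X in _.-integrable _ (EFin \o X)]funext do rewrite mulr1.
  rewrite -RintegralB//; last first.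
    by move: I2; under [X in _.-integrable _ (EFin \o X)]funext do rewrite mulrA.
  by apply: eq_Rintegral => u _; ring.
rewrite -mulrA -mulrBr E normrM.
apply: (@le_trans _ _ (`|(t_ n)^-1| * (e' * `|s_ n - s|))).
  by rewrite ler_wpM2l.
rewrite mulrCA -normrM; apply: (@le_trans _ _ (e' * (`|sg| + 1))).
  by rewrite ler_wpM2l// ltW.
by rewrite /e' divfK// gt_eqF.
Unshelve. all: end_near.
Qed.

End slab.

Section halfspace_derivative.
Context {R : realType} {d : nat}.
Local Notation mu := (@lebesgue_measure R).
Local Notation lam := (@lebesgue_rV R d).
Local Notation I01 := (\1_(`[0%R, 1%R]%classic) : R -> R).
Variables (A B : 'rV[R]_d -> R) (A_ B_ : nat -> 'rV[R]_d -> R) (w : 'rV[R]_d)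
  (kap k : R) (kap_ k_ t_ : nat -> R) (Phi_ : nat -> 'rV[R]_d -> R) (Phi : 'rV[R]_d -> R)
  (M rho C : R).
Hypotheses (mA : measurable_fun setT A) (mB : measurable_fun setT B)
  (mA_ : forall n, measurable_fun setT (A_ n))
  (mPhi_ : forall n, measurable_fun setT (Phi_ n)) (mPhi : measurable_fun setT Phi).
Hypotheses (Aw : forall x u, A (x + u *: w) = A x + u * kap)
  (A_w : forall n x u, A_ n (x + u *: w) = A_ n x + u * kap_ n)
  (kap0 : 0 < kap) (kap_0 : forall n, kap / 2 <= kap_ n).
Hypotheses (t0 : forall n, t_ n != 0) (tcvg : t_ n @[n --> \oo] --> 0)
  (AE : forall n x, A_ n x = A x + t_ n * B_ n x)
  (kapE : forall n, kap_ n = kap + t_ n * k_ n)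
  (Bcvg : forall x, B_ n x @[n --> \oo] --> B x) (kcvg : k_ n @[n --> \oo] --> k).
Hypotheses (PhiM : forall n x, `|Phi_ n x| <= M) (Phi0 : forall n x, rho < `|x| -> Phi_ n x = 0).
Hypotheses (BC : forall n x, `|x| <= rho + `|w| -> `|B_ n x| <= C)
  (AC : forall x, `|x| <= rho + `|w| -> `|A x| <= C) (kC : forall n, `|k_ n| <= C).


(** Along the line [x + u * w] the sign of [A] changes at the time [crossing_time x], and
    [crossing_speed x] is the derivative of this time when [A] is perturbed to
    [A + t * B] and its slope [kap] to [kap + t * k]. *)
Definition crossing_time x := - A x / kap.
Definition crossing_speed x := (A x * k - B x * kap) / kap ^+ 2.

(** The volume form of the surface integral of [Phi] over the hypersurface [A = 0], weighted
    by its normal speed: a point [y] of the hypersurface is spread over the segment of the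
    points [y - u * w] with [0 < u < 1]. *)
Definition halfspace_derivative x : R :=
  if 0 < crossing_time x < 1 then
    crossing_speed x * Phi (x + crossing_time x *: w) else 0.


(** The first two conditions exclude the crossing times [0] and [1], at which the indicator of
    the unit segment jumps. *)
Hypothesis regular : {ae lam, forall x, [/\ A x != 0, A x + kap != 0 &
  Phi_ p.1 p.2 @[p --> filter_prod \oo (nbhs (x + crossing_time x *: w))] -->
    Phi (x + crossing_time x *: w)]}.

Let M0 : 0 <= M.
Proof. exact: le_trans (PhiM 0%N 0). Qed.

Let C0 : 0 <= C.
Proof. exact: le_trans (kC 0%N). Qed.

Let s_ n x := - A_ n x / kap_ n.

Let kap_gt0 n : 0 < kap_ n.
Proof. by apply: lt_le_trans (kap_0 n); rewrite divr_gt0. Qed.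

Let below_A x u : below 0 (A (x + u *: w)) = below (crossing_time x) u.
Proof.
rewrite /below Aw /crossing_time ler_pdivlMr//; congr (_%:R); congr nat_of_bool.
by apply/idP/idP; lra.
Qed.

Let below_A_ n x u : below 0 (A_ n (x + u *: w)) = below (s_ n x) u.
Proof.
rewrite /below A_w /s_ ler_pdivlMr//; congr (_%:R); congr nat_of_bool.
by apply/idP/idP; lra.
Qed.

Let width n x : (t_ n)^-1 * (s_ n x - crossing_time x) =
  (A x * k_ n - B_ n x * kap) / (kap * kap_ n).
Proof.
rewrite /s_ /crossing_time AE {1}kapE; have := kap_gt0 n; rewrite kapE => kn.
by field; rewrite t0 !gt_eqF.
Qed.

Let kap_cvg : kap_ n @[n --> \oo] --> kap.
Proof.
rewrite (_ : kap_ = fun n => kap + t_ n * k_ n); last by apply/funext.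
rewrite -[X in _ --> X]addr0 -[X in _ + X](mul0r k).
by apply: cvgD; [exact: cvg_cst|exact: cvgM].
Qed.

Let width_cvg x : (t_ n)^-1 * (s_ n x - crossing_time x) @[n --> \oo] --> crossing_speed x.
Proof.
under eq_fun do rewrite width.
rewrite /crossing_speed expr2; apply: cvgM.
  by apply: cvgB; apply: cvgM => //; exact: cvg_cst.
apply: cvgV; first by rewrite mulf_neq0// gt_eqF.
by apply: cvgM => //; exact: cvg_cst.
Qed.

Let s_cvg x : s_ n x @[n --> \oo] --> crossing_time x.
Proof.
have h : t_ n * ((t_ n)^-1 * (s_ n x - crossing_time x)) + crossing_time x @[n --> \oo] -->
   0 * crossing_speed x + crossing_time x.
  by apply: cvgD; [apply: cvgM|exact: cvg_cst].
rewrite mul0r add0r in h.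
rewrite (_ : s_ ^~ x = fun n => t_ n * ((t_ n)^-1 * (s_ n x - crossing_time x)) + crossing_time x)//.
by apply/funext => n; rewrite mulrA divff// mul1r subrK.
Qed.

Let D n x := (below 0 (A_ n x) - below 0 (A x)) * Phi_ n x.

Let mbelowA (f : 'rV[R]_d -> R) : measurable_fun setT f ->
  measurable_fun setT (fun x => below 0 (f x)).
Proof. by move=> mf; apply: (measurableT_comp (measurable_below 0)). Qed.

Let mD n : measurable_fun setT (D n).
Proof. by apply: measurable_funM => //; apply: measurable_funB; exact: mbelowA. Qed.

Let DM n x : `|D n x| <= M.
Proof.
rewrite /D normrM -[leRHS]mul1r; apply: ler_pM => //.
rewrite /below; case: (A_ n x <= 0); case: (A x <= 0);
  by rewrite ?subrr ?subr0 ?sub0r ?normrN ?normr0 ?normr1.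
Qed.

Let D0 n x : rho < `|x| -> D n x = 0.
Proof. by move=> /Phi0 h; rewrite /D h mulr0. Qed.

Let K_ n x := (t_ n)^-1 * \int[mu]_u (I01 u * D n (x + u *: w)).

Let mPhi_line n x : measurable_fun setT (fun u : R => Phi_ n (x + u *: w)).
Proof.
exact: (measurableT_comp (measurableT_comp (mPhi_ n) (measurable_line w)) (measurable_pair1 x)).
Qed.

Let K_E n x : K_ n x = (t_ n)^-1 * \int[mu]_u (I01 u *
  ((below (s_ n x) u - below (crossing_time x) u) * Phi_ n (x + u *: w))).
Proof.
congr (_ * _); apply: eq_Rintegral => u _.
by rewrite /D below_A below_A_.
Qed.

Let bnd := M * ((C * C + C * kap) / (kap * (kap / 2))).

Let K_bound n x : `|K_ n x| <= bnd * \1_[set x : 'rV[R]_d | `|x| <= rho + `|w| ] x.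
Proof.
rewrite indicE; have [xr|xr] := leP `|x| (rho + `|w|).
  rewrite mem_set//= mulr1 K_E normrM.
  have [_ h] := slab_bound (s := crossing_time x) (s' := s_ n x) (mPhi_line n x) M0 (fun u _ => PhiM n _).
  apply: (@le_trans _ _ (`|(t_ n)^-1| * (M * `|s_ n x - crossing_time x|))).
    by rewrite ler_wpM2l.
  rewrite mulrCA -normrM width /bnd ler_wpM2l//.
  rewrite normrM; apply: ler_pM => //.
    apply: (le_trans (ler_normB _ _)); apply: lerD; rewrite normrM.
      by apply: ler_pM => //; exact: AC.
    by rewrite [`|kap|]gtr0_norm// ler_pM2r//; exact: BC.
  rewrite gtr0_norm ?invr_gt0 ?mulr_gt0//.
  by rewrite lef_pV2 ?posrE ?mulr_gt0 ?divr_gt0// ler_pM2l.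
rewrite memNset/= ?mulr0; last by apply/negP; rewrite -ltNge.
rewrite normr_le0 /K_ (@eq_Rintegral _ _ _ _ _ (cst 0)) ?Rintegral_cst ?mul0r ?mulr0// => u _.
rewrite indicE mem_setE in_itv/=; have [/andP[u0 u1]|_] := boolP (0 <= u <= 1); last by rewrite mul0r.
rewrite D0 ?mulr0//.
have h : `|u *: w| <= `|w| by rewrite normrZ ger0_norm// ler_piMl.
have := ler_normB (x + u *: w) (u *: w); rewrite addrK; lra.
Qed.

Let mcross : measurable_fun setT crossing_time.
Proof.
by apply: measurable_funM => //; apply: (measurableT_comp _ mA) => //; exact: oppr_measurable.
Qed.

Let mlim : measurable_fun setT halfspace_derivative.
Proof.
apply: measurable_fun_ifT.
- apply: measurable_and; apply: measurable_fun_ltr => //.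
- apply: measurable_funM.
    apply: measurable_funM => //; apply: measurable_funB; exact: measurable_funM.
  apply: (measurableT_comp mPhi).
  apply: measurable_fun_mxP => i j; under eq_fun do rewrite !mxE.
  apply: measurable_funD; first exact: measurable_mx_entry.
  by apply: measurable_funM => //; exact: measurable_cst.
- exact: measurable_cst.
Qed.


(** After averaging along [w] the difference quotient is, for each [x], the integral over a
    slab of the line through [x], to which [slab_cvg] applies. The widths of the
    slabs are at most proportional to [t], which gives the domination. *)
Theorem cvg_halfspace_derivative :
  lam.-integrable setT (EFin \o halfspace_derivative) /\
  (t_ n)^-1 * (\int[lam]_x ((below 0 (A_ n x) - below 0 (A x)) * Phi_ n x))
    @[n --> \oo] --> \int[lam]_x halfspace_derivative x.
Proof.
have mK n : measurable_fun setT (K_ n).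
  by apply: measurable_funM => //; exact: (measurable_Rintegral_average w (mD n) (DM n) (@D0 n)).
have bI : lam.-integrable setT
    (EFin \o (fun x => bnd * \1_[set x : 'rV[R]_d | `|x| <= rho + `|w| ] x)).
  apply: (boxed_integrable (M := bnd) (r := rho + `|w|)).
  - apply: measurable_funM => //; apply: measurable_indic; exact: measurable_mx_box.
  - move=> x; rewrite normrM ger0_norm; last first.
      rewrite mulr_ge0// divr_ge0 ?addr_ge0 ?mulr_ge0 ?divr_ge0//; exact: ltW.
    rewrite ler_piMr//; last by rewrite ger0_norm// indicE lern1 leq_b1.
    rewrite mulr_ge0// divr_ge0 ?addr_ge0 ?mulr_ge0 ?divr_ge0//; exact: ltW.
  - by move=> x xr; rewrite indicE memNset/= ?mulr0//; apply/negP; rewrite -ltNge.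
have avE n : (t_ n)^-1 * (\int[lam]_x ((below 0 (A_ n x) - below 0 (A x)) * Phi_ n x)) =
    \int[lam]_x K_ n x.
  rewrite -/(D n) (Rintegral_average w (mD n) (DM n) (@D0 n)) /K_ RintegralZl//.
  have tb : lam.-integrable setT (EFin \o (fun x => t_ n * K_ n x)).
    apply: (le_integrable measurableT _ _ (integrableZl measurableT `|t_ n| bI)).
      by apply/measurable_EFinP; exact: measurable_funM.
    move=> x _; rewrite /= lee_fin normrM [leRHS]normrM normr_id ler_wpM2l//.
    apply: (le_trans (K_bound n x)); exact: ler_norm.
  apply: eq_integrable tb => // x _ /=; congr (_%:E).
  by rewrite /K_ mulrA divff// mul1r.
under eq_fun do rewrite avE.
apply: (Rintegral_dominated_convergence mK mlim _ bI) => //.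
apply: filterS regular => x [Ax0 Axk cPhi].
rewrite /halfspace_derivative.
under eq_fun do rewrite K_E.
have n0 : crossing_time x != 0.
  by apply: mulf_neq0; rewrite ?oppr_eq0 ?invr_eq0 ?(lt0r_neq0 kap0).
have n1 : crossing_time x != 1.
  rewrite -subr_eq0 -[X in _ - X](divff (lt0r_neq0 kap0)) -mulrBl.
  by apply: mulf_neq0; rewrite ?invr_eq0 ?(lt0r_neq0 kap0)// -opprD oppr_eq0.
have h := slab_cvg (phi_ := fun n u => Phi_ n (x + u *: w)) (M := M)
  (l := Phi (x + crossing_time x *: w)) t0 (@s_cvg x) (@width_cvg x)
  (fun n => mPhi_line n x) (fun n u => PhiM n _) n0 n1.
apply: h => _.
apply: (@cvg_comp _ _ _ (fun p : nat * R => (p.1, x + p.2 *: w))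
  (fun q : nat * 'rV[R]_d => Phi_ q.1 q.2) _ _ _ _ cPhi).
move=> S [[P Q] /= [hP hQ] PQ].
have lin : x + u *: w @[u --> crossing_time x] --> x + crossing_time x *: w.
  by apply: cvgD; [exact: cvg_cst|apply: cvgZr_tmp; exact: cvg_id].
exists (P, [set u | Q (x + u *: w)]) => /=; first by split => //; exact: lin.
by move=> [n u] /= [Pn Qu]; exact: (PQ (n, x + u *: w)).
Qed.

End halfspace_derivative.

(** * Geometry of the quantization loss *)
Lemma cvgr_sum (R : realType) (I T : Type) (F : set_system T) {FF : Filter F} (r : seq I)
    (P : pred I) (f : I -> T -> R) (l : I -> R) :
  (forall i, P i -> f i x @[x --> F] --> l i) ->
  \sum_(i <- r | P i) f i x @[x --> F] --> \sum_(i <- r | P i) l i.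
Proof. by apply: cvg_big; exact: add_continuous. Qed.

Lemma cvgr_prod (R : realType) (I T : Type) (F : set_system T) {FF : Filter F} (r : seq I)
    (P : pred I) (f : I -> T -> R) (l : I -> R) :
  (forall i, P i -> f i x @[x --> F] --> l i) ->
  \prod_(i <- r | P i) f i x @[x --> F] --> \prod_(i <- r | P i) l i.
Proof. by apply: cvg_big; exact: mul_continuous. Qed.

Section quantization_geometry.
Context {R : realType} {d : nat}.
Implicit Types x y z : 'rV[R]_d.

Definition dotv x y : R := \sum_r x 0 r * y 0 r.
Definition sqd x : R := dotv x x.

Lemma dotvDr x y z : dotv x (y + z) = dotv x y + dotv x z.
Proof. by rewrite /dotv -big_split; apply: eq_bigr => r _; rewrite mxE mulrDr. Qed.
Lemma dotvC x y : dotv x y = dotv y x.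
Proof. by apply: eq_bigr => r _; rewrite mulrC. Qed.
Lemma dotvDl x y z : dotv (x + y) z = dotv x z + dotv y z.
Proof. by rewrite dotvC dotvDr ![dotv z _]dotvC. Qed.
Lemma dotvZr a x y : dotv x (a *: y) = a * dotv x y.
Proof. by rewrite /dotv mulr_sumr; apply: eq_bigr => r _; rewrite mxE mulrCA. Qed.
Lemma dotvZl a x y : dotv (a *: x) y = a * dotv x y.
Proof. by rewrite dotvC dotvZr dotvC. Qed.
Lemma dotvNr x y : dotv x (- y) = - dotv x y.
Proof. by rewrite -scaleN1r dotvZr mulN1r. Qed.
Lemma dotvNl x y : dotv (- x) y = - dotv x y.
Proof. by rewrite dotvC dotvNr dotvC. Qed.
Definition dotvE := (dotvDr, dotvDl, dotvZr, dotvZl, dotvNr, dotvNl).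

Lemma dotv_le x y : `|dotv x y| <= d%:R * (`|x| * `|y|).
Proof.
apply: (le_trans (ler_norm_sum _ _ _)).
have -> : d%:R * (`|x| * `|y|) = \sum_(r < d) (`|x| * `|y|).
  by rewrite sumr_const card_ord mulr_natl.
by apply: ler_sum => r _; rewrite normrM ler_pM// mx_norm_entry.
Qed.

Lemma sqd_ge0 x : 0 <= sqd x.
Proof. by apply: sumr_ge0 => r _; rewrite -expr2 sqr_ge0. Qed.

Lemma sqd_eq0 x : sqd x = 0 -> x = 0.
Proof.
move=> /eqP; rewrite psumr_eq0 => [/allP h|r _]; last by rewrite -expr2 sqr_ge0.
apply/rowP => r; rewrite mxE; apply/eqP.
by have := h r (mem_index_enum r); rewrite /= mulf_eq0 orbb.
Qed.

Lemma sqd_gt0 x : x != 0 -> 0 < sqd x.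
Proof.
move=> x0; rewrite lt_neqAle sqd_ge0 andbT eq_sym.
by apply: contra x0 => /eqP/sqd_eq0 ->.
Qed.

Lemma enorm_sqr x : enorm x ^+ 2 = sqd x.
Proof.
rewrite /enorm sqr_sqrtr; last by apply: sumr_ge0 => r _; exact: sqr_ge0.
by apply: eq_bigr => r _; rewrite expr2.
Qed.

Lemma closed_unit_ballE x : closed_unit_ball x <-> sqd x <= 1.
Proof.
rewrite /closed_unit_ball /= -enorm_sqr; have e0 : 0 <= enorm x by exact: sqrtr_ge0.
by rewrite expr_le1.
Qed.

Lemma mx_norm_sqd x : `|x| ^+ 2 <= sqd x.
Proof.
have h : `|x| <= Num.sqrt (sqd x).
  apply: mx_norm_le => [|i j]; first exact: sqrtr_ge0.
  rewrite ord1 -sqrtr_sqr ler_wsqrtr// /sqd /dotv (bigD1 j)//= -expr2 lerDl sumr_ge0// => r _.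
  by rewrite -expr2 sqr_ge0.
by rewrite -[leRHS]sqr_sqrtr ?sqd_ge0// lerXn2r ?nnegrE// sqrtr_ge0.
Qed.

Lemma closed_unit_ball_norm x : closed_unit_ball x -> `|x| <= 1.
Proof.
move=> /closed_unit_ballE h; have := le_trans (mx_norm_sqd x) h.
by rewrite expr_le1.
Qed.

Lemma sqd_continuous : continuous sqd.
Proof.
move=> x; apply: (@cvgr_sum _ _ _ (nbhs x)) => r _; apply: cvgM; exact: coord_continuous.
Qed.

Lemma measurable_closed_unit_ball : measurable (@closed_unit_ball R d).
Proof.
rewrite (_ : closed_unit_ball = sqd @^-1` `]-oo, 1]%classic); last first.
  apply/seteqP; split => x /=; rewrite in_itv/=; by move/closed_unit_ballE.
rewrite -[X in measurable X]setTI; apply: continuous_measurable_mx => //.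
exact: sqd_continuous.
Qed.

Section codebook.
Variable k : nat.
Implicit Types c h : 'M[R]_(k, d).

Definition qdist c (j : 'I_k) x : R := sqd (x - row j c).

Lemma mx_norm_row c j : `|row j c| <= `|c|.
Proof. by apply: mx_norm_le => // i r; rewrite mxE mx_norm_entry. Qed.

Lemma qdistD c h j x :
  qdist (c + h) j x = qdist c j x - 2 * dotv (x - row j c) (row j h) + sqd (row j h).
Proof.
rewrite /qdist linearD opprD addrA /sqd !dotvE [dotv (row j h) x]dotvC.
by rewrite [dotv (row j h) (row j c)]dotvC; ring.
Qed.

Lemma qdist_shift c j x u y :
  qdist c j (x + u *: y) = qdist c j x + 2 * u * dotv y (x - row j c) + u ^+ 2 * sqd y.
Proof.
rewrite /qdist addrAC /sqd !dotvE [dotv x y]dotvC [dotv (row j c) y]dotvC; ring.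
Qed.

Lemma qdist_ge0 c j x : 0 <= qdist c j x.
Proof. exact: sqd_ge0. Qed.

Lemma qdist_continuous c j : continuous (qdist c j).
Proof.
move=> x; apply: (@continuous_comp _ _ _ (fun x => x - row j c) sqd).
  by apply: (@cvgB _ _ _ (nbhs x) _ id (cst (row j c))); [exact: cvg_id|exact: cvg_cst].
exact: sqd_continuous.
Qed.

Lemma measurable_qdist c j : measurable_fun setT (qdist c j).
Proof. exact: (@continuous_measurable_mx _ _ _ (qdist c j) (@qdist_continuous c j)). Qed.

Lemma gammaE c x : gamma c x = inf (range (fun j : 'I_k => qdist c j x)).
Proof.
rewrite /gamma (_ : (fun j => _) = fun j => qdist c j x)//.
by apply/funext => j; exact: enorm_sqr.
Qed.

Lemma gamma_le c j x : gamma c x <= qdist c j x.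
Proof.
rewrite gammaE; apply: ge_inf; last by exists j.
by exists 0 => _ [i _ <-]; exact: qdist_ge0.
Qed.

Hypothesis k0 : (0 < k)%N.
Let j0 : 'I_k := Ordinal k0.

Lemma gamma_attained c x : exists j, gamma c x = qdist c j x.
Proof.
pose j := [arg min_(j < j0) qdist c j x]%O.
exists j; apply/eqP; rewrite eq_le gamma_le /= gammaE; apply: lb_le_inf.
  by exists (qdist c j0 x); exists j0.
move=> _ [i _ <-]; rewrite /j.
by case: arg_minP => // i' _; apply.
Qed.

Lemma le_gamma c x a : (forall j, a <= qdist c j x) -> a <= gamma c x.
Proof. by move=> h; have [j ->] := gamma_attained c x. Qed.

Lemma gamma_ge0 c x : 0 <= gamma c x.
Proof. by apply: le_gamma => j; exact: qdist_ge0. Qed.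

Lemma measurable_gamma c : measurable_fun setT (gamma c).
Proof.
apply: (measurability _ (RGenInftyO.measurableE R)).
move=> /= _ [_ [a ->] <-]; rewrite setTI.
rewrite (_ : _ @^-1` _ = \bigcup_(j in [set: 'I_k]) (qdist c j @^-1` `]-oo, a[%classic)).
  apply: fin_bigcup_measurable => // j _.
  by rewrite -[X in measurable X]setTI; apply: measurable_qdist.
apply/seteqP; split => x /=; rewrite in_itv/=.
  by have [j ->] := gamma_attained c x => h; exists j => //=; rewrite in_itv.
by move=> [j _ /=]; rewrite in_itv/=; exact: le_lt_trans (gamma_le _ _ _).
Qed.

Lemma qdist_lipschitz c c' j x (b : R) : `|x| <= 1 -> `|c| <= b -> `|c'| <= b ->
  `|qdist c j x - qdist c' j x| <= d%:R * (2 + 2 * b) * `|c - c'|.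
Proof.
move=> x1 cb cb'.
have -> : qdist c j x - qdist c' j x =
    dotv (row j (c' - c)) (x - row j c + (x - row j c')).
  by rewrite /qdist /sqd linearB/= !dotvE [dotv (row j c) x]dotvC
    [dotv (row j c') x]dotvC [dotv (row j c') (row j c)]dotvC; ring.
apply: (le_trans (dotv_le _ _)); rewrite -[leRHS]mulrA ler_wpM2l// mulrC.
apply: ler_pM => //; last by rewrite distrC; exact: mx_norm_row.
have h0 (e : 'M[R]_(k, d)) : `|e| <= b -> `|x - row j e| <= 1 + b.
  move=> eb; apply: (le_trans (ler_normB _ _)); apply: lerD => //.
  exact: le_trans (mx_norm_row _ _) eb.
apply: (le_trans (ler_normD _ _)); have := h0 c cb; have := h0 c' cb'; lra.
Qed.

Lemma gamma_lipschitz c c' x (b : R) : `|x| <= 1 -> `|c| <= b -> `|c'| <= b ->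
  `|gamma c x - gamma c' x| <= d%:R * (2 + 2 * b) * `|c - c'|.
Proof.
move=> x1 cb cb'.
have h (e e' : 'M[R]_(k, d)) : `|e| <= b -> `|e'| <= b -> gamma e x - gamma e' x <= d%:R * (2 + 2 * b) * `|e - e'|.
  move=> eb eb'; have [j ->] := gamma_attained e' x.
  apply: (@le_trans _ _ (qdist e j x - qdist e' j x)); first by rewrite lerB// gamma_le.
  apply: (le_trans (ler_norm _)); exact: qdist_lipschitz.
rewrite ler_norml; apply/andP; split; last exact: h.
by rewrite lerNl opprB distrC; exact: h.
Qed.

Lemma gamma_bounded c x (b : R) : `|x| <= 1 -> `|c| <= b -> gamma c x <= d%:R * (1 + b) ^+ 2.
Proof.
move=> x1 cb; apply: (le_trans (gamma_le c j0 x)); apply: (le_trans (ler_norm _)).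
apply: (le_trans (dotv_le _ _)); rewrite ler_wpM2l// -expr2 lerXn2r ?nnegrE//.
  by rewrite addr_ge0// (le_trans _ cb).
apply: (le_trans (ler_normB _ _)); apply: lerD => //.
exact: le_trans (mx_norm_row _ _) cb.
Qed.

End codebook.
End quantization_geometry.

(** * Differentiating integrals over Voronoi cells *)
Lemma ae_affine_neq0 (R : realType) d (B : 'rV[R]_d -> R) (w : 'rV[R]_d) (kap : R) :
  measurable_fun setT B -> kap != 0 -> (forall x u, B (x + u *: w) = B x + u * kap) ->
  {ae @lebesgue_rV R d, forall x, B x != 0}.
Proof.
move=> mB k0 Bw; exists (B @^-1` [set 0]); split.
- by rewrite -[X in measurable X]setTI; exact: mB.
- exact: null_zeros_of_affine Bw.
- by move=> x /= /negP; rewrite negbK => /eqP.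
Qed.

Lemma cvg_below (R : realType) T (F : set_system T) {FF : Filter F} (f : T -> R) (a : R) :
  f x @[x --> F] --> a -> a != 0 -> below 0 (f x) @[x --> F] --> below 0 a.
Proof.
move=> fa a0; apply: cvg_near_cst; have [an|ap] := ltP a 0.
  have : \forall x \near F, f x < 0 by apply: (cvgr_lt _ fa).
  by apply: filterS => x fx; rewrite /below (ltW fx) (ltW an).
have {}ap : 0 < a by rewrite lt_neqAle eq_sym a0.
have : \forall x \near F, 0 < f x by apply: (cvgr_gt _ fa).
by apply: filterS => x fx; rewrite /below !leNgt fx ap.
Qed.

Lemma below_01 (R : realType) (s u : R) : 0 <= below s u <= 1.
Proof. by rewrite /below ler0n lern1 leq_b1. Qed.

Lemma prod_01 (R : realType) (I : Type) (r : seq I) (P : pred I) (f : I -> R) :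
  (forall i, 0 <= f i <= 1) -> 0 <= \prod_(i <- r | P i) f i <= 1.
Proof.
move=> f01; elim/big_ind: _ => [|x y /andP[x0 x1] /andP[y0 y1]|//].
  by rewrite ler01 lexx.
by rewrite mulr_ge0//= mulr_ile1.
Qed.

Section cell_derivative.
Context {R : realType} {d k : nat}.
Local Notation lam := (@lebesgue_rV R d).
Implicit Types (c v u : 'M[R]_(k, d)) (x : 'rV[R]_d).

Definition side c (l i : 'I_k) x : R := below 0 (qdist c l x - qdist c i x).
Definition cell c (l : 'I_k) x : R := \prod_i side c l i x.

Lemma measurable_gap c l i : measurable_fun setT (fun x => qdist c l x - qdist c i x).
Proof. by apply: measurable_funB; exact: measurable_qdist. Qed.

Lemma measurable_side c l i : measurable_fun setT (side c l i).
Proof. exact: (measurableT_comp (measurable_below 0) (measurable_gap c l i)). Qed.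

Lemma measurable_cell c l : measurable_fun setT (cell c l).
Proof. by apply: measurable_prod => i _; exact: measurable_side. Qed.

Lemma side_diag c l x : side c l l x = 1.
Proof. by rewrite /side subrr /below lexx. Qed.

Lemma cvg_mx_entry T (F : set_system T) {FF : Filter F} (c_ : T -> 'M[R]_(k, d)) c i r :
  c_ n @[n --> F] --> c -> c_ n i r @[n --> F] --> c i r.
Proof.
move=> h; apply: (@cvg_comp _ _ _ c_ (fun M : 'M[R]_(k, d) => M i r) _ _ _ h).
exact: coord_continuous.
Qed.

Lemma cvg_qdist T (F : set_system T) {FF : Filter F} (c_ : T -> 'M[R]_(k, d)) c
    (x_ : T -> 'rV[R]_d) x j :
  c_ n @[n --> F] --> c -> x_ n @[n --> F] --> x ->
  qdist (c_ n) j (x_ n) @[n --> F] --> qdist c j x.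
Proof.
move=> cc xx; rewrite /qdist /sqd /dotv; apply: cvgr_sum => r _.
suff h : (x_ n - row j (c_ n)) 0 r @[n --> F] --> (x - row j c) 0 r by exact: cvgM.
rewrite !mxE; under eq_fun do rewrite !mxE.
apply: cvgB; last exact: cvg_mx_entry.
apply: (@cvg_comp _ _ _ x_ (fun M : 'rV[R]_d => M 0 r) _ _ _ xx).
exact: coord_continuous.
Qed.

Lemma cvg_dotv_row (v_ : nat -> 'M[R]_(k, d)) v y l :
  v_ n @[n --> \oo] --> v -> dotv y (row l (v_ n)) @[n --> \oo] --> dotv y (row l v).
Proof.
move=> vv; rewrite /dotv; apply: cvgr_sum => r _; apply: cvgM; first exact: cvg_cst.
by rewrite mxE; under eq_fun do rewrite mxE; exact: cvg_mx_entry.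
Qed.

Lemma cvg_sqd_row (v_ : nat -> 'M[R]_(k, d)) v l :
  v_ n @[n --> \oo] --> v -> sqd (row l (v_ n)) @[n --> \oo] --> sqd (row l v).
Proof.
move=> vv; rewrite /sqd /dotv; apply: cvgr_sum => r _.
by rewrite mxE; under eq_fun do rewrite mxE; apply: cvgM; exact: cvg_mx_entry.
Qed.

Section fixed_codebook.
Variables (c : 'M[R]_(k, d)) (F : 'rV[R]_d -> R) (M : R).
Hypothesis distinct : forall i j, i != j -> row i c != row j c.
Hypotheses (cF : continuous F) (F0 : forall x, 1 < `|x| -> F x = 0)
  (FM : forall x, `|F x| <= M).

Let mF : measurable_fun setT F.
Proof. exact: continuous_measurable_mx. Qed.

Variable l : 'I_k.


(** The face between the centers [l] and [i] is the zero set of the gap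
    [qdist c l - qdist c i], an affine function of slope [gap_slope i] along the
    direction [gap_dir i] that joins the centers. The suffix [_var] marks a
    first variation when the centers move with velocity [v]. *)
Definition gap_dir (i : 'I_k) := row i c - row l c.
Definition gap_slope i := 2 * sqd (gap_dir i).
Definition gap_slope_var i v := 2 * dotv (gap_dir i) (row i v - row l v).
Definition gap_var i v x :=
  2 * dotv (x - row i c) (row i v) - 2 * dotv (x - row l c) (row l v).
(** What is integrated over the face: [F], cut by the other sides of the cell. *)
Definition others i x := F x * \prod_(j | j != i) side c l j x.
Definition cell_side_derivative i v x :=
  halfspace_derivative (fun x => qdist c l x - qdist c i x) (gap_var i v) (gap_dir i)
    (gap_slope i) (gap_slope_var i v) (others i) x.

Lemma gap_shift e i x (u : R) y : qdist e l (x + u *: y) - qdist e i (x + u *: y) =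
  (qdist e l x - qdist e i x) + u * (2 * dotv y (row i e - row l e)).
Proof. by rewrite !qdist_shift !dotvE; ring. Qed.

(** The point [y] is the projection of [x] onto the bisector of the centers [l] and
    [i]. Being also on the bisector of [l] and [j] is an affine condition [B x = 0] on
    [x], where [th] removes from the direction of [j] its component along the direction
    of [i]. If nothing remains, the three centers are aligned and [B] is a nonzero constant;
    otherwise [B] varies along the remainder [z]. *)
Lemma bisectors_transversal i j : i != l -> j != l -> j != i ->
  {ae lam, forall x, let y := x + crossing_time (fun x => qdist c l x - qdist c i x) (gap_slope i) x *: gap_dir i in
    qdist c l y - qdist c j y != 0}.
Proof.
move=> il jl ji.
have w0 : gap_dir i != 0 by rewrite subr_eq0 distinct.
have sw0 : 0 < sqd (gap_dir i) by exact: sqd_gt0.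
pose th := dotv (gap_dir i) (gap_dir j) / sqd (gap_dir i).
pose B x := (qdist c l x - qdist c j x) - th * (qdist c l x - qdist c i x).
have yE x : let y := x + crossing_time (fun x => qdist c l x - qdist c i x) (gap_slope i) x *: gap_dir i in
    qdist c l y - qdist c j y = B x.
  rewrite /= gap_shift /B /th /crossing_time /gap_slope -/(gap_dir j); field.
  exact: lt0r_neq0.
suff : {ae lam, forall x, B x != 0} by apply: filterS => x /= h; rewrite yE.
have mB : measurable_fun setT B.
  apply: measurable_funB; first exact: measurable_gap.
  by apply: measurable_funM => //; exact: measurable_gap.
pose z := gap_dir j - th *: gap_dir i.
have [z0|z0] := eqVneq z 0.
  have jE : gap_dir j = th *: gap_dir i by apply/eqP; rewrite -subr_eq0 -/z z0.
  have cj : row j c = row l c + th *: gap_dir i by rewrite -jE addrC subrK.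
  have ci : row i c = row l c + gap_dir i by rewrite addrC subrK.
  apply: aeW => x.
  have -> : B x = th * (1 - th) * sqd (gap_dir i).
    have H (y w : 'rV[R]_d) : sqd y - sqd (y - th *: w) - th * (sqd y - sqd (y - w)) =
        th * (1 - th) * sqd w.
      by rewrite /sqd !dotvE [dotv w y]dotvC; ring.
    have Ej : x - row j c = x - row l c - th *: gap_dir i by rewrite cj opprD addrA.
    have Ei : x - row i c = x - row l c - gap_dir i by rewrite [in LHS]ci opprD addrA.
    by rewrite /B /qdist Ej Ei; exact: H.
  apply: mulf_neq0; last exact: lt0r_neq0.
  apply: mulf_neq0.
    by apply: contraNneq (distinct jl) => th0; rewrite cj th0 scale0r addr0.
  rewrite subr_eq0; apply: contraNneq (distinct ji) => th1.
  by rewrite cj -th1 scale1r -ci.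
have sz0 : 2 * sqd z != 0 by rewrite mulf_neq0 ?(lt0r_neq0 (sqd_gt0 z0)).
have zz : sqd z = dotv z (gap_dir j) - th * dotv z (gap_dir i).
  by rewrite /sqd -dotvZr -dotvNr -dotvDr.
have Bz x (u : R) : B (x + u *: z) = B x + u * (2 * sqd z).
  rewrite /B !gap_shift -/(gap_dir j) -/(gap_dir i) zz; ring.
exact: ae_affine_neq0 Bz.
Qed.


(** The sides before [i] belong to the moved codebook [c'], those after [i] still to [c]: these
    are the factors left over when the product of the sides is moved one factor at a time. *)
Definition perturbed_others (c' : 'M[R]_(k, d)) (i : 'I_k) x :=
  F x * \prod_(j | j != i) (if (j < i)%N then side c' l j x else side c l j x).

Let mgap_var i v : measurable_fun setT (gap_var i v).
Proof.
have h e y : measurable_fun setT (fun x : 'rV[R]_d => dotv (x - e) y).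
  apply: measurable_sum => r; apply: measurable_funM => //.
  apply: (measurableT_comp (measurable_mx_entry 0 r)); exact: measurable_shift_rV.
by apply: measurable_funB; apply: measurable_funM => //; exact: h.
Qed.

Let mpert c' i : measurable_fun setT (perturbed_others c' i).
Proof.
apply: measurable_funM => //; under eq_fun do rewrite big_mkcond/=.
apply: measurable_prod => j _; case: (j != i) => //; case: (j < i)%N; exact: measurable_side.
Qed.

Let mothers i : measurable_fun setT (others i).
Proof.
apply: measurable_funM => //; under eq_fun do rewrite big_mkcond/=.
by apply: measurable_prod => j _; case: (j != i) => //; exact: measurable_side.
Qed.

Let pertM c' i x : `|perturbed_others c' i x| <= M.
Proof.
rewrite /perturbed_others normrM -[leRHS]mulr1; apply: ler_pM => //.
have /andP[h0 h1] : 0 <= \prod_(j | j != i)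
    (if (j < i)%N then side c' l j x else side c l j x) <= 1.
  by apply: prod_01 => j; case: ifP => _; exact: below_01.
by rewrite ger0_norm.
Qed.

Section one_side.
Variables (i : 'I_k) (t_ : nat -> R) (v_ : nat -> 'M[R]_(k, d)) (v : 'M[R]_(k, d)).
Hypotheses (il : i != l) (t0 : forall n, t_ n != 0) (tc : t_ n @[n --> \oo] --> 0)
  (vc : v_ n @[n --> \oo] --> v).
Let c_ n := c + t_ n *: v_ n.

Let cvg_c : c_ n @[n --> \oo] --> c.
Proof.
rewrite -[X in _ --> X]addr0 -(scale0r v).
by apply: cvgD; [exact: cvg_cst|exact: cvgZ].
Qed.

Let slope_cvg : gap_slope_var i (v_ n) @[n --> \oo] --> gap_slope_var i v.
Proof.
rewrite /gap_slope_var dotvDr dotvNr; under eq_fun do rewrite dotvDr dotvNr.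
by apply: cvgM; [exact: cvg_cst|apply: cvgB; exact: cvg_dotv_row].
Qed.

Let slope_ n := gap_slope i + t_ n * gap_slope_var i (v_ n).

Let slope_E n : slope_ n = 2 * dotv (gap_dir i) (row i (c_ n) - row l (c_ n)).
Proof.
have -> : row i (c_ n) - row l (c_ n) = gap_dir i + t_ n *: (row i (v_ n) - row l (v_ n)).
  by apply/rowP => r; rewrite !mxE; ring.
rewrite dotvDr dotvZr /slope_ /gap_slope /gap_slope_var /sqd; ring.
Qed.

Let B_ n x := gap_var i (v_ n) x + t_ n * (sqd (row l (v_ n)) - sqd (row i (v_ n))).

Let B_E n x : qdist (c_ n) l x - qdist (c_ n) i x =
  qdist c l x - qdist c i x + t_ n * B_ n x.
Proof.
have rZ j : row j (t_ n *: v_ n) = t_ n *: row j (v_ n).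
  by apply/rowP => r; rewrite !mxE.
rewrite /c_ !qdistD !rZ /sqd !(dotvZr, dotvZl) /B_ /gap_var /sqd; ring.
Qed.

Let B_cvg x : B_ n x @[n --> \oo] --> gap_var i v x.
Proof.
rewrite -[X in _ --> X]addr0 -[X in _ + X](mul0r (sqd (row l v) - sqd (row i v))).
apply: cvgD.
  by apply: cvgB; (apply: cvgM; [exact: cvg_cst|exact: cvg_dotv_row]).
by apply: cvgM => //; apply: cvgB; exact: cvg_sqd_row.
Qed.


(** For almost every [x] the crossing point is on no other bisector, so the other sides are
    locally constant there. *)
Let regular : {ae lam, forall x, let s := crossing_time (fun x => qdist c l x - qdist c i x) (gap_slope i) x in
  [/\ qdist c l x - qdist c i x != 0, qdist c l x - qdist c i x + gap_slope i != 0 &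
  perturbed_others (c_ p.1) i p.2 @[p --> filter_prod \oo (nbhs (x + s *: gap_dir i))] -->
    others i (x + s *: gap_dir i)]}.
Proof.
have sw0 : gap_slope i != 0.
  by rewrite lt0r_neq0// mulr_gt0// sqd_gt0// subr_eq0 distinct.
have H1 : {ae lam, forall x, qdist c l x - qdist c i x != 0}.
  by apply: (ae_affine_neq0 (measurable_gap c l i) sw0) => x u; rewrite gap_shift.
have H2 : {ae lam, forall x, qdist c l x - qdist c i x + gap_slope i != 0}.
  apply: (ae_affine_neq0 (w := gap_dir i) _ sw0).
    by apply: measurable_funD => //; exact: measurable_gap.
  by move=> x u; rewrite gap_shift -/(gap_dir i) addrAC.
have H3 : {ae lam, forall x, forall j, j != i -> j != l ->
    let y := x + crossing_time (fun x => qdist c l x - qdist c i x) (gap_slope i) x *: gap_dir i in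
    qdist c l y - qdist c j y != 0}.
  apply: filter_forall => j.
  have [ji|ji] := eqVneq j i; first exact: aeW.
  have [jl|jl] := eqVneq j l; first exact: aeW.
  by apply: filterS (bisectors_transversal il jl ji) => x h _ _.
apply: filterS3 H1 H2 H3 => x A0 A1 A2 /=; split => //.
set y := x + _ *: _ in A2 *.
have c2 : c_ p.1 @[p --> filter_prod \oo (nbhs y)] --> c.
  exact: (@cvg_comp _ _ _ fst c_ _ _ _ cvg_fst cvg_c).
have y2 : p.2 @[p --> filter_prod \oo (nbhs y)] --> y by exact: cvg_snd.
rewrite /perturbed_others /others; apply: cvgM.
  by apply: continuous_cvg; [exact: cF|exact: y2].
apply: cvgr_prod => j ji.
have [->|jl] := eqVneq j l.
  case: (l < i)%N; rewrite side_diag; under eq_fun do rewrite side_diag; exact: cvg_cst.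
have hb (e_ : nat * 'rV[R]_d -> 'M[R]_(k, d)) :
    e_ p @[p --> filter_prod \oo (nbhs y)] --> c ->
    side (e_ p) l j p.2 @[p --> filter_prod \oo (nbhs y)] --> side c l j y.
  move=> ec; apply: (@cvg_below _ _ _ _ (fun p => qdist (e_ p) l p.2 - qdist (e_ p) j p.2)).
    by apply: cvgB; apply: cvg_qdist.
  exact: A2.
case: (j < i)%N; first exact: (hb (fun p => c_ p.1)).
by apply: (hb (fun=> c)); exact: cvg_cst.
Qed.

Hypotheses (V : R) (vV : forall n, `|v_ n| <= V) (t1 : forall n, `|t_ n| <= 1)
  (slope2 : forall n, gap_slope i / 2 <= slope_ n).

Lemma cvg_side_bounded :
  lam.-integrable setT (EFin \o cell_side_derivative i v) /\
  (t_ n)^-1 * (\int[lam]_x ((side (c_ n) l i x - side c l i x) * perturbed_others (c_ n) i x))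
    @[n --> \oo] --> \int[lam]_x cell_side_derivative i v x.
Proof.
have V0 : 0 <= V by apply: le_trans (vV 0%N).
have sw0 : 0 < gap_slope i by rewrite mulr_gt0// sqd_gt0// subr_eq0 distinct.
pose rho := 1 + `|gap_dir i| + `|c|.
have rho0 : 0 <= rho by rewrite !addr_ge0.
pose C1 := 4 * (d%:R * (rho * V)) + 2 * (d%:R * (V * V)).
pose C2 := 2 * (d%:R * (rho * rho)).
pose C3 := 2 * (d%:R * (`|gap_dir i| * (V + V))).
have C10 : 0 <= C1 by rewrite addr_ge0 ?mulr_ge0.
have C20 : 0 <= C2 by rewrite !mulr_ge0.
have C30 : 0 <= C3 by rewrite !mulr_ge0 ?addr_ge0.
have xr x j : `|x| <= 1 + `|gap_dir i| -> `|x - row j c| <= rho.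
  move=> h; apply: (le_trans (ler_normB _ _)); apply: lerD => //; exact: mx_norm_row.
have vr n j : `|row j (v_ n)| <= V by apply: le_trans (vV n); exact: mx_norm_row.
have dxv x j n : `|x| <= 1 + `|gap_dir i| -> `|dotv (x - row j c) (row j (v_ n))| <= d%:R * (rho * V).
  move=> h; apply: (le_trans (dotv_le _ _)); rewrite ler_wpM2l//; apply: ler_pM => //; exact: xr.
have sv n j : `|sqd (row j (v_ n))| <= d%:R * (V * V).
  by apply: (le_trans (dotv_le _ _)); rewrite ler_wpM2l//; apply: ler_pM.
have qx x j : `|x| <= 1 + `|gap_dir i| -> `|qdist c j x| <= d%:R * (rho * rho).
  by move=> h; apply: (le_trans (dotv_le _ _)); rewrite ler_wpM2l//; apply: ler_pM => //; exact: xr.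
apply: (@cvg_halfspace_derivative R d (fun x => qdist c l x - qdist c i x) (gap_var i v)
  (fun n x => qdist (c_ n) l x - qdist (c_ n) i x) B_ (gap_dir i) (gap_slope i)
  (gap_slope_var i v) slope_ (fun n => gap_slope_var i (v_ n)) t_
  (fun n => perturbed_others (c_ n) i) (others i) M 1 (C1 + C2 + C3)) => //.
- exact: measurable_gap.
- by move=> n; exact: measurable_gap.
- by move=> x u; rewrite gap_shift.
- by move=> n x u; rewrite gap_shift slope_E.
- by move=> n x /F0 h; rewrite /perturbed_others h mul0r.
- move=> n x h; apply: (@le_trans _ _ C1); last by lra.
  rewrite /B_ /gap_var; apply: (le_trans (ler_normD _ _)); apply: lerD.
    apply: (le_trans (ler_normB _ _)); rewrite !normrM [`|2|]ger0_norm//.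
    by have := dxv x i n h; have := dxv x l n h; lra.
  rewrite normrM -[leRHS]mul1r; apply: ler_pM => //.
  apply: (le_trans (ler_normB _ _)); have := sv n l; have := sv n i; lra.
- move=> x h; apply: (@le_trans _ _ C2); last by lra.
  apply: (le_trans (ler_normB _ _)); have := qx x l h; have := qx x i h; rewrite /C2; lra.
- move=> n; apply: (@le_trans _ _ C3); last by lra.
  rewrite /gap_slope_var normrM ger0_norm// ler_wpM2l//.
  apply: (le_trans (dotv_le _ _)); rewrite ler_wpM2l// ler_wpM2l//.
  by apply: (le_trans (ler_normB _ _)); apply: lerD.
Qed.

End one_side.


(** Convergence only concerns large [n], so the bounds on [t_], [v_] and the slopes may
    be assumed. *)
Lemma cvg_side (i : 'I_k) (t_ : nat -> R) (v_ : nat -> 'M[R]_(k, d)) (v : 'M[R]_(k, d)) :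
  i != l -> (forall n, t_ n != 0) -> t_ n @[n --> \oo] --> 0 -> v_ n @[n --> \oo] --> v ->
  lam.-integrable setT (EFin \o cell_side_derivative i v) /\
  (t_ n)^-1 * (\int[lam]_x ((side (c + t_ n *: v_ n) l i x - side c l i x) *
      perturbed_others (c + t_ n *: v_ n) i x))
    @[n --> \oo] --> \int[lam]_x cell_side_derivative i v x.
Proof.
move=> il t0 tc vc.
have sw0 : 0 < gap_slope i by rewrite mulr_gt0// sqd_gt0// subr_eq0 distinct.
have slope_cvg : gap_slope i + t_ n * gap_slope_var i (v_ n) @[n --> \oo] --> gap_slope i.
  rewrite -[X in _ --> X]addr0 -[X in _ + X](mul0r (gap_slope_var i v)).
  apply: cvgD; first exact: cvg_cst.
  apply: cvgM => //.
  rewrite /gap_slope_var dotvDr dotvNr; under eq_fun do rewrite dotvDr dotvNr.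
  by apply: cvgM; [exact: cvg_cst|apply: cvgB; exact: cvg_dotv_row].
have [N _ HN] : \forall n \near \oo, [/\ `|v_ n| <= `|v| + 1, `|t_ n| <= 1 &
    gap_slope i / 2 <= gap_slope i + t_ n * gap_slope_var i (v_ n)].
  near=> n; split.
  - have : `|v - v_ n| <= 1 by near: n; move/cvgrPdist_le : vc; apply.
    move=> h; have := ler_normD (v_ n - v) v; rewrite subrK distrC; lra.
  - have : `|0 - t_ n| <= 1 by near: n; move/cvgrPdist_le : tc; apply.
    by rewrite sub0r normrN.
  - by near: n; apply: (cvgr_ge _ slope_cvg); lra.
have sh n : (N <= n + N)%N by rewrite leq_addl.
have tc' : t_ (n + N)%N @[n --> \oo] --> 0 by rewrite (cvg_shiftn N t_).
have vc' : v_ (n + N)%N @[n --> \oo] --> v by rewrite (cvg_shiftn N v_).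
have b1 n : `|v_ (n + N)%N| <= `|v| + 1 by case: (HN _ (sh n)).
have b2 n : `|t_ (n + N)%N| <= 1 by case: (HN _ (sh n)).
have b3 n : gap_slope i / 2 <= gap_slope i + t_ (n + N)%N * gap_slope_var i (v_ (n + N)%N).
  by case: (HN _ (sh n)).
have [] := cvg_side_bounded il (fun n => t0 (n + N)%N) tc' vc' b1 b2 b3.
move=> h1 h2; split; first exact: h1.
set e : nat -> R := fun n => _.
by rewrite -(cvg_shiftn N e); exact: h2.
Unshelve. all: end_near.
Qed.

Lemma cell_side_derivative_linear i a (u v : 'M[R]_(k, d)) x :
  cell_side_derivative i (a *: u + v) x =
  a * cell_side_derivative i u x + cell_side_derivative i v x.
Proof.
rewrite /cell_side_derivative /halfspace_derivative; case: ifP => _; last by ring.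
have rE j : row j (a *: u + v) = a *: row j u + row j v.
  by apply/rowP => r; rewrite !mxE.
rewrite /crossing_speed /gap_var /gap_slope_var !rE !(dotvDr, dotvNr, dotvZr); ring.
Qed.

Definition cell_derivative v : R :=
  \sum_(i | i != l) \int[lam]_x cell_side_derivative i v x.

Lemma cell_side_derivative_integrable i v : i != l ->
  lam.-integrable setT (EFin \o cell_side_derivative i v).
Proof.
move=> il; have [] := @cvg_side i (fun n => n.+1%:R^-1) (fun=> v) v il => //.
- exact: cvg_harmonic.
- exact: cvg_cst.
Qed.

Lemma cell_derivative_linear a u v :
  cell_derivative (a *: u + v) = a * cell_derivative u + cell_derivative v.
Proof.
rewrite /cell_derivative mulr_sumr -big_split; apply: eq_bigr => i il /=.
under eq_Rintegral do rewrite cell_side_derivative_linear.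
have Iu := cell_side_derivative_integrable u il.
have Iv := cell_side_derivative_integrable v il.
rewrite RintegralD//; last exact: (integrableZl measurableT a Iu).
by rewrite RintegralZl.
Qed.

Definition cell_integral c' : R := \int[lam]_x (cell c' l x * F x).


(** The indicator of a cell is a product over its sides; moving them one at a time writes the
    difference as a telescoping sum with one half-space integral per face. Letting
    the velocities [v_] vary gives a derivative in the strong sense, along sequences of
    codebooks. *)
Theorem cvg_cell_derivative (t_ : nat -> R) (v_ : nat -> 'M[R]_(k, d)) (v : 'M[R]_(k, d)) :
  (forall n, t_ n != 0) -> t_ n @[n --> \oo] --> 0 -> v_ n @[n --> \oo] --> v ->
  (t_ n)^-1 * (cell_integral (c + t_ n *: v_ n) - cell_integral c) @[n --> \oo] -->
    cell_derivative v.
Proof.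
move=> t0 tc vc.
pose Hyb c' (m : nat) x := F x * \prod_(j < k) (if (j < m)%N then side c' l j x else side c l j x).
have HybI c' m : lam.-integrable setT (EFin \o Hyb c' m).
  apply: (boxed_integrable (M := M) (r := 1)).
  - apply: measurable_funM => //; apply: measurable_prod => j _.
    by case: (j < m)%N; exact: measurable_side.
  - move=> x; rewrite /Hyb normrM -[leRHS]mulr1; apply: ler_pM => //.
    have /andP[h0 h1] : 0 <= \prod_(j < k) (if (j < m)%N then side c' l j x else side c l j x) <= 1.
      by apply: prod_01 => j; case: ifP => _; exact: below_01.
    by rewrite ger0_norm.
  - by move=> x /F0 h; rewrite /Hyb h mul0r.
have tel c' : cell_integral c' - cell_integral c =
    \sum_(i < k) \int[lam]_x ((side c' l i x - side c l i x) * perturbed_others c' i x).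
  transitivity (\sum_(i < k) (\int[lam]_x Hyb c' i.+1 x - \int[lam]_x Hyb c' i x)).
    rewrite -(big_mkord predT (fun i => \int[lam]_x Hyb c' i.+1 x - \int[lam]_x Hyb c' i x)).
    rewrite telescope_sumr//; congr (_ - _); apply: eq_Rintegral => x _; rewrite mulrC /Hyb /cell.
      by congr (_ * _); apply: eq_bigr => j _; rewrite ltn_ord.
    by congr (_ * _); apply: eq_bigr => j _.
  apply: eq_bigr => i _; rewrite -RintegralB//; apply: eq_Rintegral => x _.
  rewrite /Hyb /perturbed_others (bigD1 i)//= [in X in _ - X](bigD1 i)//= ltnSn ltnn.
  rewrite (eq_bigr (fun j : 'I_k => if (j < i)%N then side c' l j x else side c l j x)).
    by ring.
  move=> j ji; rewrite ltnS leq_eqVlt (_ : (j == i :> nat) = false)//; exact/negbTE.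
under eq_fun do rewrite tel mulr_sumr.
rewrite /cell_derivative (big_mkcond (fun i => i != l)); apply: cvgr_sum => i _.
case: ifPn => [il|/negPn/eqP ->]; last first.
  rewrite (_ : (fun n => _) = cst 0); first exact: cvg_cst.
  apply/funext => n; rewrite (@eq_Rintegral _ _ _ _ _ (cst 0)).
    by rewrite Rintegral_cst// mul0r mulr0.
  by move=> x _; rewrite !side_diag subrr mul0r.
by have [_] := cvg_side il t0 tc vc.
Qed.

End fixed_codebook.
End cell_derivative.

(** * Means under a continuous density carried by the unit ball *)
Section density.
Context {R : realType} {d : nat}.
Local Notation lam := (@lebesgue_rV R d).
Variables (P : probability 'rV[R]_d R) (f : 'rV[R]_d -> R).
Hypotheses (hpeak : P closed_unit_ball = 1%E) (cf : continuous f) (densf : is_density P f).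

Let f0 x : 0 <= f x. Proof. by case: densf. Qed.

Lemma measurable_density : measurable_fun setT f.
Proof. exact: continuous_measurable_mx. Qed.
Let mf := measurable_density.


(** A positive value outside the closed ball would, by continuity, give positive mass to a
    small cube that misses the ball. *)
Lemma density_eq0 x : ~ closed_unit_ball x -> f x = 0.
Proof.
move=> xB; apply/eqP; rewrite eq_le f0 andbT leNgt; apply/negP => fx.
have sx : 1 < sqd x by rewrite ltNge; apply/negP => /closed_unit_ballE.
have [e /= e0 eP] : exists2 e : R, 0 < e & forall y, `|y - x| <= e -> 1 < sqd y /\ f x / 2 < f y.
  have H : \forall y \near x, 1 < sqd y /\ f x / 2 < f y.
    have H1 : \forall y \near x, 1 < sqd y by apply: (cvgr_gt _ (@sqd_continuous R d x)).
    have fx2 : f x / 2 < f x by lra.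
    have cfx : f y @[y --> x] --> f x by exact: cf.
    have H2 : \forall y \near x, f x / 2 < f y by apply: (cvgr_gt _ cfx).
    by apply: filterS2 H1 H2.
  have /nbhs_ballP[e /= e0 he] := H.
  exists (e / 2); first by rewrite divr_gt0.
  move=> y yx; apply: he; rewrite -ball_normE /= distrC.
  by apply: (le_lt_trans yx); rewrite ltr_pdivrMr// mulr_natr mulr2n ltrDl.
pose S := [set y : 'rV[R]_d | `|y - x| <= e].
have mS : measurable S by exact: measurable_rV_ball.
have PS : P S = 0%E.
  apply/eqP; rewrite -measure_le0.
  have <- : P (~` closed_unit_ball) = 0%E.
    by rewrite probability_setC ?hpeak ?subee//; exact: measurable_closed_unit_ball.
  apply: le_measure; rewrite ?inE//.
    by apply: measurableC; exact: measurable_closed_unit_ball.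
  move=> y Sy /closed_unit_ballE; have [h _] := eP y Sy.
  by rewrite leNgt h.
have lS : (0 < lam S)%E by rewrite lebesgue_rV_ball lebesgue_rV_box_gt0.
have := densf.2 S mS; rewrite PS => /esym h.
have : ((f x / 2)%:E * lam S <= \int[lam]_(y in S) (f y)%:E)%E.
  rewrite -integral_cst//; apply: ge0_le_integral => //.
  - by move=> y _; rewrite lee_fin divr_ge0.
  - by apply/measurable_EFinP; exact: measurable_funTS.
  - by move=> y Sy; rewrite lee_fin ltW//; have [] := eP y Sy.
rewrite h leNgt => /negP; apply; apply: mule_gt0 => //.
by rewrite lte_fin divr_gt0.
Qed.

Lemma density_eq0_norm x : 1 < `|x| -> f x = 0.
Proof.
move=> x1; apply: density_eq0 => /closed_unit_ball_norm; by rewrite leNgt x1.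
Qed.

Lemma compact_mx_box (r : R) : compact [set x : 'rV[R]_d | `|x| <= r].
Proof.
apply: bounded_closed_compact.
  by exists r; split; [exact: num_real|move=> s rs x /= xr; exact: (le_trans xr (ltW rs))].
apply: (@closed_comp _ _ (fun x : 'rV[R]_d => `|x|) [set y | y <= r]).
  by move=> x _; exact: norm_continuous.
exact: closed_le.
Qed.

Let box_neq0 : [set x : 'rV[R]_d | `|x| <= 1] !=set0.
Proof. by exists 0; rewrite /= normr0. Qed.

Lemma density_bounded : exists Mf, forall x, `|f x| <= Mf.
Proof.
have [c _ hc] := EVT_max_rV box_neq0 (@compact_mx_box 1) (continuous_subspaceT cf).
exists (f c) => x; rewrite ger0_norm//.
have [x1|x1] := leP `|x| 1; first by apply: hc; rewrite inE.
by rewrite density_eq0_norm.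
Qed.

Definition mean (phi : 'rV[R]_d -> R) : R := \int[lam]_x (phi x * f x).

(** Boundedness is required near the support only, so that polynomials qualify. *)
Definition tame (phi : 'rV[R]_d -> R) := measurable_fun setT phi /\
  exists B, forall x, `|x| <= 1 -> `|phi x| <= B.

Lemma tame_boxed phi : tame phi -> exists M, [/\ measurable_fun setT (fun x => phi x * f x),
  forall x, `|phi x * f x| <= M & forall x, 1 < `|x| -> phi x * f x = 0].
Proof.
move=> [mphi [B hB]]; have [Mf hM] := density_bounded.
have M0 : 0 <= Mf by apply: le_trans (hM 0).
have B0 : 0 <= B by apply: le_trans (hB 0 _); rewrite ?normr0.
exists (B * Mf); split; first exact: measurable_funM.
  move=> x; have [x1|x1] := leP `|x| 1; first by rewrite normrM; apply: ler_pM => //; exact: hB.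
  by rewrite density_eq0_norm// mulr0 normr0 mulr_ge0.
by move=> x x1; rewrite density_eq0_norm// mulr0.
Qed.

Lemma tame_integrable phi : tame phi -> lam.-integrable setT (EFin \o (fun x => phi x * f x)).
Proof. by move=> /tame_boxed[M [h1 h2 h3]]; exact: (boxed_integrable h1 h2 h3). Qed.

Lemma continuous_tame phi : continuous phi -> tame phi.
Proof.
move=> cphi; split; first exact: continuous_measurable_mx.
have cn : continuous (fun x => `|phi x|).
  by move=> x; apply: continuous_comp; [exact: cphi|exact: norm_continuous].
have [c _ hc] := EVT_max_rV box_neq0 (@compact_mx_box 1) (continuous_subspaceT cn).
by exists `|phi c| => x x1; apply: hc; rewrite inE.
Qed.

Lemma tame_cst a : tame (fun=> a).
Proof. by split; [exact: measurable_cst|exists `|a|]. Qed.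

Lemma tameD phi psi : tame phi -> tame psi -> tame (fun x => phi x + psi x).
Proof.
move=> [m1 [B1 h1]] [m2 [B2 h2]]; split; first exact: measurable_funD.
exists (B1 + B2) => x x1; apply: (le_trans (ler_normD _ _)); apply: lerD; [exact: h1|exact: h2].
Qed.

Lemma tameM phi psi : tame phi -> tame psi -> tame (fun x => phi x * psi x).
Proof.
move=> [m1 [B1 h1]] [m2 [B2 h2]]; split; first exact: measurable_funM.
exists (B1 * B2) => x x1; rewrite normrM; apply: ler_pM => //; [exact: h1|exact: h2].
Qed.

Lemma tame_sum (I : Type) (r : seq I) (phi : I -> 'rV[R]_d -> R) :
  (forall i, tame (phi i)) -> tame (fun x => \sum_(i <- r) phi i x).
Proof.
move=> h; elim: r => [|i r IH]; first by under eq_fun do rewrite big_nil; exact: tame_cst.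
by under eq_fun do rewrite big_cons; exact: tameD.
Qed.

Lemma meanD phi psi : tame phi -> tame psi ->
  mean (fun x => phi x + psi x) = mean phi + mean psi.
Proof.
move=> h1 h2; rewrite /mean -RintegralD//; try exact: tame_integrable.
by apply: eq_Rintegral => x _; rewrite mulrDl.
Qed.

Lemma meanZ a phi : tame phi -> mean (fun x => a * phi x) = a * mean phi.
Proof.
move=> h1; rewrite /mean -RintegralZl//; last exact: tame_integrable.
by apply: eq_Rintegral => x _; rewrite mulrA.
Qed.

Lemma mean_sum (I : Type) (r : seq I) (phi : I -> 'rV[R]_d -> R) :
  (forall i, tame (phi i)) ->
  mean (fun x => \sum_(i <- r) phi i x) = \sum_(i <- r) mean (phi i).
Proof.
move=> h; elim: r => [|i r IH].
  rewrite big_nil /mean (@eq_Rintegral _ _ _ _ _ (cst 0)) ?Rintegral_cst ?mul0r// => x _.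
  by rewrite big_nil mul0r.
rewrite big_cons -IH -meanD//; last exact: tame_sum.
by apply: eq_Rintegral => x _; rewrite big_cons.
Qed.

Lemma mean_le phi psi : tame phi -> tame psi ->
  {ae lam, forall x, closed_unit_ball x -> phi x <= psi x} -> mean phi <= mean psi.
Proof.
move=> h1 h2 le12.
have hN : tame (fun x => -1 * phi x) by apply: tameM => //; exact: tame_cst.
rewrite -subr_ge0 -mulN1r -meanZ// -meanD//; set D := fun x => psi x + -1 * phi x.
have tD : tame D by exact: tameD.
have mD : measurable_fun setT (fun x => D x * f x) by have [M []] := tame_boxed tD.
rewrite /mean /Rintegral fine_ge0//.
rewrite (@ae_eq_integral _ _ _ lam setT (fun x => (`|D x * f x|)%:E)) //.
- by apply: integral_ge0 => x _; rewrite lee_fin.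
- exact/measurable_EFinP.
- by apply/measurable_EFinP; exact: measurableT_comp.
apply: filterS le12 => x hx _; congr (_%:E).
have [xB|xB] := pselect (closed_unit_ball x); last by rewrite density_eq0// mulr0 normr0.
by rewrite ger0_norm// mulr_ge0// /D mulN1r subr_ge0; exact: hx.
Qed.

Lemma Rintegral_density (phi : 'rV[R]_d -> R) : measurable_fun setT phi -> \int[P]_x phi x = mean phi.
Proof.
move=> mphi.
have H (psi : 'rV[R]_d -> R) : measurable_fun setT psi -> (forall x, 0 <= psi x) ->
    (\int[P]_x (psi x)%:E = \int[lam]_x (psi x * f x)%:E)%E.
  move=> mpsi psi0.
  have := @ge0_integral_transfer _ _ _ _ R lam P id f 1 (@measurable_id _ _ _) mf f0 ler01.
  move=> tr; rewrite [RHS](tr _ psi)//; first by rewrite mul1e.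
  move=> A mA; rewrite mul1e; apply: (etrans _ (esym (densf.2 A mA))).
  rewrite [RHS]integral_mkcond; apply: eq_integral => x _.
  by rewrite patchE indicE; case: (x \in A); rewrite ?mul1r ?mul0r.
congr fine; rewrite integralE [RHS]integralE; congr (_ - _)%E.
  rewrite [RHS](_ : _ = \int[lam]_x (Num.max (phi x) 0 * f x)%:E)%E.
    rewrite -(H (fun x => Num.max (phi x) 0)).
    - by apply: eq_integral => x _; rewrite funeposE -EFin_max.
    - exact: measurable_maxr.
    - by move=> x; rewrite le_max lexx orbT.
  by apply: eq_integral => x _; rewrite funeposE -EFin_max maxr_pMl// mul0r.
rewrite [RHS](_ : _ = \int[lam]_x (Num.max (- phi x) 0 * f x)%:E)%E.
  rewrite -(H (fun x => Num.max (- phi x) 0)).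
  - by apply: eq_integral => x _; rewrite funenegE -EFinN -EFin_max.
  - by apply: measurable_maxr => //; exact: measurableT_comp.
  - by move=> x; rewrite le_max lexx orbT.
by apply: eq_integral => x _; rewrite funenegE -EFinN -EFin_max maxr_pMl// mul0r mulNr.
Qed.

Lemma mean_cst a : mean (fun=> a) = a.
Proof.
rewrite -Rintegral_density// Rintegral_cst// [fine _](_ : _ = 1) ?mulr1//.
exact: (congr1 fine (probability_setT P)).
Qed.

End density.

(** * Gradient and Hessian of the risk *)
Section risk_gradient.
Context {R : realType} {d k : nat}.
Local Notation lam := (@lebesgue_rV R d).
Variables (P : probability 'rV[R]_d R) (f : 'rV[R]_d -> R).
Hypotheses (k0 : (0 < k)%N) (hpeak : P closed_unit_ball = 1%E) (cf : continuous f)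
  (densf : is_density P f).
Implicit Types (c h u v : 'M[R]_(k, d)) (x : 'rV[R]_d).

Definition distinct_rows c := forall i j : 'I_k, i != j -> row i c != row j c.

Lemma risk_mean c : risk P c = mean f (gamma c).
Proof. by rewrite /risk (Rintegral_density cf densf)//; exact: measurable_gamma. Qed.

Lemma tame_gamma c : tame (gamma c).
Proof.
split; first exact: measurable_gamma.
exists (d%:R * (1 + `|c|) ^+ 2) => x x1; rewrite ger0_norm ?gamma_ge0//.
exact: gamma_bounded.
Qed.

Lemma tame_cell c l : tame (cell c l).
Proof.
split; first exact: measurable_cell.
exists 1 => x _; have /andP[h0 h1] : 0 <= cell c l x <= 1 by apply: prod_01 => i; exact: below_01.
by rewrite ger0_norm.
Qed.

Lemma tame_coord r : tame (fun x => x 0 r).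
Proof. by apply: continuous_tame => x; exact: coord_continuous. Qed.

Lemma tame_dotv c l h : tame (fun x => dotv (x - row l c) (row l h)).
Proof.
apply: tame_sum => r; apply: tameM; last exact: tame_cst.
have -> : (fun x : 'rV[R]_d => (x - row l c) 0 r) = fun x => x 0 r + - c l r.
  by apply/funext => x; rewrite !mxE.
by apply: tameD; [exact: tame_coord|exact: tame_cst].
Qed.

Definition row_sqd h : R := \sum_l sqd (row l h).


(** The squared distances are differentiated inside fixed cells; the motion of the cells
    contributes nothing at first order, since the two distances agree on a face. *)
Definition gradient c h : R :=
  mean f (fun x => \sum_l cell c l x * (- 2 * dotv (x - row l c) (row l h))).

Let tame_grad c h : tame (fun x => \sum_l cell c l x * (- 2 * dotv (x - row l c) (row l h))).
Proof.
apply: tame_sum => l; apply: tameM; first exact: tame_cell.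
by apply: tameM; [exact: tame_cst|exact: tame_dotv].
Qed.

(** Off the bisectors, which are negligible, exactly one cell contains a given point. *)
Lemma cells_partition c : distinct_rows c ->
  {ae lam, forall x, exists j, gamma c x = qdist c j x /\
     forall phi : 'I_k -> R, \sum_l cell c l x * phi l = phi j}.
Proof.
move=> dc.
have : {ae lam, forall x, forall l i : 'I_k, l != i -> qdist c l x - qdist c i x != 0}.
  apply: filter_forall => l; apply: filter_forall => i.
  have [->|li] := eqVneq l i; first exact: aeW.
  have s0 : gap_slope c l i != 0.
    by rewrite lt0r_neq0// mulr_gt0// sqd_gt0// subr_eq0 dc// eq_sym.
  have := ae_affine_neq0 (measurable_gap c l i) s0 (fun x s => gap_shift l c i x s (gap_dir c l i)).
  by apply: filterS => x h _.
apply: filterS => x hx; have [j hj] := gamma_attained k0 c x.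
exists j; split => // phi; rewrite (bigD1 j)//= big1 ?addr0.
  rewrite (_ : cell c j x = 1) ?mul1r//; apply: big1 => i _.
  by rewrite /side /below subr_le0 -hj gamma_le.
move=> l lj; rewrite (_ : cell c l x = 0) ?mul0r//; apply/eqP.
rewrite prodf_seq_eq0; apply/hasP; exists j; first exact: mem_index_enum.
rewrite /= /side /below; have := hx l j lj.
have : 0 <= qdist c l x - qdist c j x by rewrite subr_ge0 -hj gamma_le.
by move=> h1 h2; rewrite le_eqVlt (negbTE h2)/= ltNge h1.
Qed.


(** Leaving every point in its old cell can only increase its loss, and with fixed cells the
    loss is exactly quadratic. *)
Lemma risk_upper c h : distinct_rows c ->
  risk P (c + h) <= risk P c + gradient c h + row_sqd h.
Proof.
move=> dc; rewrite !risk_mean -(mean_cst cf densf (row_sqd h)).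
have tg := tame_gamma c; have tG := tame_grad c h; 
  have tS : tame (fun _ : 'rV[R]_d => row_sqd h) by exact: tame_cst.
have t1 : tame (fun x => gamma c x + \sum_l cell c l x * (- 2 * dotv (x - row l c) (row l h))).
  exact: tameD.
rewrite /gradient -(meanD hpeak cf densf tg tG) -(meanD hpeak cf densf t1 tS).
apply: (mean_le hpeak cf densf (tame_gamma _)); first exact: tameD.
apply: filterS (cells_partition dc) => x [j [gj sj]] _.
rewrite sj gj; apply: (le_trans (gamma_le (c + h) j x)); rewrite qdistD -mulNr lerD2l.
by rewrite /row_sqd (bigD1 j)//= lerDl sumr_ge0// => l _; exact: sqd_ge0.
Qed.

Definition moment_density r x : R := x 0 r * f x.

Definition gradient_entry c l r : R :=
  2 * c l r * cell_integral f l c - 2 * cell_integral (moment_density r) l c.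

Lemma gradientE c h : gradient c h = \sum_l \sum_r h l r * gradient_entry c l r.
Proof.
have t2 l r : tame (fun x => cell c l x * x 0 r).
  by apply: tameM; [exact: tame_cell|exact: tame_coord].
have tc := tame_cell c.
have t1 l r : tame (fun x => h l r * (2 * c l r * cell c l x + - 2 * (cell c l x * x 0 r))).
  apply: tameM; first exact: tame_cst.
  by apply: tameD; apply: tameM => //; exact: tame_cst.
transitivity (mean f (fun x => \sum_l \sum_r
    h l r * (2 * c l r * cell c l x + - 2 * (cell c l x * x 0 r)))).
  apply: eq_Rintegral => x _; congr (_ * _); apply: eq_bigr => l _.
  rewrite /dotv mulrA mulr_sumr; apply: eq_bigr => r _; rewrite !mxE; ring.
rewrite (mean_sum hpeak cf densf); last by move=> l; exact: tame_sum.
apply: eq_bigr => l _; rewrite (mean_sum hpeak cf densf)//; apply: eq_bigr => r _.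
have t3 : tame (fun x => 2 * c l r * cell c l x) by apply: tameM => //; exact: tame_cst.
have t4 : tame (fun x => - 2 * (cell c l x * x 0 r)) by apply: tameM => //; exact: tame_cst.
rewrite (meanZ hpeak cf densf); last exact: tameD.
rewrite (meanD hpeak cf densf)// !(meanZ hpeak cf densf)//.
rewrite /gradient_entry mulNr; congr (_ * (_ - 2 * _)).
by apply: eq_Rintegral => x _; rewrite /moment_density mulrA.
Qed.

Lemma gradientZ a c h : gradient c (a *: h) = a * gradient c h.
Proof.
rewrite !gradientE mulr_sumr; apply: eq_bigr => l _; rewrite mulr_sumr.
by apply: eq_bigr => r _; rewrite mxE mulrA.
Qed.

Lemma row_sqdZ a h : row_sqd (a *: h) = a ^+ 2 * row_sqd h.
Proof.
rewrite /row_sqd mulr_sumr; apply: eq_bigr => l _; rewrite /sqd /dotv mulr_sumr.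
by apply: eq_bigr => r _; rewrite !mxE; ring.
Qed.

Lemma row_sqd_ge0 h : 0 <= row_sqd h.
Proof. by apply: sumr_ge0 => l _; exact: sqd_ge0. Qed.


(** Otherwise a small step against the gradient would decrease the right-hand side of
    [risk_upper] below the minimum. *)
Lemma gradient_optimal c h : distinct_rows c -> optimal P c -> gradient c h = 0.
Proof.
move=> dc oc.
have H a : 0 <= a * gradient c h + a ^+ 2 * row_sqd h.
  rewrite -gradientZ -row_sqdZ.
  have := le_trans (oc (c + a *: h)) (risk_upper (a *: h) dc).
  by rewrite -addrA lerDl.
set g := gradient c h in H *; set S := row_sqd h in H.
have S0 : 0 <= S by exact: row_sqd_ge0.
have S1 : 0 < S + 1 by rewrite ltr_wpDl.
have := H (- g / (S + 1)).
have -> : - g / (S + 1) * g + (- g / (S + 1)) ^+ 2 * S = - (g ^+ 2 / (S + 1) ^+ 2).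
  by field; rewrite gt_eqF.
rewrite oppr_ge0 => h1; have h2 : 0 <= g ^+ 2 / (S + 1) ^+ 2.
  by rewrite divr_ge0 ?sqr_ge0.
have /eqP : g ^+ 2 / (S + 1) ^+ 2 = 0 by apply/eqP; rewrite eq_le h1 h2.
by rewrite mulf_eq0 invr_eq0 !expf_eq0/= (gt_eqF S1) orbF => /eqP.
Qed.

Definition gradient_entry_derivative c l r v : R :=
  2 * v l r * cell_integral f l c + 2 * c l r * cell_derivative c f l v
  - 2 * cell_derivative c (moment_density r) l v.


(** The derivative of [gradient c h] when [c] moves in the direction [u]. *)
Definition second_derivative c u h : R :=
  \sum_l \sum_r h l r * gradient_entry_derivative c l r u.

Lemma moment_density_props r : [/\ continuous (moment_density r),
  forall x, 1 < `|x| -> moment_density r x = 0 &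
  exists M, forall x, `|moment_density r x| <= M].
Proof.
split.
- have cx : continuous (fun x : 'rV[R]_d => x 0 r) by exact: coord_continuous.
  by move=> x; apply: (@continuousM R _ (fun x : 'rV[R]_d => x 0 r) f); [exact: cx|exact: cf].
- by move=> x x1; rewrite /moment_density (density_eq0_norm hpeak cf densf)// mulr0.
- have [M [_ h _]] := tame_boxed hpeak cf densf (tame_coord r).
  by exists M => x; exact: h.
Qed.

Lemma second_derivative_linear c a u v h : distinct_rows c ->
  second_derivative c (a *: u + v) h =
  a * second_derivative c u h + second_derivative c v h.
Proof.
move=> dc; rewrite /second_derivative mulr_sumr -big_split; apply: eq_bigr => l _ /=.
rewrite mulr_sumr -big_split; apply: eq_bigr => r _ /=.
have [cm m0 [M mM]] := moment_density_props r; have [Mf fM] := density_bounded hpeak cf densf.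
rewrite /gradient_entry_derivative !mxE.
rewrite (cell_derivative_linear dc cf (density_eq0_norm hpeak cf densf) fM).
rewrite (cell_derivative_linear dc cm m0 mM); ring.
Qed.

Lemma cvg_gradient_entry c l r (t_ : nat -> R) (v_ : nat -> 'M[R]_(k, d)) v :
  distinct_rows c -> (forall n, t_ n != 0) -> t_ n @[n --> \oo] --> 0 ->
  v_ n @[n --> \oo] --> v ->
  (t_ n)^-1 * (gradient_entry (c + t_ n *: v_ n) l r - gradient_entry c l r) @[n --> \oo] -->
    gradient_entry_derivative c l r v.
Proof.
move=> dc t0 tc vc.
have [cm m0 [M mM]] := moment_density_props r; have [Mf fM] := density_bounded hpeak cf densf.
have h1 := cvg_cell_derivative dc cf (density_eq0_norm hpeak cf densf) fM (l := l) t0 tc vc.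
have h2 := cvg_cell_derivative dc cm m0 mM (l := l) t0 tc vc.
have h3 : cell_integral f l (c + t_ n *: v_ n) @[n --> \oo] --> cell_integral f l c.
  have h : t_ n * ((t_ n)^-1 * (cell_integral f l (c + t_ n *: v_ n) - cell_integral f l c)) +
      cell_integral f l c @[n --> \oo] --> 0 * cell_derivative c f l v + cell_integral f l c.
    by apply: cvgD; [exact: cvgM|exact: cvg_cst].
  rewrite mul0r add0r in h.
  set e : nat -> R := fun n => _.
  rewrite (_ : e = fun n => t_ n * ((t_ n)^-1 * (cell_integral f l (c + t_ n *: v_ n) -
    cell_integral f l c)) + cell_integral f l c)//.
  by apply/funext => n; rewrite mulrA divff// mul1r subrK.
set e : nat -> R := fun n => _.
rewrite (_ : e = fun n => 2 * v_ n l r * cell_integral f l (c + t_ n *: v_ n) +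
   2 * c l r * ((t_ n)^-1 * (cell_integral f l (c + t_ n *: v_ n) - cell_integral f l c)) -
   2 * ((t_ n)^-1 * (cell_integral (moment_density r) l (c + t_ n *: v_ n) -
       cell_integral (moment_density r) l c))).
  apply: cvgB; last by apply: cvgM => //; exact: cvg_cst.
  apply: cvgD; last by apply: cvgM => //; exact: cvg_cst.
  apply: cvgM => //; apply: cvgM; first exact: cvg_cst.
  exact: cvg_mx_entry.
by apply/funext => n; rewrite /e /gradient_entry !mxE; field; exact: t0.
Qed.

Lemma cvg_gradient c (t_ : nat -> R) (v_ h_ : nat -> 'M[R]_(k, d)) v h :
  distinct_rows c -> (forall n, t_ n != 0) -> t_ n @[n --> \oo] --> 0 ->
  v_ n @[n --> \oo] --> v -> h_ n @[n --> \oo] --> h ->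
  (t_ n)^-1 * (gradient (c + t_ n *: v_ n) (h_ n) - gradient c (h_ n)) @[n --> \oo] -->
    second_derivative c v h.
Proof.
move=> dc t0 tc vc hc; set e : nat -> R := fun n => _.
rewrite (_ : e = fun n => \sum_l \sum_r h_ n l r *
    ((t_ n)^-1 * (gradient_entry (c + t_ n *: v_ n) l r - gradient_entry c l r))).
  apply: cvgr_sum => l _; apply: cvgr_sum => r _; apply: cvgM; first exact: cvg_mx_entry.
  exact: cvg_gradient_entry.
apply/funext => n; rewrite /e !gradientE -sumrB mulr_sumr; apply: eq_bigr => l _.
rewrite -sumrB mulr_sumr; apply: eq_bigr => r _; ring.
Qed.

End risk_gradient.


(** Derivatives are limits along a filter, whereas dominated convergence yields limits of
    sequences. *)
Lemma cvg_dnbhs_seq (R : realType) (phi : R -> R) (l : R) :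
  (forall t_ : nat -> R, (forall n, t_ n != 0) -> t_ n @[n --> \oo] --> 0 ->
     phi (t_ n) @[n --> \oo] --> l) ->
  phi t @[t --> 0^'] --> l.
Proof.
move=> H; apply/cvgrPdist_lt => e e0; apply: contrapT => nP.
have [t_ ht] : {t_ : nat -> R & forall n, [/\ t_ n != 0, `|t_ n| < n.+1%:R^-1 & ~ `|l - phi (t_ n)| < e]}.
  apply: (@choice _ _ (fun n t => [/\ t != 0, `|t| < n.+1%:R^-1 & ~ `|l - phi t| < e])) => n.
  apply: contrapT => nE; apply: nP.
  exists n.+1%:R^-1 => //= t; rewrite /ball_/= sub0r normrN => tn t0.
  by apply: contrapT => nPt; apply: nE; exists t.
have tc : t_ n @[n --> \oo] --> 0.
  apply/cvgr0Pnorm_lt => a a0.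
  have : \forall n \near \oo, n.+1%:R^-1 < a :> R.
    have := @cvg_harmonic R; move/cvgr0Pnorm_lt => /(_ a a0).
    by apply: filterS => n; rewrite /harmonic/= ger0_norm.
  by apply: filterS => n; apply: lt_trans; have [_ h _] := ht n.
have t0 n : t_ n != 0 by have [] := ht n.
have /cvgrPdist_lt/(_ e e0)[N _ HN] := H t_ t0 tc.
by have [_ _] := ht N; apply; exact: (HN N (leqnn N)).
Qed.

Lemma derive_seq (R : realType) (V : normedModType R) (F : V -> R) (a v : V) (l : R) :
  (forall t_ : nat -> R, (forall n, t_ n != 0) -> t_ n @[n --> \oo] --> 0 ->
     (t_ n)^-1 * (F (a + t_ n *: v) - F a) @[n --> \oo] --> l) ->
  'D_v F a = l.
Proof.
move=> H; rewrite /derive; apply/cvg_lim => //.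
apply: (@cvg_dnbhs_seq _ (fun h => h^-1 *: ((F \o shift a) (h *: v) - F a))) => t_ t0 tc.
rewrite (_ : (fun n => _) = fun n => (t_ n)^-1 * (F (a + t_ n *: v) - F a)).
  exact: H.
by apply/funext => n /=; rewrite [t_ n *: v + a]addrC.
Qed.

Lemma scalar_linear_sum (R : realType) (V : lmodType R) (phi : V -> R) (I : Type) (r : seq I)
    (a : I -> R) (u : I -> V) :
  (forall b x y, phi (b *: x + y) = b * phi x + phi y) ->
  phi (\sum_(i <- r) a i *: u i) = \sum_(i <- r) a i * phi (u i).
Proof.
move=> lin; have phi0 : phi 0 = 0.
  have := lin 1 0 0; rewrite scaler0 addr0 mul1r => /eqP.
  by rewrite -subr_eq0 opprD addrA subrr sub0r oppr_eq0 => /eqP.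
by elim: r => [|i r IH]; rewrite ?big_nil// !big_cons lin IH.
Qed.


(** A cluster point exists by compactness; since [i <= s i], limits at infinity pass to the
    indices [s]. *)
Lemma bounded_seq_cluster (R : realType) m n (v_ : nat -> 'M[R]_(m, n)) (M : R) :
  (forall i, `|v_ i| <= M) ->
  exists (s : nat -> nat) (v : 'M[R]_(m, n)), (forall i, i <= s i)%N /\
    v_ (s i) @[i --> \oo] --> v.
Proof.
move=> vM; have M0 : 0 <= M by apply: le_trans (vM 0%N).
pose w_ i := mxvec (v_ i).
have wM i : `|w_ i| <= M.
  apply: mx_norm_le => // a b; rewrite ord1 /w_; case/mxvec_indexP: b => i' j'.
  by rewrite mxvecE; apply: (le_trans (mx_norm_entry _ _ _)).
have wn : (w_ @ \oo) [set x : 'rV[R]_(m * n) | `|x| <= M] by exists 0%N => // i _; exact: wM.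
have [w [_ cw]] := @compact_mx_box R (m * n) M (w_ @ \oo) _ wn.
have [s hs] : {s : nat -> nat & forall i, (i <= s i)%N /\ `|w_ (s i) - w| < i.+1%:R^-1}.
  apply: (@choice _ _ (fun i j => (i <= j)%N /\ `|w_ j - w| < i.+1%:R^-1)) => i.
  have i0 : 0 < i.+1%:R^-1 :> R by rewrite invr_gt0.
  have [_ [[j ij <-]]] := cw [set w_ j | j in [set j | (i <= j)%N]] (ball w i.+1%:R^-1)
    (ex_intro2 _ _ i I (fun j ij => ex_intro2 _ _ j ij erefl)) (nbhsx_ballx w _ i0).
  by rewrite -ball_normE /= distrC => h; exists j.
exists s, (vec_mx w); split => [i|]; first by have [] := hs i.
apply/cvgrPdist_lt => a a0.
have : \forall n \near \oo, n.+1%:R^-1 < a :> R.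
  have := @cvg_harmonic R; move/cvgr0Pnorm_lt => /(_ a a0).
  by apply: filterS => i; rewrite /harmonic/= ger0_norm.
apply: filterS => i; apply: le_lt_trans; have [_ h] := hs i.
rewrite distrC; apply: le_trans (ltW h); apply: mx_norm_le => // i' j'.
rewrite !mxE -(mxvecE (v_ (s i))) -/(w_ (s i)).
by have := mx_norm_entry (w_ (s i) - w) 0 (mxvec_index i' j'); rewrite !mxE.
Qed.

Lemma sub_rearrange (R : realType) (A b x y : R) : b <= A - x + y -> x - y <= A - b.
Proof. lra. Qed.

Lemma quotient_between (R : realType) (t D g g' S : R) : t != 0 ->
  t * g' - t ^+ 2 * S <= D -> D <= t * g + t ^+ 2 * S ->
  `|t^-1 * D - g| <= `|g' - g| + `|t| * S.
Proof.
move=> t0 d2 d1; have [tp|tneg] := ltP 0 t.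
  have e1 : t^-1 * D <= g + t * S.
    by rewrite mulrC ler_pdivrMr// (le_trans d1)//; lra.
  have e2 : g' - t * S <= t^-1 * D.
    by rewrite [leRHS]mulrC ler_pdivlMr// (le_trans _ d2)//; lra.
  rewrite [`|t|]gtr0_norm//; have := ler_norm (g' - g); have := ler_norm (- (g' - g)).
  rewrite normrN => a1 a2; rewrite ler_norml; apply/andP; split; lra.
have {}tneg : t < 0 by rewrite lt_neqAle t0.
have e1 : g + t * S <= t^-1 * D.
  by rewrite [leRHS]mulrC ler_ndivlMr// (le_trans d1)//; lra.
have e2 : t^-1 * D <= g' - t * S.
  by rewrite mulrC ler_ndivrMr// (le_trans _ d2)//; lra.
rewrite [`|t|]ltr0_norm//; have := ler_norm (g' - g); have := ler_norm (- (g' - g)).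
rewrite normrN => a1 a2; rewrite ler_norml; apply/andP; split; lra.
Qed.

Section risk_hessian.
Context {R : realType} {d k : nat}.
Variables (P : probability 'rV[R]_d R) (f : 'rV[R]_d -> R).
Hypotheses (k0 : (0 < k)%N) (hpeak : P closed_unit_ball = 1%E) (cf : continuous f)
  (densf : is_density P f).
Implicit Types (c h u v : 'M[R]_(k, d)).

Lemma near_distinct_rows T (F : set_system T) {FF : Filter F} (c_ : T -> 'M[R]_(k, d)) c :
  c_ n @[n --> F] --> c -> distinct_rows c -> \forall n \near F, distinct_rows (c_ n).
Proof.
move=> cc dc; apply: filter_forall => i; apply: filter_forall => j.
have [->|ij] := eqVneq i j; first by apply: nearW => n; rewrite eqxx.
have h : sqd (row i (c_ n) - row j (c_ n)) @[n --> F] --> sqd (row i c - row j c).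
  rewrite /sqd /dotv; apply: cvgr_sum => r _; rewrite !mxE.
  under eq_fun do rewrite !mxE.
  by apply: cvgM; apply: cvgB; exact: cvg_mx_entry.
have h0 : 0 < sqd (row i c - row j c) by rewrite sqd_gt0// subr_eq0 dc.
have : \forall n \near F, 0 < sqd (row i (c_ n) - row j (c_ n)) by apply: (cvgr_gt _ h).
apply: filterS => n hn _; apply: contraTneq hn => ->; rewrite subrr.
by rewrite /sqd /dotv big1 ?ltxx// => r _; rewrite mxE mul0r.
Qed.

Let cvg_shifted c (t_ : nat -> R) (v_ : nat -> 'M[R]_(k, d)) v :
  t_ n @[n --> \oo] --> 0 -> v_ n @[n --> \oo] --> v -> c + t_ n *: v_ n @[n --> \oo] --> c.
Proof.
move=> tc vc; rewrite -[X in _ --> X]addr0 -(scale0r v).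
by apply: cvgD; [exact: cvg_cst|exact: cvgZ].
Qed.


(** Applied from [c] and back from [c + t * h], the bound [risk_upper] encloses the increment of
    the risk between [t * gradient c h] and [t * gradient (c + t * h) h], up to [t^2]; the
    gradient is continuous. *)
Lemma cvg_risk_derivative c h (t_ : nat -> R) : distinct_rows c ->
  (forall n, t_ n != 0) -> t_ n @[n --> \oo] --> 0 ->
  (t_ n)^-1 * (risk P (c + t_ n *: h) - risk P c) @[n --> \oo] --> gradient f c h.
Proof.
move=> dc t0 tc; set S := row_sqd h; have S0 : 0 <= S by exact: row_sqd_ge0.
set g := gradient f c h; pose g_ n := gradient f (c + t_ n *: h) h.
have hc : (fun=> h) n @[n --> \oo] --> h by exact: cvg_cst.
have dg : g_ n - g @[n --> \oo] --> 0.
  have h0 := cvgM tc (cvg_gradient hpeak cf densf dc t0 tc hc hc).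
  rewrite mul0r in h0.
  rewrite (_ : (fun n => g_ n - g) = fun n => t_ n * ((t_ n)^-1 * (g_ n - g))); first exact: h0.
  by apply/funext => n /=; rewrite mulrA divff// mul1r.
have near_d := near_distinct_rows (@cvg_shifted c _ _ _ tc hc) dc.
apply/cvgrPdist_le => e e0.
have bnd : `|g_ n - g| + `|t_ n| * S @[n --> \oo] --> 0.
  rewrite -[X in _ --> X]addr0; apply: cvgD.
    by move/cvg_norm : dg; rewrite normr0.
  rewrite -(mul0r S); apply: cvgM; last exact: cvg_cst.
  by move/cvg_norm : tc; rewrite normr0.
near=> n.
have dn : distinct_rows (c + t_ n *: h) by near: n; exact: near_d.
have : `|g_ n - g| + `|t_ n| * S <= e.
  have : `| `|g_ n - g| + `|t_ n| * S | <= e by near: n; move/cvgr0Pnorm_le : bnd; apply.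
  by apply: le_trans; exact: ler_norm.
apply: le_trans.
have h1 := risk_upper k0 hpeak cf densf (t_ n *: h) dc.
have h2 := risk_upper k0 hpeak cf densf (- t_ n *: h) dn.
rewrite scaleNr addrK -scaleNr in h2.
rewrite !(gradientZ hpeak cf densf) !row_sqdZ sqrrN -/S -/g -/(g_ n) in h1 h2.
set D := risk P (c + t_ n *: h) - risk P c.
have d1 : D <= t_ n * g + t_ n ^+ 2 * S by rewrite /D lerBlDl addrA.
have d2 : t_ n * g_ n - t_ n ^+ 2 * S <= D.
  by rewrite mulNr in h2; exact: sub_rearrange h2.
by rewrite distrC; exact: quotient_between.
Unshelve. all: end_near.
Qed.

Let F (v : 'rV[R]_(k * d)) := risk P (vec_mx v : 'M[R]_(k, d)).

Lemma derive_risk y e : distinct_rows (vec_mx y) -> 'D_e F y = gradient f (vec_mx y) (vec_mx e).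
Proof.
move=> dy; apply: derive_seq => t_ t0 tc; rewrite /F.
under eq_fun do rewrite linearD linearZ/=.
exact: cvg_risk_derivative.
Qed.

Lemma hessian_risk c i j : distinct_rows c ->
  hessian F (mxvec c) i j =
  second_derivative f c (vec_mx (delta_mx 0 i)) (vec_mx (delta_mx 0 j)).
Proof.
move=> dc; rewrite mxE; apply: derive_seq => t_ t0 tc.
set u := vec_mx (delta_mx 0 i); set h := vec_mx (delta_mx 0 j).
have hc : (fun=> h) n @[n --> \oo] --> h by exact: cvg_cst.
have uc : (fun=> u) n @[n --> \oo] --> u by exact: cvg_cst.
have lim := cvg_gradient hpeak cf densf dc t0 tc uc hc.
apply: (cvg_trans _ lim); apply: near_eq_cvg.
have nd : \forall n \near \oo, distinct_rows (c + t_ n *: u).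
  exact: near_distinct_rows (@cvg_shifted c _ _ _ tc uc) dc.
apply: filterS nd => n dn; rewrite !derive_risk ?linearD ?linearZ/= ?mxvecK//.
Qed.

Lemma hessian_quadratic c (v : 'rV[R]_(k * d)) : distinct_rows c ->
  (v *m hessian F (mxvec c) *m v^T) 0 0 = second_derivative f c (vec_mx v) (vec_mx v).
Proof.
move=> dc.
have vE : vec_mx v = \sum_i v 0 i *: vec_mx (delta_mx 0 i) :> 'M[R]_(k, d).
  by rewrite {1}[v]row_sum_delta linear_sum/=; apply: eq_bigr => i _; rewrite linearZ.
have linr w b x y : second_derivative f c w (b *: x + y) =
    b * second_derivative f c w x + second_derivative f c w y.
  rewrite /second_derivative mulr_sumr -big_split; apply: eq_bigr => l _ /=.
  rewrite mulr_sumr -big_split; apply: eq_bigr => r _ /=.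
  by rewrite !mxE mulrDl mulrA.
rewrite {2}vE (@scalar_linear_sum _ _ (second_derivative f c (vec_mx v))); last exact: linr.
rewrite mxE; apply: eq_bigr => j _; rewrite !mxE mulrC; congr (_ * _).
rewrite vE (@scalar_linear_sum _ _ (fun w => second_derivative f c w (vec_mx (delta_mx 0 j)))).
  by apply: eq_bigr => i _; rewrite hessian_risk.
by move=> b x y; rewrite (second_derivative_linear hpeak cf densf).
Qed.

End risk_hessian.

(** * Quadratic growth at an optimal codebook *)
Lemma step_gain_gt0 (R : realType) (Q S : R) : 0 < Q -> 0 <= S ->
  0 < Q / (2 * (S + 1)) * Q - (Q / (2 * (S + 1))) ^+ 2 * S.
Proof.
move=> Q0 S0.
have S1 : 0 < S + 1 by rewrite ltr_wpDl.
have -> : Q / (2 * (S + 1)) * Q - (Q / (2 * (S + 1))) ^+ 2 * S =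
   Q ^+ 2 * (S + 2) / (4 * (S + 1) ^+ 2) by field; rewrite gt_eqF.
by rewrite divr_gt0 ?mulr_gt0 ?exprn_gt0//; lra.
Qed.

Section quadratic_growth.
Context {R : realType} {d k : nat}.
Local Notation lam := (@lebesgue_rV R d).
Variables (P : probability 'rV[R]_d R) (f : 'rV[R]_d -> R).
Hypotheses (k0 : (0 < k)%N) (hpeak : P closed_unit_ball = 1%E) (cf : continuous f)
  (densf : is_density P f).
Implicit Types (c h u v : 'M[R]_(k, d)).

(** If growth fails, there are codebooks [c + t * v_] with [t] tending to [0], unit [v_]
    converging to some [v], and excess [o(t^2)]. By [risk_upper], moving back by
    [ep * t * v_] decreases the risk by at least [ep * t * g - (ep * t)^2 * S], where
    the gradient [g] is equivalent to [t * Q], with [Q > 0] the second derivative along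
    [v], since it vanishes at [c]. For small [ep] this falls below the minimal risk.
    An upper expansion of the risk thus suffices. *)
Lemma quadratic_growth c : distinct_rows c -> optimal P c ->
  (forall v, v != 0 -> 0 < second_derivative f c v v) ->
  exists2 a : R, 0 < a & \forall c' \near c, a * `|c' - c| ^+ 2 <= risk P c' - risk P c.
Proof.
move=> dc oc pd; apply: contrapT => nG.
have [c_ hc] : {c_ : nat -> 'M[R]_(k, d) & forall n, `|c_ n - c| < n.+1%:R^-1 /\
    risk P (c_ n) - risk P c < n.+1%:R^-1 * `|c_ n - c| ^+ 2}.
  apply: (@choice _ _ (fun n e => `|e - c| < n.+1%:R^-1 /\
    risk P e - risk P c < n.+1%:R^-1 * `|e - c| ^+ 2)) => n.
  apply: contrapT => nE; apply: nG; exists n.+1%:R^-1; first by rewrite invr_gt0.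
  apply/nbhs_ballP; exists n.+1%:R^-1 => /=; first by rewrite invr_gt0.
  move=> e; rewrite -ball_normE /= distrC => ec; rewrite leNgt; apply/negP => h.
  by apply: nE; exists e.
pose t_ n := `|c_ n - c|; pose v_ n := (t_ n)^-1 *: (c_ n - c).
have t0 n : t_ n != 0.
  apply/negP => /eqP tn; have [_] := hc n; rewrite -/(t_ n) tn expr0n mulr0.
  by move/normr0_eq0/subr0_eq : tn => ->; rewrite subrr ltxx.
have tp n : 0 < t_ n by rewrite lt_neqAle eq_sym t0 normr_ge0.
have v1 n : `|v_ n| = 1 by rewrite normrZ gtr0_norm ?invr_gt0// mulVf.
have [s [v [sn vc]]] := bounded_seq_cluster (fun n => eq_ind_r (fun x => x <= 1) (lexx 1) (v1 n)).
have v0 : v != 0.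
  apply/negP => /eqP v0; move: vc; rewrite v0 => /cvgr0Pnorm_lt/(_ 1 ltr01)[N _ HN].
  by have := HN N (leqnn N); rewrite v1 ltxx.
have cE n : c + t_ n *: v_ n = c_ n.
  by rewrite scalerA divff// scale1r addrC subrK.
have invs n : (s n).+1%:R^-1 <= n.+1%:R^-1 :> R by rewrite lef_pV2 ?posrE// ler_nat ltnS; exact: sn.
have harm : n.+1%:R^-1 @[n --> \oo] --> (0 : R) by exact: cvg_harmonic.
have tc : t_ (s n) @[n --> \oo] --> 0.
  apply: (@squeeze_cvgr _ _ _ _ (cst 0) (fun n => n.+1%:R^-1)) => //; last exact: cvg_cst.
  apply: nearW => n; rewrite /cst/= normr_ge0/=; apply: le_trans (invs n).
  by have [/ltW] := hc (s n).
have ts0 n : t_ (s n) != 0 by [].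
have dcs : \forall n \near \oo, distinct_rows (c_ (s n)).
  have cc : c_ (s n) @[n --> \oo] --> c.
    rewrite (_ : (fun n => c_ (s n)) = fun n => c + t_ (s n) *: v_ (s n)).
      rewrite -[X in _ --> X]addr0 -(scale0r v).
      by apply: cvgD; [exact: cvg_cst|exact: cvgZ].
    by apply/funext => n; rewrite cE.
  exact: near_distinct_rows cc dc.
have gc := cvg_gradient hpeak cf densf dc ts0 tc vc vc.
set Q := second_derivative f c v v in gc.
have Q0 : 0 < Q by exact: pd.
have Sc : row_sqd (v_ (s n)) @[n --> \oo] --> row_sqd v.
  by apply: cvgr_sum => l _; exact: cvg_sqd_row.
have S0 := row_sqd_ge0 v; set S := row_sqd v in Sc S0.
(* Nearly the maximizer [Q / (2 S)] of [ep * Q - ep^2 * S], but defined also when [S = 0]. *)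
pose ep := Q / (2 * (S + 1)).
have := step_gain_gt0 Q0 S0; rewrite -/ep; apply/negP; rewrite -leNgt.
pose low n := ep * ((t_ (s n))^-1 * (gradient f (c + t_ (s n) *: v_ (s n)) (v_ (s n)) -
   gradient f c (v_ (s n)))) - ep ^+ 2 * row_sqd (v_ (s n)).
have lowc : low n @[n --> \oo] --> ep * Q - ep ^+ 2 * S.
  by apply: cvgB; apply: cvgM => //; exact: cvg_cst.
apply: (ler_cvg_to lowc harm); apply: filterS dcs => n dn.
have [_ h1] := hc (s n).
have h2 := risk_upper k0 hpeak cf densf ((- (ep * t_ (s n))) *: v_ (s n)) dn.
have h3 := oc (c_ (s n) + (- (ep * t_ (s n))) *: v_ (s n)).
rewrite (gradientZ hpeak cf densf) row_sqdZ sqrrN exprMn in h2.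
rewrite /low (gradient_optimal k0 hpeak cf densf _ dc oc) subr0 cE.
apply: le_trans (invs n); rewrite -/(t_ (s n)) in h1.
have {h2}h2 := le_trans h3 h2.
have tt0 : 0 < t_ (s n) ^+ 2 by rewrite exprn_gt0.
rewrite -(ler_pM2r tt0); apply: le_trans (ltW h1).
move: h2; set g := gradient _ _ _; set S' := row_sqd _; set A := risk P (c_ (s n)).
set b := risk P c; set t := t_ (s n); set iv := t^-1.
rewrite mulNr => h2.
have -> : (ep * (iv * g) - ep ^+ 2 * S') * t ^+ 2 = ep * t * g - ep ^+ 2 * t ^+ 2 * S'.
  by rewrite /iv; field; exact: t0.
exact: sub_rearrange h2.
Qed.

Lemma risk_lipschitz c c' (b : R) : `|c| <= b -> `|c'| <= b ->
  `|risk P c - risk P c'| <= d%:R * (2 + 2 * b) * `|c - c'|.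
Proof.
move=> cb cb'.
have H (e e' : 'M[R]_(k, d)) : `|e| <= b -> `|e'| <= b ->
    risk P e - risk P e' <= d%:R * (2 + 2 * b) * `|e - e'|.
  move=> eb eb'; rewrite lerBlDl !(risk_mean k0 cf densf).
  rewrite -[X in _ <= _ + X](mean_cst cf densf) -(meanD hpeak cf densf); last 2 first.
  - exact: tame_gamma.
  - exact: tame_cst.
  apply: (mean_le hpeak cf densf); first exact: tame_gamma.
    by apply: tameD; [exact: tame_gamma|exact: tame_cst].
  apply: aeW => x /closed_unit_ball_norm x1; rewrite -lerBlDl.
  by apply: (le_trans (ler_norm _)); exact: gamma_lipschitz.
rewrite ler_norml; apply/andP; split; last exact: H.
by rewrite lerNl opprB distrC; exact: H.
Qed.

Lemma risk_continuous : continuous (@risk R d P k).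
Proof.
move=> c; have FF := nbhs_filter c.
apply/(@cvgrPdist_le R R 'M[R]_(k, d) (nbhs c) FF) => e e0.
set K := d%:R * (2 + 2 * (`|c| + 1)); have K0 : 0 <= K by rewrite mulr_ge0// addr_ge0// mulr_ge0// addr_ge0.
have K1 : 0 < K + 1 by rewrite ltr_wpDl.
pose r := Num.min 1 (e / (K + 1)).
have r0 : 0 < r by rewrite lt_min ltr01 divr_gt0.
apply/nbhs_ballP; exists r => // c'; rewrite -ball_normE /= lt_min => /andP[/ltW h1 /ltW h2].
have h3 : `|c'| <= `|c| + 1.
  by have := ler_normB c (c - c'); rewrite subKr => /le_trans; apply; rewrite lerD2l.
have h4 : `|c| <= `|c| + 1 by rewrite lerDl.
apply: (le_trans (risk_lipschitz h4 h3)); rewrite -/K.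
apply: (@le_trans _ _ (K * (e / (K + 1)))); first exact: ler_wpM2l.
by rewrite mulrA ler_pdivrMr// mulrC ler_wpM2l ?ltW// ltrDl.
Qed.

Lemma nbhs_not_negligible (x : 'rV[R]_d) (A : set 'rV[R]_d) : nbhs x A -> ~ lam.-negligible A.
Proof.
move=> /nbhs_ballP[e /= e0 eA] [B [mB B0 AB]].
pose S := [set y : 'rV[R]_d | `|y - x| <= e / 2].
have mS : measurable S by exact: measurable_rV_ball.
have : (lam S <= lam B)%E.
  apply: le_measure; rewrite ?inE// => y Sy; apply/AB/eA.
  rewrite -ball_normE /= distrC; apply: (le_lt_trans Sy).
  by rewrite ltr_pdivrMr// mulr_natr mulr2n ltrDl.
by rewrite B0 lebesgue_rV_ball leNgt lebesgue_rV_box_gt0// divr_gt0.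
Qed.

Lemma mean_le0_ae_eq0 phi : tame phi -> (forall x, 0 <= phi x) -> mean f phi <= 0 ->
  {ae lam, forall x, phi x * f x = 0}.
Proof.
move=> tphi phi0 m0.
have [M [mpf _ _]] := tame_boxed hpeak cf densf tphi.
have Ipf := tame_integrable hpeak cf densf tphi.
have pf0 x : 0 <= phi x * f x by rewrite mulr_ge0//; case: densf.
have E0 : (\int[lam]_x (phi x * f x)%:E = 0)%E.
  rewrite (EFin_Rintegral Ipf); congr (_%:E); apply/eqP; rewrite eq_le m0/=.
  by apply: Rintegral_ge0.
have mE : measurable_fun setT (fun x => (phi x * f x)%:E) by exact/measurable_EFinP.
have := (ae_eq_integral_abs lam measurableT mE).1.
rewrite (eq_integral (fun x => (phi x * f x)%:E)); last by move=> x _; rewrite gee0_abs// lee_fin.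
move=> /(_ E0); apply: filterS => x /(_ I) => -[].
by [].
Qed.


(** If two centers coincide, one of them can be moved to a point [x0] of positive density that
    is not a center. The loss increases nowhere and decreases near [x0], which
    contradicts optimality. *)
Lemma optimal_distinct c : (0 < d)%N -> optimal P c -> distinct_rows c.
Proof.
move=> d0 oc i j ij; apply/negP => /eqP eij.
have gamma_ae0 : {ae lam, forall x, gamma c x != 0}.
  pose r0 : 'I_d := Ordinal d0.
  have : {ae lam, forall x : 'rV[R]_d, forall l : 'I_k, x 0 r0 - c l r0 != 0}.
    apply: filter_forall => l.
    apply: (@ae_affine_neq0 R d _ (delta_mx 0 r0) 1); rewrite ?oner_neq0//.
    - by apply: measurable_funB => //; exact: measurable_mx_entry.
    - by move=> x s; rewrite !mxE !eqxx mulr1; ring.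
  apply: filterS => x hx; have [l ->] := gamma_attained k0 c x.
  apply/negP => /eqP/sqd_eq0/rowP/(_ r0); rewrite !mxE => h.
  by have := hx l; rewrite h eqxx.
have [x0 fx0 gx0] : exists2 x0, 0 < f x0 & 0 < gamma c x0.
  apply: contrapT => nE.
  have fae : {ae lam, forall x, f x = 0}.
    apply: filterS gamma_ae0 => x gx; apply/eqP; rewrite eq_le (densf.1 x) andbT leNgt.
    apply/negP => fx; apply: nE; exists x => //.
    by rewrite lt_neqAle eq_sym gx gamma_ge0.
  have := mean_cst cf densf 1; rewrite /mean /Rintegral.
  rewrite (@ae_eq_integral _ _ _ lam setT (cst 0%E)) ?integral0//.
  - by move=> /eqP; rewrite eq_sym oner_eq0.
  - by apply/measurable_EFinP; apply: measurable_funM => //; exact: measurable_density.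
  - by apply: filterS fae => x h _ /=; rewrite h mulr0.
pose c0 : 'M[R]_(k, d) := \matrix_(l, r) (if l == i then x0 0 r else c l r).
have row0 l : l != i -> row l c0 = row l c.
  by move=> li; apply/rowP => r; rewrite !mxE (negbTE li).
have rowi : row i c0 = x0 by apply/rowP => r; rewrite !mxE eqxx.
have le0 x : gamma c0 x <= gamma c x.
  have [l ->] := gamma_attained k0 c x.
  have [->|li] := eqVneq l i; last by rewrite /qdist -row0//; exact: gamma_le.
  have ji : j != i by rewrite eq_sym.
  by rewrite /qdist eij -(row0 j ji); exact: gamma_le.
have t1 := tame_gamma k0 c; have t2 := tame_gamma k0 c0.
have t3 : tame (fun x => - 1 * gamma c0 x) by apply: tameM => //; exact: tame_cst.
have ae0 : {ae lam, forall x, (gamma c x + - 1 * gamma c0 x) * f x = 0}.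
  apply: mean_le0_ae_eq0; first exact: tameD.
    by move=> x; rewrite mulN1r subr_ge0.
  rewrite (meanD hpeak cf densf)// (meanZ hpeak cf densf)// mulN1r subr_le0.
  by rewrite -!(risk_mean k0 cf densf); exact: oc.
have near0 : \forall x \near x0, 0 < f x /\ gamma c0 x < gamma c x.
  have H1 : \forall x \near x0, 0 < f x.
    by have cfx : f y @[y --> x0] --> f x0 by [exact: cf]; apply: (cvgr_gt _ cfx).
  have H2 : \forall x \near x0, forall l, sqd (x - x0) < qdist c l x.
    have FF := nbhs_filter x0; apply: (@filter_forall _ _ _ (nbhs x0) FF) => l.
    have cl : qdist c l x - sqd (x - x0) @[x --> x0] --> qdist c l x0 - sqd (x0 - x0).
      have i2 : (fun x : 'rV[R]_d => x) x @[x --> x0] --> x0 by exact: cvg_id.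
      have q1 : qdist c l x @[x --> x0] --> qdist c l x0.
        by apply: cvg_qdist => //; exact: cvg_cst.
      have q2 : qdist (\matrix_(a < 1) x0) 0 x @[x --> x0] --> qdist (\matrix_(a < 1) x0) 0 x0.
        by apply: cvg_qdist => //; exact: cvg_cst.
      by apply: cvgB => //; move: q2; rewrite /qdist rowK.
    have cl0 : 0 < qdist c l x0 - sqd (x0 - x0).
      rewrite subrr [sqd 0]big1 ?subr0; first by apply: (lt_le_trans gx0); exact: gamma_le.
      by move=> r _; rewrite mxE mul0r.
    have : \forall x \near x0, 0 < qdist c l x - sqd (x - x0) by apply: (cvgr_gt _ cl).
    by apply: filterS => x; rewrite subr_gt0.
  apply: filterS2 H1 H2 => x fx hx; split => //.
  have [l ->] := gamma_attained k0 c x.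
  apply: le_lt_trans (hx l); rewrite -rowi; exact: (gamma_le c0 i x).
apply: (nbhs_not_negligible near0).
apply: negligibleS ae0 => x [fx gx] /= h; move/eqP: h.
by rewrite mulN1r mulf_eq0 (gt_eqF fx) orbF subr_eq0 (gt_eqF gx).
Qed.

End quadratic_growth.

(** * From local to uniform growth *)
(** If [K] does not have the property, the sets [K `\` B] with [Q B] generate a proper filter.
    It would cluster at a point of [K], which has a neighbourhood [U] with [Q U], although
    [K `\` U] belongs to the filter. *)
Lemma compact_induction (T : topologicalType) (K : set T) (Q : set T -> Prop) :
  compact K -> Q set0 -> (forall A B, Q A -> Q B -> Q (A `|` B)) ->
  (forall A B, A `<=` B -> Q B -> Q A) ->
  (forall x, K x -> exists2 U, nbhs x U & Q U) -> Q K.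
Proof.
move=> cK Q0 QU QS Qx; apply: contrapT => nQ.
pose F : set (set T) := [set A | exists2 B, Q B & K `\` B `<=` A].
have FF : ProperFilter F.
  apply: Build_ProperFilter_ex.
    move=> A [B QB KA]; apply: contrapT => nA; apply: nQ; apply: QS QB => x Kx.
    by apply: contrapT => nB; apply: nA; exists x; exact: KA.
  split; first by exists set0.
    move=> A1 A2 [B1 Q1 H1] [B2 Q2 H2]; exists (B1 `|` B2); first exact: QU.
    by move=> x [Kx nB]; split; [apply: H1|apply: H2]; split => // h; apply: nB; [left|right].
  by move=> A1 A2 A12 [B QB H]; exists B => // x /H/A12.
have FK : F K by exists set0 => // x [].
have [p [Kp clp]] := cK _ FF FK.
have [U pU QU'] := Qx p Kp.
have FU : F (K `\` U) by exists U.
by have [x [[_ nU] Ux]] := clp _ _ FU pU.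
Qed.

Section compact_growth.
Context {R : realType} {N : nat}.
Implicit Types (v m : 'rV[R]_N).

(** Near a point where [F] is positive it is bounded below, and any reference point will do,
    since distances in the ball of radius [b] are at most [2 b]. Near the other points
    the point itself is the reference. *)
Lemma compact_quadratic_growth (F : 'rV[R]_N -> R) (G : set 'rV[R]_N) (b : R) m0 :
  continuous F -> G m0 -> `|m0| <= b ->
  (forall v, `|v| <= b -> 0 < F v \/
    (G v /\ exists2 a, 0 < a & \forall v' \near v, a * `|v' - v| ^+ 2 <= F v')) ->
  exists2 a : R, 0 < a & exists ms : seq 'rV[R]_N,
    (forall m, m \in ms -> G m /\ `|m| <= b) /\
    forall v, `|v| <= b -> exists2 m, m \in ms & a * `|v - m| ^+ 2 <= F v.
Proof.
move=> cF Gm0 m0b hF.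
pose Q (A : set 'rV[R]_N) := exists2 a : R, 0 < a & exists ms : seq 'rV[R]_N,
  (forall m, m \in ms -> G m /\ `|m| <= b) /\
  forall v, A v -> `|v| <= b -> exists2 m, m \in ms & a * `|v - m| ^+ 2 <= F v.
suff [a a0 [ms [msG H]]] : Q [set v : 'rV[R]_N | `|v| <= b].
  by exists a => //; exists ms; split; [exact: msG|move=> v vb; exact: H].
apply: compact_induction.
- exact: compact_mx_box.
- by exists 1 => //; exists [::].
- move=> A B [a1 a10 [ms1 [G1 H1]]] [a2 a20 [ms2 [G2 H2]]].
  exists (Num.min a1 a2); first by rewrite lt_min a10.
  exists (ms1 ++ ms2); split => [m|v AB vb].
    by rewrite mem_cat => /orP[/G1|/G2].
  have mon (a' : R) m : Num.min a1 a2 <= a' -> a' * `|v - m| ^+ 2 <= F v ->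
      Num.min a1 a2 * `|v - m| ^+ 2 <= F v.
    by move=> aa; apply: le_trans; rewrite ler_wpM2r// exprn_ge0.
  case: AB => [/H1/(_ vb)[m mm h]|/H2/(_ vb)[m mm h]]; exists m.
  + by rewrite mem_cat mm.
  + by apply: mon h; rewrite ge_min lexx.
  + by rewrite mem_cat mm orbT.
  + by apply: mon h; rewrite ge_min lexx orbT.
- move=> A B AB [a a0 [ms [msG H]]]; exists a => //; exists ms; split => // v /AB.
  exact: H.
- move=> v vb; have [Fv|[Gv [a a0 av]]] := hF v vb; last first.
    exists [set v' | a * `|v' - v| ^+ 2 <= F v']; first exact: av.
    exists a => //; exists [:: v]; split => [m|v' h _].
      by rewrite inE => /eqP ->.
    by exists v => //; rewrite inE.
  have Fv2 : F v / 2 < F v by lra.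
  exists [set v' | F v / 2 < F v'].
    have cFv : F y @[y --> v] --> F v by exact: cF.
    by apply: (cvgr_gt _ cFv).
  have b0 : 0 <= b := le_trans (normr_ge0 _) vb.
  have K0 : 0 < (2 * b) ^+ 2 + 1 by rewrite ltr_wpDl// exprn_ge0// mulr_ge0.
  exists (F v / 2 / ((2 * b) ^+ 2 + 1)); first by rewrite !divr_gt0.
  exists [:: m0]; split => [m|v' h vb']; first by rewrite inE => /eqP ->.
  exists m0; first by rewrite inE.
  apply: le_trans (ltW h); rewrite mulrAC ler_pdivrMr// ler_wpM2l ?divr_ge0// ?ltW//.
  apply: (@le_lt_trans _ _ ((2 * b) ^+ 2)); last by rewrite ltrDl.
  rewrite lerXn2r ?nnegrE ?mulr_ge0//; apply: (le_trans (ler_normB _ _)).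
  by rewrite mulr_natl mulr2n lerD.
Qed.

End compact_growth.

(** * Reduction to bounded codebooks *)
Section truncation.
Context {R : realType} {d k : nat}.
Hypothesis k0 : (0 < k)%N.
Implicit Types (c : 'M[R]_(k, d)) (x y : 'rV[R]_d).

Lemma sqdD_le x y : sqd (x + y) <= 2 * sqd x + 2 * sqd y.
Proof. by have := sqd_ge0 (x - y); rewrite /sqd !dotvE [dotv y x]dotvC; lra. Qed.

(** Some center [j0] has squared distance at most [2] to a point of the unit ball, hence
    squared norm at most [2 * 2 + 2 * 1 = 6] and squared distance at most
    [2 * 1 + 2 * 6 = 14] to every point of the ball. A center of squared norm above
    [30] has squared distance at least [30 / 2 - 1 = 14] to the ball: it is never strictly
    the nearest, and may be replaced by [j0]. The bound [6] comes from [30 <= 6^2]. *)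
Lemma gamma_truncation c x0 : closed_unit_ball x0 -> gamma c x0 <= 2 ->
  exists2 c' : 'M[R]_(k, d), `|c'| <= 6 & forall x, closed_unit_ball x -> gamma c' x = gamma c x.
Proof.
move=> /closed_unit_ballE bx0; have [j0 ->] := gamma_attained k0 c x0.
rewrite /qdist => q0.
have r0 : sqd (row j0 c) <= 6.
  have := sqdD_le x0 (- (x0 - row j0 c)).
  rewrite subKr => /le_trans; apply.
  by move: q0; rewrite [sqd (- _)]/sqd dotvNl dotvNr opprK -/(sqd _); lra.
pose c' : 'M[R]_(k, d) := \matrix_(j, r) (if sqd (row j c) <= 30 then c j r else c j0 r).
have rowc' j : row j c' = if sqd (row j c) <= 30 then row j c else row j0 c.
  by apply/rowP => r; rewrite !mxE; case: ifP => h; rewrite !mxE.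
exists c'.
  apply: mx_norm_le => // j r.
  have -> : c' j r = (row j c') 0 r by rewrite [RHS]mxE.
  apply: (le_trans (mx_norm_entry _ _ _)).
  rewrite -(@ler_pXn2r _ 2)// ?nnegrE//; apply: (le_trans (mx_norm_sqd _)).
  by rewrite rowc'; case: ifP => h; lra.
move=> x /closed_unit_ballE bx; apply/eqP; rewrite eq_le; apply/andP; split.
  apply: (le_gamma k0) => j.
  have [gj|bj] := boolP (sqd (row j c) <= 30).
    apply: (le_trans (gamma_le c' j x)); by rewrite /qdist rowc' gj.
  apply: (le_trans (gamma_le c' j0 x)); rewrite /qdist rowc' (le_trans r0) ?ler_nat//.
  have h1 := sqdD_le x (- row j0 c).
  have h2 := sqdD_le x (- (x - row j c)).
  rewrite subKr in h2; move: bj; rewrite -ltNge => bj.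
  move: h1 h2; rewrite ![sqd (- _)]/sqd !dotvNl !dotvNr !opprK -!/(sqd _).
  by move=> h1 h2; lra.
apply: (le_gamma k0) => j; rewrite /qdist rowc'.
by case: ifP => _; exact: (gamma_le c).
Qed.

End truncation.

Section clamping.
Context {R : realType} {d k : nat}.
Hypothesis k0 : (0 < k)%N.

Definition clamp (b t : R) : R := Num.max (- b) (Num.min t b).

Lemma clamp_bounded b t : 0 <= b -> `|clamp b t| <= b.
Proof.
move=> b0; rewrite /clamp ler_norml le_max lexx/= ge_max ge_min lexx orbT andbT.
by lra.
Qed.

Lemma clamp_id b t : `|t| <= b -> clamp b t = t.
Proof.
by rewrite ler_norml /clamp => /andP[h1 h2]; rewrite (min_idPl h2) (max_idPr h1).
Qed.

Lemma clamp_lipschitz b s t : `|clamp b s - clamp b t| <= `|s - t|.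
Proof.
have h1 := ler_norm (s - t); have h2 := ler_norm (t - s); rewrite distrC in h2.
rewrite /clamp ler_norml; case: (leP s b) => ?; case: (leP t b) => ?.
all: case: (leP (- b) s) => ?; case: (leP (- b) t) => ?; case: (leP (- b) b) => ?.
all: by apply/andP; split; lra.
Qed.

Lemma mx_norm_vec_mx (v : 'rV[R]_(k * d)) : `|vec_mx v : 'M[R]_(k, d)| <= `|v|.
Proof. by apply: mx_norm_le => // i j; rewrite mxE mx_norm_entry. Qed.

Lemma mx_norm_mxvec (c : 'M[R]_(k, d)) : `|mxvec c| <= `|c|.
Proof.
apply: mx_norm_le => // i j; rewrite ord1.
by case/mxvec_indexP: j => a b; rewrite mxvecE mx_norm_entry.
Qed.

Lemma mx_norm_vec_mxB (v v' : 'rV[R]_(k * d)) :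
  `|v - v'| <= `|(vec_mx v : 'M[R]_(k, d)) - vec_mx v'|.
Proof.
apply: mx_norm_le => // i j; rewrite ord1; case/mxvec_indexP: j => a b.
by have := mx_norm_entry ((vec_mx v : 'M[R]_(k, d)) - vec_mx v') a b; rewrite !mxE.
Qed.

Lemma vec_mx_continuous : continuous (vec_mx : 'rV[R]_(k * d) -> 'M[R]_(k, d)).
Proof.
move=> v; have FF := nbhs_filter v.
apply/(@cvgrPdist_le R _ _ (nbhs v) FF) => e e0.
apply/nbhs_ballP; exists e => // v'; rewrite -ball_normE /= => /ltW.
by apply: le_trans; rewrite -linearB; exact: mx_norm_vec_mx.
Qed.

(** The quantization loss is only locally bounded and locally Lipschitz; clamping the entries
    of the codebook and cutting the loss off outside the unit ball makes it globally so, and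
    changes nothing for the bounded codebooks and the samples of interest. *)
Definition clamped_codebook (b : R) (v : 'rV[R]_(k * d)) : 'M[R]_(k, d) :=
  map_mx (clamp b) (vec_mx v).

Definition clamped_loss b v (x : 'rV[R]_d) : R :=
  gamma (clamped_codebook b v) x * \1_closed_unit_ball x.

Lemma clamped_codebook_bounded b v : 0 <= b -> `|clamped_codebook b v| <= b.
Proof. by move=> b0; apply: mx_norm_le => // i j; rewrite mxE clamp_bounded. Qed.

Lemma clamped_codebook_id b v : `|v| <= b -> clamped_codebook b v = vec_mx v.
Proof.
move=> vb; apply/matrixP => i j; rewrite mxE clamp_id// (le_trans (mx_norm_entry _ _ _))//.
exact: le_trans (mx_norm_vec_mx _) vb.
Qed.

Lemma clamped_codebook_lipschitz b v v' :
  `|clamped_codebook b v - clamped_codebook b v'| <= `|v - v'|.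
Proof.
apply: mx_norm_le => // i j; rewrite !mxE; apply: (le_trans (clamp_lipschitz _ _ _)).
by apply: le_trans (mx_norm_entry _ 0 (mxvec_index i j)); rewrite !mxE.
Qed.

Lemma clamped_loss_in b v x : closed_unit_ball x ->
  clamped_loss b v x = gamma (clamped_codebook b v) x.
Proof. by move=> bx; rewrite /clamped_loss indicE mem_set// mulr1. Qed.

Lemma clamped_loss_out b v x : ~ closed_unit_ball x -> clamped_loss b v x = 0.
Proof. by move=> bx; rewrite /clamped_loss indicE memNset// mulr0. Qed.

Lemma measurable_clamped_loss b v : measurable_fun setT (clamped_loss b v).
Proof.
apply: measurable_funM; first exact: measurable_gamma.
by apply: measurable_indic; exact: measurable_closed_unit_ball.
Qed.

Lemma clamped_loss_lipschitz b v v' x : 0 <= b ->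
  `|clamped_loss b v x - clamped_loss b v' x| <= d%:R * (2 + 2 * b) * `|v - v'|.
Proof.
move=> b0; have [bx|nbx] := pselect (closed_unit_ball x); last first.
  by rewrite !clamped_loss_out// subrr normr0 !mulr_ge0// addr_ge0// mulr_ge0.
rewrite !clamped_loss_in//; apply: (le_trans (gamma_lipschitz k0
  (closed_unit_ball_norm bx) (clamped_codebook_bounded v b0) (clamped_codebook_bounded v' b0))).
by rewrite ler_wpM2l ?clamped_codebook_lipschitz// mulr_ge0// addr_ge0// mulr_ge0.
Qed.

Lemma clamped_loss_bounded b v x : 0 <= b -> `|clamped_loss b v x| <= d%:R * (1 + b) ^+ 2.
Proof.
move=> b0; have [bx|nbx] := pselect (closed_unit_ball x); last first.
  by rewrite clamped_loss_out// normr0 mulr_ge0// sqr_ge0.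
rewrite clamped_loss_in// ger0_norm ?gamma_ge0//.
exact: gamma_bounded (closed_unit_ball_norm bx) (clamped_codebook_bounded v b0).
Qed.

End clamping.

Section risk_reduction.
Context {R : realType} {d k : nat}.
Variables (P : probability 'rV[R]_d R) (f : 'rV[R]_d -> R).
Hypotheses (k0 : (0 < k)%N) (hpeak : P closed_unit_ball = 1%E) (cf : continuous f)
  (densf : is_density P f).
Implicit Types (c : 'M[R]_(k, d)).

Lemma mean_eq phi psi : tame phi -> tame psi ->
  (forall x, closed_unit_ball x -> phi x = psi x) -> mean f phi = mean f psi.
Proof.
move=> tphi tpsi h; apply/eqP; rewrite eq_le; apply/andP.
by split; apply: (mean_le hpeak cf densf) => //; apply: aeW => x /h ->.
Qed.

Lemma risk_eq c c' : (forall x, closed_unit_ball x -> gamma c x = gamma c' x) ->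
  risk P c = risk P c'.
Proof.
by move=> h; rewrite !(risk_mean k0 cf densf); apply: mean_eq => //; exact: tame_gamma.
Qed.

Lemma Rintegral_clamped_loss (b : R) v : `|v| <= b ->
  \int[P]_x clamped_loss b v x = risk P (vec_mx v : 'M[R]_(k, d)).
Proof.
move=> vb; have b0 := le_trans (normr_ge0 _) vb.
rewrite (Rintegral_density cf densf); last exact: measurable_clamped_loss.
rewrite (risk_mean k0 cf densf); apply: mean_eq; last 2 first.
- exact: tame_gamma.
- by move=> x bx; rewrite clamped_loss_in// clamped_codebook_id.
split; first exact: measurable_clamped_loss.
by exists (d%:R * (1 + b) ^+ 2) => x _; exact: clamped_loss_bounded.
Qed.

Lemma gamma0_le x : closed_unit_ball x -> gamma (0 : 'M[R]_(k, d)) x <= 1.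
Proof.
move=> /closed_unit_ballE; apply: le_trans.
by rewrite (le_trans (gamma_le _ (Ordinal k0) _))// /qdist linear0 subr0.
Qed.


(** The zero codebook has risk at most [1], so an optimal codebook cannot have a loss above [2]
    on the whole ball. *)
Lemma optimal_gamma_le c : optimal P c -> exists2 x, closed_unit_ball x & gamma c x <= 2.
Proof.
move=> oc; apply: contrapT => nx.
have h1 : risk P (0 : 'M[R]_(k, d)) <= 1.
  rewrite (risk_mean k0 cf densf) -[leRHS](mean_cst cf densf).
  apply: (mean_le hpeak cf densf); [exact: tame_gamma|exact: tame_cst|].
  by apply: aeW => x; exact: gamma0_le.
have h2 : 2 <= risk P c.
  rewrite (risk_mean k0 cf densf) -[leLHS](mean_cst cf densf).
  apply: (mean_le hpeak cf densf); [exact: tame_cst|exact: tame_gamma|].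
  apply: aeW => x bx; rewrite leNgt; apply/negP => h; apply: nx.
  by exists x => //; exact: ltW.
by have := le_trans h2 (le_trans (oc 0) h1); lra.
Qed.

Lemma minimizer_gamma_le n (x : 'I_n -> 'rV[R]_d) c : (0 < n)%N ->
  (forall i, closed_unit_ball (x i)) -> empirical_risk_minimizer x c ->
  exists2 i, closed_unit_ball (x i) & gamma c (x i) <= 2.
Proof.
move=> n0 bx ec; apply: contrapT => nE.
have n0' : 0 < n%:R^-1 :> R by rewrite invr_gt0 ltr0n.
have := ec 0; rewrite /empirical_risk ler_pM2l//; apply/negP; rewrite -ltNge.
apply: (@le_lt_trans _ _ (\sum_(i < n) 1)); first by apply: ler_sum => i _; exact: gamma0_le.
apply: (@lt_le_trans _ _ (\sum_(i < n) 2)).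
  by rewrite !sumr_const card_ord ltr_pMn2r// ltr1n.
apply: ler_sum => i _; rewrite leNgt; apply/negP => h; apply: nE.
by exists i => //; exact: ltW.
Qed.


(** The basic inequality of empirical risk minimization: the excess risk is a difference of
    empirical risks, which is not positive, plus an increment of the centered mean. *)
Lemma excess_le_centered_mean (b : R) n (x : 'I_n -> 'rV[R]_d) (v m : 'rV[R]_(k * d)) :
  (0 < n)%N -> `|v| <= b -> `|m| <= b -> (forall i, closed_unit_ball (x i)) ->
  empirical_risk x (vec_mx v : 'M[R]_(k, d)) <= empirical_risk x (vec_mx m : 'M[R]_(k, d)) ->
  risk P (vec_mx v : 'M[R]_(k, d)) - risk P (vec_mx m : 'M[R]_(k, d)) <=
  centered_mean P (clamped_loss b) x m - centered_mean P (clamped_loss b) x v.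
Proof.
move=> n0 vb mb bx ev.
have cE u : `|u| <= b -> centered_mean P (clamped_loss b) x u =
    empirical_risk x (vec_mx u : 'M[R]_(k, d)) - risk P (vec_mx u : 'M[R]_(k, d)).
  move=> ub; rewrite /centered_mean /empirical_risk Rintegral_clamped_loss//.
  have nr (r : R) : n%:R^-1 * (r *+ n) = r by rewrite -(mulr_natl r n) mulKf ?pnatr_eq0 -?lt0n.
  rewrite sumrB sumr_const card_ord mulrBr nr.
  congr (_ * _ - _); apply: eq_bigr => i _.
  by rewrite clamped_loss_in// clamped_codebook_id.
rewrite !cE//; move: ev; set A := empirical_risk _ _; set B := empirical_risk _ _.
by set A' := risk _ _; set B' := risk _ _; lra.
Qed.

End risk_reduction.

(** * The fast rate for empirically optimal codebooks *)
Section global_growth.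
Context {R : realType} {d k : nat}.
Variables (P : probability 'rV[R]_d R) (f : 'rV[R]_d -> R).
Hypotheses (k0 : (0 < k)%N) (d0 : (0 < d)%N) (hpeak : P closed_unit_ball = 1%E)
  (cf : continuous f) (densf : is_density P f).
Hypothesis pd : forall c : 'M[R]_(k, d), optimal P c ->
  posdefmx (hessian (fun v : 'rV[R]_(k * d) => risk P (vec_mx v)) (mxvec c)).
Implicit Types (c : 'M[R]_(k, d)).

Lemma second_derivative_gt0 c (h : 'M[R]_(k, d)) : distinct_rows c -> optimal P c ->
  h != 0 -> 0 < second_derivative f c h h.
Proof.
move=> dc oc h0; have hn0 : mxvec h != 0.
  by apply: contra h0 => /eqP h0; rewrite -[h]mxvecK h0 linear0.
rewrite -{1 2}[h]mxvecK -(hessian_quadratic k0 hpeak cf densf (mxvec h) dc).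
exact: (pd oc hn0).
Qed.

Lemma near_vec_mx (v : 'rV[R]_(k * d)) (A : set 'M[R]_(k, d)) :
  nbhs (vec_mx v : 'M[R]_(k, d)) A -> nbhs v [set v' | A (vec_mx v')].
Proof. exact: vec_mx_continuous. Qed.

Lemma optimal_quadratic_growth v : optimal P (vec_mx v : 'M[R]_(k, d)) ->
  exists2 a : R, 0 < a & \forall v' \near v,
    a * `|v' - v| ^+ 2 <= risk P (vec_mx v' : 'M[R]_(k, d)) - risk P (vec_mx v : 'M[R]_(k, d)).
Proof.
move=> ov; have dc := optimal_distinct k0 hpeak cf densf d0 ov.
have [a a0 H] := quadratic_growth k0 hpeak cf densf dc ov
  (fun h => @second_derivative_gt0 _ h dc ov).
exists a => //; apply: filterS (near_vec_mx H) => v'; apply: le_trans.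
apply: ler_wpM2l; first exact: ltW.
by rewrite lerXn2r ?nnegrE//; exact: mx_norm_vec_mxB.
Qed.


(** Truncation does not change the loss on the ball, hence not the risk. *)
Lemma truncated_optimal c : optimal P c ->
  exists2 v : 'rV[R]_(k * d), `|v| <= 6 & optimal P (vec_mx v : 'M[R]_(k, d)).
Proof.
move=> oc; have [x bx gx] := optimal_gamma_le k0 hpeak cf densf oc.
have [c' c'6 gE] := gamma_truncation k0 bx gx.
exists (mxvec c'); first exact: le_trans (mx_norm_mxvec _) c'6.
by rewrite mxvecK => e; rewrite (risk_eq k0 hpeak cf densf gE).
Qed.

Lemma global_quadratic_growth c : optimal P c ->
  exists2 a : R, 0 < a & exists ms : seq 'rV[R]_(k * d),
    (forall m, m \in ms -> optimal P (vec_mx m : 'M[R]_(k, d)) /\ `|m| <= 6) /\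
    forall v : 'rV[R]_(k * d), `|v| <= 6 -> exists2 m, m \in ms &
      a * `|v - m| ^+ 2 <= risk P (vec_mx v : 'M[R]_(k, d)) - risk P c.
Proof.
move=> oc; have [m0 m06 om0] := truncated_optimal oc.
apply: (@compact_quadratic_growth R _ (fun v => risk P (vec_mx v : 'M[R]_(k, d)) - risk P c)
  (fun v => optimal P (vec_mx v : 'M[R]_(k, d))) _ m0) => //.
  move=> v; apply: (@cvgB _ _ _ (nbhs v)); last exact: cvg_cst.
  apply: (@continuous_comp _ _ _ (vec_mx : 'rV[R]_(k * d) -> 'M[R]_(k, d)) (@risk R d P k)).
    exact: vec_mx_continuous.
  exact: (risk_continuous k0 hpeak cf densf).
move=> v v6.
have [vc|cv] := ltP (risk P c) (risk P (vec_mx v : 'M[R]_(k, d))).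
  by left; rewrite subr_gt0.
have ov : optimal P (vec_mx v : 'M[R]_(k, d)) by move=> e; exact: le_trans cv (oc e).
right; split; first exact: ov.
have E : risk P c = risk P (vec_mx v : 'M[R]_(k, d)).
  by apply/eqP; rewrite eq_le; apply/andP; split; [exact: oc|exact: cv].
have [a a0 H] := optimal_quadratic_growth ov; exists a; first exact: a0.
by apply: filterS H => v'; rewrite -E.
Qed.

Lemma sample_in_ball dO (Omega : measurableType dO) (Pr : probability Omega R) n
    (X : 'I_n -> {RV Pr >-> 'rV[R]_d}) : iid P X ->
  {ae Pr, forall w, forall i, closed_unit_ball (X i w)}.
Proof.
move=> [_ dX]; apply: filter_forall => i.
have mB := @measurable_closed_unit_ball R d.
exists (X i @^-1` (~` closed_unit_ball)); split.
- by rewrite -[Y in measurable Y]setTI; apply: measurable_funP => //; exact: measurableC.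
- have P0 : P (~` closed_unit_ball) = 0%E by rewrite probability_setC// hpeak subee.
  by have := dX i _ (measurableC mB); rewrite P0.
- by move=> w /=; apply.
Qed.

End global_growth.

Theorem theorem3p1 (R : realType) (k d : nat) (hk : (0 < k)%N) (hd : (0 < d)%N)
    (P : probability 'rV[R]_d R)
    (hpeak : P closed_unit_ball = 1%E) (hreg : pollard_regular P k) :
  exists2 C0 : R, 0 < C0 &
    forall (n : nat), (0 < n)%N ->
    forall (dO : measure_display) (Omega : measurableType dO)
      (Pr : probability Omega R) (X : 'I_n -> {RV Pr >-> 'rV[R]_d})
      (chat : {RV Pr >-> 'M[R]_(k, d)}),
      iid P X ->
      (forall w, empirical_risk_minimizer (fun i => X i w) (chat w)) ->
      forall cstar : 'M[R]_(k, d), optimal P cstar ->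
        ('E_Pr[fun w => excess_risk P (chat w) cstar] <= (C0 / n%:R)%:E)%E.
Proof.
have [[c0 oc0]|noc] := pselect (exists c : 'M[R]_(k, d), optimal P c); last first.
  by exists 1 => // n _ dO Omega Pr X chat _ _ c oc; case: noc; exists c.
have [[f cf densf] pd] := hreg.
have [a a0 [ms [msP growth]]] := global_quadratic_growth hk hd hpeak cf densf pd oc0.
have b0 : 0 <= 6 :> R by [].
have L0 : 0 <= d%:R * (2 + 2 * 6) :> R by rewrite mulr_ge0.
(* Two codebooks in the ball of radius [6] are at distance at most [12]. *)
have [C0 C00 fast] := erm_fast_rate P 12 ms (@measurable_clamped_loss R d k hk 6)
  (fun v v' x => clamped_loss_lipschitz hk v v' x b0)
  (fun v x => clamped_loss_bounded hk v x b0) L0 a0.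
exists C0 => // n n0 dO Omega Pr X chat iidX erm cstar ocs.
rewrite unlock; apply: (fast n n0 _ _ Pr X iidX).
- apply: measurable_funB => //.
  apply: (@measurableT_comp _ _ _ _ _ _ (@risk R d P k)); last exact: measurable_funP.
  exact: continuous_measurable_mx (risk_continuous hk hpeak cf densf).
- by move=> w; rewrite subr_ge0; exact: ocs.
apply: filterS (sample_in_ball hpeak iidX) => w bX.
(* The minimizer itself may be unbounded; its truncation [c'] has the same losses. *)
have [i bi gi] := minimizer_gamma_le hk n0 bX (erm w).
have [c' c'6 gE] := gamma_truncation hk bi gi.
have v6 : `|mxvec c'| <= 6 := le_trans (mx_norm_mxvec c') c'6.
have [m mms grow] := growth _ v6.
have [om m6] := msP m mms.
have r0s : risk P c0 = risk P cstar.
  by apply/eqP; rewrite eq_le; apply/andP; split; [exact: oc0|exact: ocs].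
have rms : risk P (vec_mx m : 'M[R]_(k, d)) = risk P cstar.
  by apply/eqP; rewrite eq_le; apply/andP; split; [exact: om|exact: ocs].
rewrite mxvecK in grow.
have rc : risk P (chat w) = risk P c' by apply/esym/(risk_eq hk hpeak cf densf gE).
have excess : excess_risk P (chat w) cstar = risk P c' - risk P c0.
  by rewrite /excess_risk rc r0s.
exists m; first exact: mms.
exists (mxvec c'); split; first 1 last.
- by rewrite excess; exact: grow.
- have := excess_le_centered_mean hk hpeak cf densf n0 v6 m6 bX.
  rewrite mxvecK excess r0s -rms; apply.
  rewrite (_ : empirical_risk _ c' = empirical_risk (fun i => X i w) (chat w)); first exact: erm.
  by rewrite /empirical_risk; congr (_ * _); apply: eq_bigr => j _; exact: gE.
- by apply: (le_trans (ler_normB _ _)); apply: (le_trans (lerD v6 m6)); rewrite -natrD.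
Qed.
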